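(* Let $R>1$ and $X=\{z\in\mathbb{C} : R^{-1}\le |z|\le R\}$. Let $K(R)$ (respectively $K_{cb}(R)$) denote the smallest constant $C$ such that $X$ is a $C$-spectral set (respectively a complete $C$-spectral set) for every invertible bounded linear operator $A$ on a complex Hilbert space satisfying $\|A\|\le R$ and $\|A^{-1}\|\le R$. Then $$\frac{2}{1+R^{-2}} < K(R)\le K_{cb}(R)\le 2+\min\left(\sqrt{\frac{R^2+2R+1}{R^2+R+1}},\ \sqrt{\frac{R^2+1}{R^2-1}}\right)\le 2+\frac{2}{\sqrt{3}}<3.2 .$$
   Context: For a complex Hilbert space $H$, $\mathcal{L}(H)$ denotes the bounded linear operators on $H$. For a closed set $X\subset\mathbb{C}$, $R(X)$ is the algebra of bounded rational functions on $X$ (so their poles lie outside $X$), with norm $\|f\|_X=\sup\{|f(x)| : x\in X\}$. For $A\in\mathcal{L}(H)$ with spectrum $\sigma(A)\subset X$ and $f=p/q\in R(X)$, put $f(A)=p(A)q(A)^{-1}$. For a constant $K>0$, $X$ is a $K$-spectral set for $A$ if $\sigma(A)\subset X$ and $\|f(A)\|\le K\|f\|_X$ for every $f\in R(X)$. For an $n\times n$ matrix $(f_{ij})\in M_n(R(X))$ put $\|(f_{ij})\|_X=\sup\{\|(f_{ij}(x))\| : x\in X\}$, where $\|(f_{ij}(x))\|$ is the operator norm on the Hilbert space $\mathbb{C}^n$; an element $(A_{ij})\in M_n(\mathcal{L}(H))$ is normed as an operator on the direct sum of $n$ copies of $H$. $X$ is a complete $K$-spectral set for $A$ if $\sigma(A)\subset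 X$ and $\|(f_{ij}(A))\|\le K\|(f_{ij})\|_X$ for every $n\ge 1$ and every $(f_{ij})\in M_n(R(X))$. In the definition of $K(R)$ and $K_{cb}(R)$, the operator $A$ ranges over all complex Hilbert spaces $H$. *)

(* Defs.v *)
From HB Require Import structures.
From mathcomp Require Import all_boot all_order all_algebra.
From mathcomp Require Import all_classical all_reals all_analysis.
From mathcomp Require Import complex.
Set Implicit Arguments.
Unset Strict Implicit.
Unset Printing Implicit Defensive.
Import Order.TTheory GRing.Theory Num.Theory.
Import numFieldNormedType.Exports.
Local Open Scope classical_set_scope.
Local Open Scope ring_scope.

(* Norms over R[i] take (real, nonnegative) values in R[i]; suprema and square
   roots need them in R. *)
Definition rnorm (R : realType) (V : normedZmodType R[i]) (x : V) : R :=
  complex.Re `|x|.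

HB.mixin Record isHilbert (R : realType) T of CompleteNormedModule R[i] T := {
  hinner : {dot T for @Num.conj R[i]} ;
  hinnerE : forall x : T, hinner x x = `|x| ^+ 2
}.

#[short(type="hilbertType")]
HB.structure Definition Hilbert (R : realType) :=
  { T of isHilbert R T & CompleteNormedModule R[i] T }.

Section Operators.
Variables (R : realType) (H : hilbertType R).
Implicit Types (A B : H -> H).

Definition bounded_operator : set (H -> H) :=
  [set A | linear A /\ bounded_near A (nbhs (0 : H))].

Definition opnorm A : R :=
  sup [set rnorm (A x) | x in [set x : H | rnorm x <= 1]].

Definition is_opinv A B : Prop :=
  [/\ bounded_operator B, A \o B = id & B \o A = id].

Definition op_invertible A : Prop := exists B, is_opinv A B.

(* The zero map when A is not invertible. *)
Definition opinv A : H -> H := xget (fun=> 0) [set B | is_opinv A B].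

Definition spectrum A : set R[i] :=
  [set z | ~ op_invertible (fun x => A x - z *: x)].

Definition op_poly (p : {poly R[i]}) A : H -> H :=
  fun x => \sum_(i < size p) p`_i *: iter i A x.

End Operators.

Section RationalFunctions.
Variable R : realType.

(* A pair (p, q) stands for the rational function p / q; it need not be in
   lowest terms. *)
Definition ratfun : Type := ({poly R[i]} * {poly R[i]})%type.

Definition rat_eval (f : ratfun) (z : R[i]) : R[i] := f.1.[z] / f.2.[z].

Definition rat_bounded (X : set R[i]) : set ratfun :=
  [set f | [/\ f.2 != 0, forall z, X z -> f.2.[z] != 0 &
    exists M : R, forall z, X z -> rnorm (rat_eval f z) <= M]].

Definition rat_supnorm (X : set R[i]) (f : ratfun) : R :=
  sup [set rnorm (rat_eval f z) | z in X].

Definition rat_op (H : hilbertType R) (f : ratfun) (A : H -> H) : H -> H :=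
  op_poly f.1 A \o opinv (op_poly f.2 A).

End RationalFunctions.

Section Matrices.
Variables (R : realType) (n : nat).

(* The norm of the direct sum of n copies of V; C^n when V = R[i]. *)
Definition l2norm (V : normedZmodType R[i]) (x : 'cV[V]_n) : R :=
  Num.sqrt (\sum_(i < n) rnorm (x i 0) ^+ 2).

Definition mx_norm (M : 'M[R[i]]_n) : R :=
  sup [set l2norm (M *m x) | x in [set x : 'cV[R[i]]_n | l2norm x <= 1]].

Definition opmx_apply (H : hilbertType R) (T : 'M[H -> H]_n) (x : 'cV[H]_n) :
    'cV[H]_n :=
  \col_i \sum_(j < n) T i j (x j 0).

Definition opmx_norm (H : hilbertType R) (T : 'M[H -> H]_n) : R :=
  sup [set l2norm (opmx_apply T x) | x in [set x : 'cV[H]_n | l2norm x <= 1]].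

Definition ratmx_supnorm (X : set R[i]) (F : 'M[ratfun R]_n) : R :=
  sup [set mx_norm (\matrix_(i, j) rat_eval (F i j) z) | z in X].

Definition ratmx_op (H : hilbertType R) (F : 'M[ratfun R]_n) (A : H -> H) :
    'M[H -> H]_n :=
  \matrix_(i, j) rat_op (F i j) A.

End Matrices.

Definition spectral_set (R : realType) (H : hilbertType R) (K : R)
    (X : set R[i]) (A : H -> H) : Prop :=
  [/\ 0 < K, spectrum A `<=` X &
    forall f : ratfun R, rat_bounded X f ->
      opnorm (rat_op f A) <= K * rat_supnorm X f].

Definition complete_spectral_set (R : realType) (H : hilbertType R) (K : R)
    (X : set R[i]) (A : H -> H) : Prop :=
  [/\ 0 < K, spectrum A `<=` X &
    forall (n : nat) (F : 'M[ratfun R]_n), (0 < n)%N ->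
      (forall i j, rat_bounded X (F i j)) ->
      opmx_norm (ratmx_op F A) <= K * ratmx_supnorm X F].

Section Annulus.
Variable R : realType.
Implicit Type r : R.

Definition annulus r : set R[i] := [set z : R[i] | r^-1 <= rnorm z <= r].

Definition annulus_operator (H : hilbertType R) r (A : H -> H) : Prop :=
  [/\ bounded_operator A, op_invertible A, opnorm A <= r &
    opnorm (opinv A) <= r].

Definition spectral_constants r : set R :=
  [set K | forall (H : hilbertType R) (A : H -> H),
    annulus_operator r A -> spectral_set K (annulus r) A].

Definition complete_spectral_constants r : set R :=
  [set K | forall (H : hilbertType R) (A : H -> H),
    annulus_operator r A -> complete_spectral_set K (annulus r) A].

(* The smallest elements of these sets, provided that they exist; inf alone
   does not assert that it is attained (see is_least). *)
Definition Kspec r : R := inf (spectral_constants r).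
Definition Kcb r : R := inf (complete_spectral_constants r).

Definition is_least (S : set R) (c : R) : Prop := S c /\ lbound S c.

End Annulus.

(* Main.v *)
Require Import Defs.
From HB Require Import structures.
From mathcomp Require Import all_boot all_order all_algebra.
From mathcomp Require Import all_classical all_reals all_analysis.
From mathcomp Require Import complex cyclic separable cyclotomic.
From mathcomp Require Import ring lra zify.
Set Implicit Arguments.
Unset Strict Implicit.
Unset Printing Implicit Defensive.
Import Order.TTheory GRing.Theory Num.Theory.
Import numFieldNormedType.Exports.
Local Open Scope classical_set_scope.
Local Open Scope ring_scope.

(** Upper bound. Let [B = A^-1] and let [F = \sum_l a_l z ^ l] be a matrix of Laurent
    polynomials, bounded by [S] on the annulus. Let [T1] be the average over the unit
    circle of [F (r w)] against the operator Poisson kernel of [r^-1 A], and [T2] that of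
    [F (r^-1 w^-1)] against the kernel of [r^-1 B]. Comparison of coefficients gives
    [F (A) = T1 + T2 - E], where the remainder [E] is the sum of the [a_l] times
    [r ^- (2 |l|)] times the adjoint of [A ^ (- l)] ([laurent_form_le]). As [r^-1 A] and
    [r^-1 B] are contractions, both kernels are positive, and the norms of [T1] and
    [T2] are at most [S] ([contraction_le]). This accounts for the 2 in the bound; the
    minimum comes from two estimates of [E].
    - Cauchy-Schwarz and Parseval give the square root of
      [\sum_l r ^- (2 |l|) = (r ^+ 2 + 1) / (r ^+ 2 - 1)] ([remainder_parseval_le]).
    - The kernel of [E] is [\sum_l r ^- (2 |l|) U ^ l] with [U = w^-1 A], which is a
      multiple of the inverse of [r ^+ 2 + r ^- 2 - U - U^-1]. The numerical range of the
      latter lies in the sector around the positive half-line whose half-angle has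
      sine [(r + r^-1)^-1] ([numerical_range_le]). A sectorial kernel behaves like a
      positive one, up to the inverse of the cosine of the half-angle
      ([remainder_sector_le]), and this is below the other term of the minimum
      ([sector_constant_le]).

    Operators enter through the forms [hinner (T x) y] only, so no adjoint has to be
    constructed, and positive kernels are families of positive semidefinite forms. A
    matrix of norm [S] multiplies such a form by at most [S] ([mform_le]), which makes
    all estimates hold for matrices of functions at once. Averages over the circle
    are taken over roots of unity, and are exact on trigonometric polynomials
    ([kernel_le]). Rational functions with poles off the annulus are limits of Laurent
    polynomials, on the annulus as well as at [A], by the Neumann series
    ([approx_ratfun]).

    Lower bound. The Jordan block [[1, t], [0, 1]] with [t = r - r^-1] and its inverse have
    norm [r]. A function [f] with [f 1 = 0] takes it to [t f' 1] times the nilpotent part.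
    For the rational function [extremal], with norm at most [r / (1 - r ^- 6)] on the
    annulus, this gives the constant
    [2 (1 - r ^- 2) (1 - r ^- 6) / (1 - r ^- 4) ^+ 2], which exceeds [2 / (1 + r ^- 2)].

    Hence the sets of constants are nonempty and bounded below by a positive number,
    and their infima are attained, because the defining inequalities are closed
    ([inf_le_mul]). *)

Local Notation Re := complex.Re.
Local Notation Im := complex.Im.

(** * Real-valued norms and complex numbers *)

Section RealNorm.
Variable R : realType.
Local Notation C := R[i].

Lemma rnormE (V : normedZmodType C) (x : V) : (rnorm x)%:C%C = `|x|.
Proof. by rewrite /rnorm RRe_real ?normr_real. Qed.

Lemma rnorm_ge0 (V : normedZmodType C) (x : V) : 0 <= rnorm x.
Proof. by rewrite -ler0c rnormE. Qed.

Lemma rnorm0 (V : normedZmodType C) : rnorm (0 : V) = 0.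
Proof. by rewrite /rnorm normr0. Qed.

Lemma rnorm_eq0 (V : normedZmodType C) (x : V) : (rnorm x == 0) = (x == 0).
Proof. by rewrite -(inj_eq (@complexI _)) rnormE normr_eq0. Qed.

Lemma rnormN (V : normedZmodType C) (x : V) : rnorm (- x) = rnorm x.
Proof. by rewrite /rnorm normrN. Qed.

Lemma rnorm_triangle (V : normedZmodType C) (x y : V) :
  rnorm (x + y) <= rnorm x + rnorm y.
Proof. by rewrite -lecR rmorphD /= !rnormE ler_normD. Qed.

Lemma rnormB (V : normedZmodType C) (x y : V) : rnorm (x - y) = rnorm (y - x).
Proof. by rewrite -opprB rnormN. Qed.

Lemma rnorm_sum (V : normedZmodType C) I (r : seq I) (P : pred I) (F : I -> V) :
  rnorm (\sum_(i <- r | P i) F i) <= \sum_(i <- r | P i) rnorm (F i).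
Proof.
elim/big_rec2: _ => [|i x y _ le_yx]; first by rewrite rnorm0.
by rewrite (le_trans (rnorm_triangle _ _))// lerD2l.
Qed.

Lemma rnormM (x y : C) : rnorm (x * y) = rnorm x * rnorm y.
Proof. by apply: complexI; rewrite rmorphM /= !rnormE normrM. Qed.

Lemma rnormZ (V : normedModType C) (a : C) (x : V) :
  rnorm (a *: x) = rnorm a * rnorm x.
Proof. by apply: complexI; rewrite rmorphM /= !rnormE normrZ. Qed.

Lemma sqr_rnorm_le (V W : normedZmodType C) (x : V) (y : W) (a : R) : 0 <= a ->
  rnorm x <= a * rnorm y -> rnorm x ^+ 2 <= a ^+ 2 * rnorm y ^+ 2.
Proof.
move=> a0 le1; rewrite -exprMn; apply: lerXn2r; rewrite ?nnegrE ?rnorm_ge0//.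
by rewrite mulr_ge0 ?rnorm_ge0.
Qed.

Lemma rnorm1 : rnorm (1 : C) = 1.
Proof. by rewrite /rnorm normr1. Qed.

Lemma rnormX (x : C) n : rnorm (x ^+ n) = rnorm x ^+ n.
Proof. by elim: n => [|n IH]; rewrite ?expr0 ?rnorm1// !exprS rnormM IH. Qed.

Lemma rnormV (x : C) : rnorm x^-1 = (rnorm x)^-1.
Proof. by apply: complexI; rewrite fmorphV /= !rnormE normfV. Qed.

Lemma rnormC (a : R) : rnorm (a%:C%C : C) = `|a|.
Proof. by rewrite /rnorm normc_def /= expr0n /= addr0 sqrtr_sqr. Qed.

Lemma rnorm_conj (z : C) : rnorm z^* = rnorm z.
Proof. by rewrite /rnorm norm_conjC. Qed.

Lemma sqr_rnorm (z : C) : rnorm z ^+ 2 = Re z ^+ 2 + Im z ^+ 2.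
Proof. by apply: complexI; rewrite rmorphXn /= rnormE -add_Re2_Im2. Qed.

Lemma conjCE (z : C) : z^* = (Re z -i* Im z)%C.
Proof. by case: z. Qed.

Lemma cRe_conj (z : C) : Re z^* = Re z. Proof. by case: z. Qed.

Lemma cReD (x y : C) : Re (x + y) = Re x + Re y.
Proof. by case: x y => [a b] []. Qed.
Lemma cImD (x y : C) : Im (x + y) = Im x + Im y.
Proof. by case: x y => [a b] []. Qed.
Lemma cReN (x : C) : Re (- x) = - Re x. Proof. by case: x. Qed.
Lemma cImN (x : C) : Im (- x) = - Im x. Proof. by case: x. Qed.
Lemma cReM (x y : C) : Re (x * y) = Re x * Re y - Im x * Im y.
Proof. by case: x y => [a b] []. Qed.

Lemma mul_conj (z : C) : z * z^* = ((rnorm z) ^+ 2)%:C%C.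
Proof. by rewrite -normCK -rnormE rmorphXn. Qed.

Lemma cRe_le_rnorm (z : C) : Re z <= rnorm z.
Proof.
have := sqr_rnorm z; have := rnorm_ge0 z; have := sqr_ge0 (Im z); nra.
Qed.

Lemma conjC_real (a : R) : (a%:C%C : C)^* = a%:C%C.
Proof. by rewrite conjCE /= oppr0. Qed.

Lemma rnorm_phase (z : C) : exists2 e : C, rnorm e = 1 & e^* * z = (rnorm z)%:C%C.
Proof.
have [->|z0] := eqVneq z 0.
  by exists 1; rewrite ?rnorm1// mulr0 rnorm0.
have nz : rnorm z != 0 by rewrite rnorm_eq0.
exists (z / (rnorm z)%:C%C).
  by rewrite rnormM rnormV rnormC ger0_norm ?rnorm_ge0// divff.
rewrite rmorphM /= mulrAC [_^* * z]mulrC mul_conj fmorphV /=.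
rewrite conjC_real.
by rewrite -fmorphV -rmorphM /= expr2 mulfK.
Qed.

Lemma natrC n : (n%:R : C) = (n%:R : R)%:C%C.
Proof. by rewrite rmorph_nat. Qed.

Lemma rnorm_nat n : rnorm (n%:R : C) = n%:R.
Proof. by rewrite natrC rnormC ger0_norm ?ler0n. Qed.

Lemma cReMr (a : R) (z : C) : Re (a%:C%C * z) = a * Re z.
Proof. by rewrite cReM mul0r subr0. Qed.

Lemma cReMn (z : C) n : Re (z *+ n) = Re z *+ n.
Proof. by elim: n => [|n IH]; rewrite ?mulr0n// !mulrS cReD IH. Qed.

End RealNorm.

(** * The two-dimensional Hilbert space *)

(** The product type carries the supremum norm, hence a separate name for the
    same module with the Euclidean norm. *)
Definition plane (R : realType) : Type := (R[i] * R[i])%type.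

Section Plane.
Variable R : realType.
Local Notation C := R[i].
HB.instance Definition _ := GRing.Lmodule.copy (plane R) (C * C)%type.

Definition plane_norm (x : plane R) : C :=
  (Num.sqrt (rnorm x.1 ^+ 2 + rnorm x.2 ^+ 2))%:C%C.

Lemma plane_normD x y : plane_norm (x + y) <= plane_norm x + plane_norm y.
Proof.
rewrite /plane_norm -rmorphD lecR.
have := rnorm_triangle x.1 y.1; have := rnorm_triangle x.2 y.2.
rewrite -[x.1 + y.1]/((x + y).1) -[x.2 + y.2]/((x + y).2).
move: (rnorm_ge0 (x + y).1) (rnorm_ge0 (x + y).2) (rnorm_ge0 x.1) (rnorm_ge0 x.2)
  (rnorm_ge0 y.1) (rnorm_ge0 y.2).
move: (rnorm (x + y).1) (rnorm (x + y).2) (rnorm x.1) (rnorm x.2)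
  (rnorm y.1) (rnorm y.2) => a b c d e f.
move=> a0 b0 c0 d0 e0 f0 le1 le2.
set s := Num.sqrt (c ^+ 2 + d ^+ 2); set t := Num.sqrt (e ^+ 2 + f ^+ 2).
have s0 : 0 <= s by exact: sqrtr_ge0.
have t0 : 0 <= t by exact: sqrtr_ge0.
have es : s ^+ 2 = c ^+ 2 + d ^+ 2 by rewrite sqr_sqrtr// addr_ge0 ?sqr_ge0.
have et : t ^+ 2 = e ^+ 2 + f ^+ 2 by rewrite sqr_sqrtr// addr_ge0 ?sqr_ge0.
rewrite -(@ger0_norm _ (s + t)) ?addr_ge0// -sqrtr_sqr ler_sqrt ?sqr_ge0//.
have cs : c * e + d * f <= s * t.
  rewrite -(@ler_pXn2r _ 2) ?nnegrE ?addr_ge0 ?mulr_ge0//.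
  by rewrite [leRHS]exprMn es et -subr_ge0;
    apply: le_trans (sqr_ge0 (c * f - d * e)) _; rewrite le_eqVlt; apply/orP; left; apply/eqP; ring.
have le3 : a ^+ 2 + b ^+ 2 <= (c + e) ^+ 2 + (d + f) ^+ 2.
  by rewrite lerD// ler_pXn2r ?nnegrE ?addr_ge0.
apply: le_trans le3 _; rewrite [leRHS]sqrrD es et -subr_ge0; nra.
Qed.

Lemma plane_normZ (l : C) x : plane_norm (l *: x) = `|l| * plane_norm x.
Proof.
rewrite /plane_norm -rnormE -rmorphM /= !rnormM !exprMn -mulrDr.
by rewrite sqrtrM ?sqr_ge0// sqrtr_sqr ger0_norm ?rnorm_ge0.
Qed.

Lemma plane_norm_eq0 x : plane_norm x = 0 -> x = 0.
Proof.
move=> [] /eqP; rewrite sqrtr_eq0 => le0.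
have := sqr_ge0 (rnorm x.1); have := sqr_ge0 (rnorm x.2) => h1 h2.
have /eqP : rnorm x.1 ^+ 2 = 0 by lra.
have /eqP : rnorm x.2 ^+ 2 = 0 by lra.
rewrite !expf_eq0 /= !rnorm_eq0 => /eqP e2 /eqP e1.
by case: x e1 e2 {le0 h1 h2} => a b /= -> ->.
Qed.

HB.instance Definition _ := @Lmodule_isNormed.Build C (plane R) plane_norm
  plane_normD plane_normZ plane_norm_eq0.

Lemma rnorm_planeE (x : plane R) :
  rnorm x = Num.sqrt (rnorm x.1 ^+ 2 + rnorm x.2 ^+ 2).
Proof. by []. Qed.

Let coord (i : 'I_4) (x : plane R) : R :=
  [:: Re x.1; Im x.1; Re x.2; Im x.2]`_i.

Let coord_le i (x y : plane R) : `|coord i x - coord i y| <= rnorm (x - y).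
Proof.
rewrite rnorm_planeE !sqr_rnorm -sqrtr_sqr ler_sqrt ?sqr_ge0 ?addr_ge0 ?sqr_ge0//.
rewrite !(cReD, cImD, cReN, cImN).
have hx (a b c d : R) : (a ^+ 2 <= a ^+ 2 + b ^+ 2 + (c ^+ 2 + d ^+ 2)) *
  (b ^+ 2 <= a ^+ 2 + b ^+ 2 + (c ^+ 2 + d ^+ 2)) *
  (c ^+ 2 <= a ^+ 2 + b ^+ 2 + (c ^+ 2 + d ^+ 2)) *
  (d ^+ 2 <= a ^+ 2 + b ^+ 2 + (c ^+ 2 + d ^+ 2)).
  have := sqr_ge0 a; have := sqr_ge0 b; have := sqr_ge0 c; have := sqr_ge0 d.
  by move=> *; split; [split; [split|]|]; lra.
by case: i => [] [|[|[|[|//]]]] lti; rewrite /coord /= hx.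
Qed.

(** Convergence is checked on the four real coordinates. *)
Lemma plane_complete (F : set_system (plane R)) :
  ProperFilter F -> cauchy F -> cvg F.
Proof.
move=> FF Fc.
have Fi (i : 'I_4) : cvg (coord i @ F).
  apply: R_complete; apply: cauchy_exP => e e0.
  have /cauchyP /(_ (e%:C)%C) := Fc; rewrite ltcR => /(_ e0)[x Fx].
  exists (coord i x); suff: F (coord i @^-1` ball (coord i x) e) by [].
  apply: filterS Fx => y; rewrite -ball_normE /= -rnormE ltcR -ball_normE /=.
  exact: le_lt_trans (coord_le i x y).
pose l i := lim (coord i @ F).
pose L : plane R := ((l ord0 +i* l (inord 1))%C, (l (inord 2) +i* l (inord 3))%C).
have Ll i : coord i L = l i.
  by case: i => [] [|[|[|[|//]]]] lti; rewrite /coord /L /=; congr l; apply/val_inj;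
    rewrite /= ?inordK.
apply/cvg_ex; exists L; apply/cvgrPdist_lt => e.
rewrite ltcE => /andP[/eqP e_im e0].
have {e_im}ee : e = (Re e)%:C%C by case: e e_im {e0} => a b /= ->.
have e4 : 0 < Re e / 4 by apply: divr_gt0.
have near_i (i : 'I_4) : \forall x \near F, `|coord i L - coord i x| < Re e / 4.
  have /cvgrPdist_lt /(_ (Re e / 4)) : coord i @ F --> l i by exact: Fi i.
  by rewrite Ll; exact.
have hall : F (fun x => forall i : 'I_4, `|coord i L - coord i x| < Re e / 4) by apply: filter_forall.
apply: filterS hall => x hx.
rewrite ee -rnormE ltcR rnorm_planeE !sqr_rnorm.
have := hx (inord 0); have := hx (inord 1); have := hx (inord 2); have := hx (inord 3).
rewrite /coord !inordK //= {Ll near_i Fi hx}.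
rewrite !(cReD, cImD, cReN, cImN).
move: (l _ - _) (l _ - _) (l _ - _) (l _ - _) => a b c d.
have sq (t : R) : `|t| < Re e / 4 -> t ^+ 2 < (Re e / 4) ^+ 2.
  by rewrite ltr_norml => /andP[? ?]; nra.
move=> /sq ha /sq hb /sq hc /sq hd.
rewrite -[X in _ < X]ger0_norm ?ltW// -sqrtr_sqr ltr_sqrt ?exprn_gt0//.
nra.
Qed.

HB.instance Definition _ := Uniform_isComplete.Build (plane R) plane_complete.

Definition plane_dot (x y : plane R) : C := x.1 * (y.1)^* + x.2 * (y.2)^*.

Lemma plane_dot_bilinear : bilinear_for
  (GRing.Scale.Law.clone _ _ *%R _)
  (GRing.Scale.Law.clone _ _ (@Num.conj C \; *%R) _) plane_dot.
Proof.
split=> [u|u] a x y; rewrite /plane_dot.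
  rewrite -[(a *: x + y).1]/(a * x.1 + y.1) -[(a *: x + y).2]/(a * x.2 + y.2) /=.
  by ring.
rewrite -[(a *: x + y).1]/(a * x.1 + y.1) -[(a *: x + y).2]/(a * x.2 + y.2) /=.
by rewrite !rmorphD !rmorphM /=; ring.
Qed.

HB.instance Definition _ := bilinear_isBilinear.Build C (plane R) (plane R) C
  _ _ plane_dot plane_dot_bilinear.

Lemma plane_dot_herm x y :
  plane_dot x y = (-1) ^+ false * Num.conj (plane_dot y x).
Proof. by rewrite expr0 mul1r /plane_dot rmorphD !rmorphM /= !conjCK; ring. Qed.

HB.instance Definition _ := isHermitianSesquilinear.Build C (plane R) false
  Num.conj plane_dot plane_dot_herm.

Lemma plane_dotE x : plane_dot x x = `|x| ^+ 2.
Proof.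
rewrite /plane_dot !mul_conj -rnormE rnorm_planeE -rmorphXn -rmorphD /=.
by rewrite sqr_sqrtr// addr_ge0 ?sqr_ge0.
Qed.

Lemma plane_dot_gt0 x : x != 0 -> 0 < plane_dot x x.
Proof. by move=> x0; rewrite plane_dotE exprn_gt0// normr_gt0. Qed.

HB.instance Definition _ := isDotProduct.Build C (plane R) plane_dot plane_dot_gt0.

HB.instance Definition _ := isHilbert.Build R (plane R) plane_dotE.

End Plane.

(** * Positive semidefinite forms *)

Section PositiveForms.
Variable R : realType.
Local Notation C := R[i].

(** The forms in use are built by hand, as finite sums of translates of the inner
    product by powers of an operator. A predicate fits them better than a bundled
    structure, and the form [x, y |-> hinner x (A y)] replaces the adjoint of
    [A]. *)
Definition sesqui (V : lmodType C) (h : V -> V -> C) :=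
  (forall a x x' y, h (a *: x + x') y = a * h x y + h x' y) /\
  (forall a x y y', h x (a *: y + y') = a^* * h x y + h x y').

Definition psd (V : lmodType C) (h : V -> V -> C) :=
  [/\ sesqui h, forall x y, h y x = (h x y)^* & forall x, 0 <= Re (h x x)].

Section Sesqui.
Variables (V : lmodType C) (h : V -> V -> C).
Hypothesis hS : sesqui h.

Lemma sesquiDl x x' y : h (x + x') y = h x y + h x' y.
Proof. by rewrite -[x in LHS]scale1r hS.1 mul1r. Qed.
Lemma sesquiDr x y y' : h x (y + y') = h x y + h x y'.
Proof. by rewrite -[y in LHS]scale1r hS.2 conjC1 mul1r. Qed.
Lemma sesqui0l y : h 0 y = 0.
Proof. by apply: (addrI (h 0 y)); rewrite -sesquiDl !addr0. Qed.
Lemma sesqui0r y : h y 0 = 0.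
Proof. by apply: (addrI (h y 0)); rewrite -sesquiDr !addr0. Qed.
Lemma sesquiZl a x y : h (a *: x) y = a * h x y.
Proof. by rewrite -[a *: x]addr0 hS.1 sesqui0l addr0. Qed.
Lemma sesquiZr a x y : h x (a *: y) = a^* * h x y.
Proof. by rewrite -[a *: y]addr0 hS.2 sesqui0r addr0. Qed.
Lemma sesquiNl x y : h (- x) y = - h x y.
Proof. by rewrite -scaleN1r sesquiZl mulN1r. Qed.
Lemma sesquiNr x y : h x (- y) = - h x y.
Proof. by rewrite -scaleN1r sesquiZr rmorphN1 mulN1r. Qed.
Lemma sesqui_suml I (r : seq I) (P : pred I) F y :
  h (\sum_(i <- r | P i) F i) y = \sum_(i <- r | P i) h (F i) y.
Proof. by elim/big_rec2: _ => [|i u v _ <-]; rewrite ?sesqui0l ?sesquiDl. Qed.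
Lemma sesqui_sumr I (r : seq I) (P : pred I) F x :
  h x (\sum_(i <- r | P i) F i) = \sum_(i <- r | P i) h x (F i).
Proof. by elim/big_rec2: _ => [|i u v _ <-]; rewrite ?sesqui0r ?sesquiDr. Qed.
End Sesqui.

Lemma psd_sesqui (V : lmodType C) (h : V -> V -> C) : psd h -> sesqui h.
Proof. by case. Qed.

(** Polarisation against the phase of [h x y] gives the arithmetic-geometric
    form of the Cauchy-Schwarz inequality, which, unlike the usual form, can be
    averaged over a family of forms. *)
Lemma psd_amgm (V : lmodType C) (h : V -> V -> C) x y : psd h ->
  2 * rnorm (h x y) <= Re (h x x) + Re (h y y).
Proof.
case=> hS hC h0; have [e e1 ee] := rnorm_phase (h x y).
have := h0 (x - e *: y).
rewrite !(sesquiDl hS, sesquiDr hS, sesquiNl hS, sesquiNr hS, sesquiZl hS, sesquiZr hS).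
have -> : h y x = (h x y)^* by [].
have ee' : e * (h x y)^* = (rnorm (h x y))%:C%C.
  by rewrite -[e]conjCK -rmorphM /= ee conjCE /= oppr0.
have -> : e * (e^* * h y y) = h y y by rewrite mulrA mul_conj e1 expr1n mul1r.
rewrite ee ee' !(cReD, cReN) /= => le0; lra.
Qed.

Lemma psd_amgmZ (V : lmodType C) (h : V -> V -> C) x y (l : R) : psd h -> 0 < l ->
  2 * rnorm (h x y) <= l^-1 * Re (h x x) + l * Re (h y y).
Proof.
move=> hp l0; have hS := psd_sesqui hp.
have := psd_amgm x (l%:C%C *: y) hp.
rewrite !(sesquiZl hS, sesquiZr hS) rnormM rnorm_conj rnormC gtr0_norm//.
have -> : Re (l%:C%C * (l%:C%C^* * h y y)) = l ^+ 2 * Re (h y y).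
  by rewrite mulrA mul_conj rnormC cReM /= mul0r subr0 gtr0_norm.
move=> le0; rewrite -(ler_pM2l l0) [leRHS]mulrDr !mulrA divff ?gt_eqF// mul1r.
by move: le0; rewrite expr2 !mulrA; lra.
Qed.

(** The sesquilinear form, on [n]-tuples, of the tensor product of the matrix [F] and
    the operator behind [h]. *)
Definition mform n (V : lmodType C) (F : 'M[C]_n) (h : V -> V -> C)
  (x y : 'I_n -> V) : C := \sum_i \sum_j F i j * h (x j) (y i).

Lemma l2norm_ge0 n (V : normedZmodType C) (x : 'cV[V]_n) : 0 <= l2norm x.
Proof. exact: sqrtr_ge0. Qed.

Lemma sqr_l2norm n (V : normedZmodType C) (x : 'cV[V]_n) :
  l2norm x ^+ 2 = \sum_i rnorm (x i 0) ^+ 2.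
Proof. by rewrite sqr_sqrtr// sumr_ge0// => i _; exact: sqr_ge0. Qed.

Local Open Scope sesquilinear_scope.

(** Diagonalising the Gram matrix of [x] for [h] reduces the estimate to the
    action of [F] on scalar vectors. *)
Lemma psd_mulmx n (V : lmodType C) (F : 'M[C]_n) (h : V -> V -> C) (S : R)
    (x : 'I_n -> V) : psd h ->
  (forall c : 'cV_n, l2norm (F *m c) ^+ 2 <= S * l2norm c ^+ 2) ->
  \sum_i Re (h (\sum_j F i j *: x j) (\sum_j F i j *: x j)) <=
    S * \sum_j Re (h (x j) (x j)).
Proof.
move=> hp hF; have hS := psd_sesqui hp; have [_ hC h0] := hp.
pose G : 'M[C]_n := \matrix_(j, l) h (x j) (x l).
have comb (c : 'I_n -> C) : h (\sum_j c j *: x j) (\sum_j c j *: x j) =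
    \sum_j \sum_l c j * (c l)^* * G j l.
  rewrite sesqui_suml//; apply: eq_bigr => j _; rewrite sesqui_sumr//.
  by apply: eq_bigr => l _; rewrite sesquiZl// sesquiZr// mxE mulrA.
have GH : G \is hermsymmx.
  apply/is_hermitianmxP; rewrite expr0 scale1r; apply/matrixP => j l.
  by rewrite !mxE.
have /hermitian_normalmx /orthomx_spectralP := GH.
set P := spectralmx G; set d := spectral_diag G => GE.
have Pu : P \is unitarymx by exact: spectral_unitarymx.
rewrite invmx_unitary// in GE.
have GEk j l : G j l = \sum_k d 0 k * ((P k j)^* * P k l).
  rewrite {1}GE mxE; apply: eq_bigr => k _.
  rewrite mul_mx_diag !mxE; ring.
have combd (c : 'I_n -> C) : h (\sum_j c j *: x j) (\sum_j c j *: x j) =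
    \sum_k d 0 k * (rnorm (\sum_j c j * (P k j)^*) ^+ 2)%:C%C.
  rewrite comb; under eq_bigr do under eq_bigr do rewrite GEk mulr_sumr.
  under eq_bigr do rewrite exchange_big /=.
  rewrite exchange_big /=; apply: eq_bigr => k _.
  rewrite -mul_conj rmorph_sum mulr_suml mulr_sumr; apply: eq_bigr => j _.
  rewrite !mulr_sumr; apply: eq_bigr => l _.
  by rewrite rmorphM /= conjCK; ring.
have PP k l : \sum_j P k j * (P l j)^* = (k == l)%:R.
  have /unitarymxP /matrixP /(_ k l) := Pu; rewrite [RHS]mxE mxE => <-.
  by apply: eq_bigr => j _; rewrite !mxE.
have d0 k : 0 <= Re (d 0 k).
  have := h0 (\sum_j P k j *: x j); rewrite combd.
  under eq_bigr do rewrite PP.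
  rewrite (bigD1 k) //= eqxx rnorm1 expr1n mulr1 big1 ?addr0// => l lk.
  by rewrite eq_sym (negPf lk) rnorm0 expr0n mulr0.
have Re_sum (I : finType) (f : I -> C) : Re (\sum_i f i) = \sum_i Re (f i).
  by elim/big_rec2: _ => // i a b _ <-; rewrite cReD.
pose Pk k : 'cV[C]_n := \col_j (P k j)^*.
have Re_combd (c : 'I_n -> C) : Re (h (\sum_j c j *: x j) (\sum_j c j *: x j)) =
    \sum_k Re (d 0 k) * rnorm (\sum_j c j * (P k j)^*) ^+ 2.
  by rewrite combd Re_sum; apply: eq_bigr => k _; rewrite cReM /= mulr0 subr0.
have -> : \sum_i Re (h (\sum_j F i j *: x j) (\sum_j F i j *: x j)) =
    \sum_k Re (d 0 k) * l2norm (F *m Pk k) ^+ 2.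
  under eq_bigr do rewrite Re_combd.
  rewrite exchange_big; apply: eq_bigr => k _; rewrite sqr_l2norm mulr_sumr.
  apply: eq_bigr => i _; congr (_ * rnorm _ ^+ 2); rewrite mxE.
  by apply: eq_bigr => j _; rewrite !mxE.
have -> : \sum_j Re (h (x j) (x j)) = \sum_k Re (d 0 k) * l2norm (Pk k) ^+ 2.
  rewrite [RHS](eq_bigr (fun k => \sum_j Re (d 0 k) * rnorm (P k j) ^+ 2)); last first.
    move=> k _; rewrite sqr_l2norm mulr_sumr; apply: eq_bigr => j _.
    by rewrite mxE rnorm_conj.
  rewrite exchange_big; apply: eq_bigr => j _.
  have <- : G j j = h (x j) (x j) by rewrite mxE.
  rewrite GEk Re_sum; apply: eq_bigr => k _.
  by rewrite mulrC [_ * P k j]mulrC mul_conj cReM /= mul0r subr0 mulrC.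
rewrite mulr_sumr; apply: ler_sum => k _.
by rewrite [leRHS]mulrCA; apply: ler_wpM2l.
Qed.

(** This turns an estimate for a positive form into one with matrix coefficients, at
    no cost in the constant: it is the source of complete bounds. *)
Lemma mform_le n (V : lmodType C) (F : 'M[C]_n) (h : V -> V -> C) (S : R)
    (x y : 'I_n -> V) : psd h -> 0 < S ->
  (forall c : 'cV_n, l2norm (F *m c) <= S * l2norm c) ->
  2 * rnorm (mform F h x y) <=
    S * (\sum_j Re (h (x j) (x j)) + \sum_i Re (h (y i) (y i))).
Proof.
move=> hp S0 hF; have hS := psd_sesqui hp.
have -> : mform F h x y = \sum_i h (\sum_j F i j *: x j) (y i).
  apply: eq_bigr => i _; rewrite sesqui_suml//; apply: eq_bigr => j _.
  by rewrite sesquiZl.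
apply: (@le_trans _ _ (\sum_i (S^-1 * Re (h (\sum_j F i j *: x j)
    (\sum_j F i j *: x j)) + S * Re (h (y i) (y i))))).
  apply: (@le_trans _ _ (\sum_i 2 * rnorm (h (\sum_j F i j *: x j) (y i)))).
    by rewrite -mulr_sumr ler_wpM2l ?rnorm_sum.
  by apply: ler_sum => i _; exact: psd_amgmZ.
rewrite big_split /= -!mulr_sumr mulrDr lerD2r.
have := @psd_mulmx n V F h (S ^+ 2) x hp.
have hF2 (c : 'cV_n) : l2norm (F *m c) ^+ 2 <= S ^+ 2 * l2norm c ^+ 2.
  rewrite -exprMn; apply: lerXn2r; rewrite ?nnegrE ?l2norm_ge0//.
  by apply: mulr_ge0; [exact: ltW | exact: l2norm_ge0].
move=> /(_ hF2) hle; rewrite -(ler_pM2l S0) mulrA divff ?gt_eqF// mul1r.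
by rewrite mulrA -expr2.
Qed.

End PositiveForms.

(** * Discrete Fourier averages of positive kernels *)

Definition zsum (T : nmodType) (N : nat) (E : int -> T) : T :=
  \sum_(i < N.*2.+1) E (i%:Z - N%:Z).

Section ZSum.
Variable T : nmodType.
Implicit Type E : int -> T.

Lemma zsumS N E : zsum N.+1 E = E (- N.+1%:Z) + zsum N E + E N.+1%:Z.
Proof.
rewrite /zsum doubleS big_ord_recl big_ord_recr /= addrA; congr (_ + _ + _).
- by rewrite sub0r.
- by apply: eq_bigr => i _; congr E; rewrite /bump /=; lia.
- by congr E; rewrite /bump /=; lia.
Qed.

Lemma zsum0 E : zsum 0 E = E 0.
Proof. by rewrite /zsum big_ord1. Qed.

Lemma eq_zsum N E E' : (forall l, E l = E' l) -> zsum N E = zsum N E'.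
Proof. by move=> EE; apply: eq_bigr => i _. Qed.

Lemma zsum_opp N E : zsum N E = zsum N (fun l => E (- l)).
Proof.
elim: N => [|N IH]; first by rewrite !zsum0 oppr0.
by rewrite !zsumS opprK IH [RHS]addrC -addrA [in LHS](addrC _ (E _)).
Qed.

Lemma zsum_widen N N' E : (N <= N')%N ->
  (forall l, (N < `|l|)%N -> E l = 0) -> zsum N' E = zsum N E.
Proof.
move=> /subnKC <- E0; elim: (_ - _)%N => [|k IH]; first by rewrite addn0.
by rewrite addnS zsumS !E0 ?addr0 ?add0r ?IH//; lia.
Qed.

Lemma zsum_delta N (x : T) : zsum N (fun l => if l == 0 then x else 0) = x.
Proof.
by elim: N => [|N IH]; rewrite ?zsum0 ?eqxx// zsumS IH /= addr0 add0r.
Qed.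

Lemma zsumD N E E' : zsum N (fun l => E l + E' l) = zsum N E + zsum N E'.
Proof. exact: big_split. Qed.

(** The coefficients of the Fejer kernel of order [N]. Raising [N] by one adds the
    Dirichlet kernel of order [N]. *)
Lemma double_sum_sub N E :
  \sum_(i < N) \sum_(j < N) E (i%:Z - j%:Z) =
  zsum N (fun l => E l *+ (N - `|l|)).
Proof.
elim: N => [|N IH]; first by rewrite big_ord0 zsum0 mulr0n.
transitivity (zsum N (fun l => E l *+ (N - `|l|)) + zsum N E); last first.
  rewrite zsumS -zsumD abszN absz_nat subnn !mulr0n addr0 add0r.
  apply: eq_bigr => i _; rewrite -mulrSr; congr (_ *+ _).
  by rewrite subSn//; move: (ltn_ord i); lia.
rewrite big_ord_recr /=.
under eq_bigr do rewrite big_ord_recr /=.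
rewrite big_split /= IH -addrA; congr (_ + _).
transitivity (\sum_(i < N) E (i%:Z - N%:Z) + \sum_(N <= i < N.*2.+1) E (i%:Z - N%:Z)).
  congr (_ + _); rewrite (_ : N.*2.+1 = N.+1 + N)%N; last lia.
  rewrite -{1}[N in RHS]add0n big_addn addnK big_mkord (reindex_inj rev_ord_inj) /=.
  apply: eq_bigr => i _; congr E; have := ltn_ord i; lia.
rewrite /zsum -(big_mkord xpredT (fun i => E (i%:Z - N%:Z))).
rewrite -(big_mkord xpredT (fun i => E (i%:Z - N%:Z))) -big_cat_nat//; lia.
Qed.

End ZSum.

Section Fourier.
Variable R : realType.
Local Notation C := R[i].

Lemma prim_root_exists n : (0 < n)%N -> exists z : C, n.-primitive_root z.
Proof.
pose p : {poly C} := 'X^n - 1; have [r Dp] := closed_field_poly_normal p.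
move=> n_gt0; rewrite (monicP _) ?monicXnsubC // scale1r in Dp.
have rn1 : all n.-unity_root r by apply/allP=> z; rewrite -root_prod_XsubC -Dp.
have sz_r : (n < (size r).+1)%N.
  by rewrite -(size_prod_XsubC r id) -Dp size_XnsubC.
have [|z] := hasP (has_prim_root n_gt0 rn1 _ sz_r); last by exists z.
by rewrite -separable_prod_XsubC -Dp separable_Xn_sub_1 // pnatr_eq0 -lt0n.
Qed.

Lemma prim_root_rnorm n (z : C) : n.-primitive_root z -> rnorm z = 1.
Proof.
move=> pz; have n0 := prim_order_gt0 pz.
have /eqP := prim_expr_order pz => /eqP /(congr1 (@rnorm R C)).
rewrite rnormX rnorm1 => /eqP; rewrite pexpr_eq1 ?rnorm_ge0//.
by move=> /eqP.
Qed.

Lemma rnorm1_neq0 (w : C) : rnorm w = 1 -> w != 0.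
Proof. by move=> w1; rewrite -rnorm_eq0 w1 oner_eq0. Qed.

Lemma conj_unit_exp (w : C) l : rnorm w = 1 -> (w ^ l)^* = w ^ (- l).
Proof.
move=> w1; have w0 := rnorm1_neq0 w1.
have wc : w^* = w^-1 by apply: (mulfI w0); rewrite mul_conj w1 expr1n divff.
by rewrite -exprz_inv -wc; case: l => k; rewrite /= ?fmorphV rmorphXn.
Qed.

Lemma fourier_ortho N (e : C) (i l : 'I_N) : N.-primitive_root e ->
  \sum_(k < N) (e ^+ k) ^ (i%:Z - l%:Z) = if i == l then N%:R else 0.
Proof.
move=> pe; have e0 := rnorm1_neq0 (prim_root_rnorm pe).
have -> : \sum_(k < N) (e ^+ k) ^ (i%:Z - l%:Z) =
    \sum_(k < N) (e ^ (i%:Z - l%:Z)) ^+ k.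
  by apply: eq_bigr => k _; rewrite !exprnP exprzAC.
case: eqVneq => [->|il].
  rewrite subrr expr0z; under eq_bigr do rewrite expr1n.
  by rewrite sumr_const card_ord.
set u := e ^ _.
have u1 : u != 1.
  apply: contra_neq il => u1; apply/val_inj => /=.
  have : e ^+ i = e ^+ l.
    by rewrite !exprnP -[i%:Z](subrK l%:Z) expfzDr// -/u u1 mul1r.
  move=> /eqP; rewrite (eq_prim_root_expr pe) !modn_small ?ltn_ord//.
  by move=> /eqP.
have : (u - 1) * \sum_(k < N) u ^+ k = 0.
  rewrite -subrX1 /u exprnP exprzAC -exprnP (prim_expr_order pe).
  by rewrite exp1rz subrr.
by move=> /eqP; rewrite mulf_eq0 subr_eq0 (negPf u1) => /eqP.
Qed.

(** The indices in [- N .. N] are pairwise incongruent modulo [2 N + 1], so that the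
    finite average is exact: no aliasing occurs. *)
Lemma fourier_parseval N (e : C) (u v : int -> C) :
  N.*2.+1.-primitive_root e ->
  \sum_(k < N.*2.+1) (zsum N (fun l => (e ^+ k) ^ l * u l) *
     zsum N (fun l => (e ^+ k) ^ (- l) * v l)) =
  N.*2.+1%:R * zsum N (fun l => u l * v l).
Proof.
move=> pe; have e0 := rnorm1_neq0 (prim_root_rnorm pe).
rewrite /zsum mulr_sumr.
under eq_bigr do rewrite mulr_suml.
rewrite exchange_big; apply: eq_bigr => i _ /=.
under eq_bigr do rewrite mulr_sumr.
rewrite exchange_big /= (bigD1 i)//= [X in _ + X]big1 => [|l li].
  rewrite addr0; have := fourier_ortho i i pe; rewrite eqxx => <-.
  rewrite mulr_suml; apply: eq_bigr => k _; rewrite mulrACA -expfzDr ?expf_neq0//.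
  by congr (_ ^ _ * _); lia.
have := fourier_ortho i l pe; rewrite eq_sym (negPf li) => o.
transitivity ((\sum_(k < N.*2.+1) (e ^+ k) ^ (i%:Z - l%:Z)) *
    (u (i%:Z - N%:Z) * v (l%:Z - N%:Z))); last by rewrite o mul0r.
rewrite mulr_suml; apply: eq_bigr => k _; rewrite mulrACA -expfzDr ?expf_neq0//.
by congr (_ ^ _ * _); lia.
Qed.

Lemma Re_sum I (r : seq I) (P : pred I) (f : I -> C) :
  Re (\sum_(i <- r | P i) f i) = \sum_(i <- r | P i) Re (f i).
Proof. by elim/big_rec2: _ => // i a b _ <-; rewrite cReD. Qed.

(** Averaging [mform_le] over the roots of unity of order [2 N + 1], which see
    exactly the Fourier coefficients of order at most [N]. *)
Lemma kernel_le n (V : lmodType C) N (a : int -> 'M[C]_n)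
    (c : int -> V -> V -> C) (S : R) (x y : 'I_n -> V) : 0 < S ->
  (forall w : C, rnorm w = 1 ->
    psd (fun x y => zsum N (fun l => w ^ (- l) * c l x y))) ->
  (forall w : C, rnorm w = 1 -> forall v : 'cV_n,
    l2norm (zsum N (fun l => w ^ l *: a l) *m v) <= S * l2norm v) ->
  2 * rnorm (zsum N (fun l => mform (a l) (c l) x y)) <=
    S * (\sum_j Re (c 0 (x j) (x j)) + \sum_i Re (c 0 (y i) (y i))).
Proof.
move=> S0 hp hF; pose M := N.*2.+1.
have [e pe] := @prim_root_exists M isT.
have e1 (k : nat) : rnorm (e ^+ k) = 1.
  by rewrite rnormX (prim_root_rnorm pe) expr1n.
pose F w : 'M[C]_n := zsum N (fun l => w ^ l *: a l).
pose h (w : C) x y := zsum N (fun l => w ^ (- l) * c l x y).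
have M0 : 0 < (M%:R : R) by rewrite ltr0n.
have rM : rnorm (M%:R : C) = M%:R := rnorm_nat R M.
have sum_h z : \sum_(k < M) Re (h (e ^+ k) z z) = M%:R * Re (c 0 z z).
  rewrite -Re_sum.
  have := @fourier_parseval N e (fun l => if l == 0 then 1 else 0)
    (fun l => c l z z) pe.
  rewrite [in RHS](@eq_zsum _ N _ (fun l => if l == 0 then c 0 z z else 0)).
    rewrite zsum_delta => hs.
    rewrite -[LHS](_ : Re (M%:R * c 0 z z) = _).
      by rewrite natrC cReMr.
    congr Re; rewrite -hs; apply: eq_bigr => k _.
    rewrite [X in X * _](@eq_zsum _ N _ (fun l => if l == 0 then 1 else 0)).
      by rewrite zsum_delta mul1r.
    by move=> l; case: eqP => [->|_]; rewrite ?expr0z ?mulr1// mulr0.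
  by move=> l; case: eqP => [->|_]; rewrite ?mul1r// mul0r.
have sum_F : \sum_(k < M) mform (F (e ^+ k)) (h (e ^+ k)) x y =
    M%:R * zsum N (fun l => mform (a l) (c l) x y).
  have -> : zsum N (fun l => mform (a l) (c l) x y) =
      \sum_i \sum_j zsum N (fun l => a l i j * c l (x j) (y i)).
    by rewrite /zsum exchange_big /=; apply: eq_bigr => i _; rewrite exchange_big.
  rewrite /mform exchange_big /= mulr_sumr; apply: eq_bigr => i _.
  rewrite exchange_big /= mulr_sumr; apply: eq_bigr => j _.
  have := @fourier_parseval N e (fun l => a l i j) (fun l => c l (x j) (y i)) pe.
  move=> <-; apply: eq_bigr => k _; congr (_ * _).
  by rewrite /F /zsum summxE; apply: eq_bigr => l _; rewrite mxE.
rewrite -(ler_pM2l M0) mulrCA -rM -rnormM -sum_F rM.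
apply: (@le_trans _ _ (\sum_(k < M) S * (\sum_j Re (h (e ^+ k) (x j) (x j)) +
     \sum_i Re (h (e ^+ k) (y i) (y i))))).
  apply: (@le_trans _ _ (\sum_(k < M) 2 * rnorm (mform (F (e ^+ k)) (h (e ^+ k)) x y))).
    by rewrite -mulr_sumr ler_wpM2l ?rnorm_sum.
  by apply: ler_sum => k _; apply: mform_le => //; [exact: hp|exact: hF].
rewrite -mulr_sumr mulrCA; apply: ler_wpM2l; first exact: ltW.
rewrite big_split /= mulrDr.
rewrite !mulr_sumr exchange_big [X in _ + X]exchange_big /=.
by rewrite lerD//; apply: ler_sum => i _; rewrite sum_h.
Qed.

End Fourier.

(** * Contractions *)

Section Contraction.
Variables (R : realType) (H : hilbertType R).
Local Notation C := R[i].
Local Notation ip := (fun x y : H => hinner x y : C).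

Lemma hinner_psd : psd ip.
Proof.
split; [split|..] => [a x x' y|a x y y'|x y|x].
- by rewrite linearPl.
- by rewrite linearPr.
- by rewrite hermC expr0 mul1r.
- by rewrite hinnerE -rnormE -rmorphXn /= sqr_ge0.
Qed.
Let ipS : sesqui ip := psd_sesqui hinner_psd.

Lemma Re_hinner (x : H) : Re (hinner x x) = rnorm x ^+ 2.
Proof. by rewrite hinnerE -rnormE -rmorphXn. Qed.

Lemma hinner_conj (x y : H) : hinner y x = (hinner x y)^* :> C.
Proof. by have [_ /(_ x y)] := hinner_psd. Qed.

Lemma sqr_rnormD (x y : H) :
  rnorm (x + y) ^+ 2 = rnorm x ^+ 2 + 2 * Re (hinner x y) + rnorm y ^+ 2.
Proof.
rewrite -!Re_hinner (sesquiDl ipS) !(sesquiDr ipS) !cReD.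
by rewrite (hinner_conj x y) cRe_conj; ring.
Qed.

Lemma hinner_le (x y : H) : rnorm (hinner x y : C) <= rnorm x * rnorm y.
Proof.
have [->|y0] := eqVneq y 0; first by rewrite (sesqui0r ipS) !rnorm0 mulr0.
have [->|x0] := eqVneq x 0; first by rewrite (sesqui0l ipS) !rnorm0 mul0r.
have ny : 0 < rnorm y by rewrite lt_neqAle eq_sym rnorm_eq0 y0 rnorm_ge0.
have nx : 0 < rnorm x by rewrite lt_neqAle eq_sym rnorm_eq0 x0 rnorm_ge0.
have := psd_amgmZ x y (hinner_psd) (divr_gt0 nx ny).
rewrite !Re_hinner invf_div.
have -> : rnorm y / rnorm x * rnorm x ^+ 2 + rnorm x / rnorm y * rnorm y ^+ 2 =
    2 * (rnorm x * rnorm y) by field; rewrite !gt_eqF.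
by rewrite ler_pM2l.
Qed.

Lemma is_linear_iter (T : H -> H) k : linear T -> linear (iter k T).
Proof. by move=> TL; elim: k => [|k IH] a x y /=; rewrite ?IH ?TL. Qed.

(** The powers of [T], with the adjoint of [T] moved to the other side of the
    inner product in place of a negative power. *)
Definition tau (T : H -> H) (l : int) (x y : H) : C :=
  match l with
  | Posz k => hinner (iter k T x) y
  | Negz k => hinner x (iter k.+1 T y)
  end.

Variable T : H -> H.
Hypothesis TL : linear T.

Lemma tau_sesqui l : sesqui (tau T l).
Proof.
split=> [a x x' y|a x y y']; case: l => k; rewrite /tau.
- by rewrite (is_linear_iter k TL) (sesquiDl ipS) (sesquiZl ipS).
- by rewrite (sesquiDl ipS) (sesquiZl ipS).
- by rewrite (sesquiDr ipS) (sesquiZr ipS).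
- by rewrite (is_linear_iter k.+1 TL) (sesquiDr ipS) (sesquiZr ipS).
Qed.

Lemma tauN l x y : tau T (- l) y x = (tau T l x y)^*.
Proof. by case: l => [[|k]|k]; rewrite /tau /= -hinner_conj. Qed.

Lemma tau_nat k x y : tau T k%:Z x y = hinner (iter k T x) y.
Proof. by []. Qed.

Hypothesis Tle : forall x, rnorm (T x) <= rnorm x.

(** The Toeplitz matrix of the powers of a contraction is positive: with
    [z k.+1 = T (z k + x k)], its quadratic form increases by
    [rnorm (z k + x k) ^+ 2 - rnorm (z k) ^+ 2 >=
      rnorm (z k.+1) ^+ 2 - rnorm (z k) ^+ 2] when the order grows by one. *)
Lemma toeplitz_ge0 N (x : nat -> H) :
  0 <= Re (\sum_(i < N) \sum_(j < N) tau T (i%:Z - j%:Z) (x j) (x i)).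
Proof.
pose z := fix z k := if k is k'.+1 then T (z k' + x k') else 0.
have zE k : z k = \sum_(j < k) iter (k - j) T (x j).
  elim: k => [|k IH]; first by rewrite big_ord0.
  rewrite big_ord_recr /= subSnn -[z k]scale1r TL scale1r IH; congr (_ + _).
  have T0 : T 0 = 0 by have := TL (-1) 0 0; rewrite scaler0 addr0 scaleN1r addNr.
  have TD u v : T (u + v) = T u + T v by rewrite -[u in LHS]scale1r TL scale1r.
  rewrite (big_morph T TD T0); apply: eq_bigr => j _.
  by rewrite subSn ?iterS// ltnW.
suff: rnorm (z N) ^+ 2 <=
    Re (\sum_(i < N) \sum_(j < N) tau T (i%:Z - j%:Z) (x j) (x i)).
  exact: le_trans (sqr_ge0 _).
elim: N => [|N IH]; first by rewrite big_ord0 /= rnorm0 expr0n.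
have zT u : \sum_(j < N) tau T (N%:Z - j%:Z) (x j) u = hinner (z N) u.
  rewrite zE (sesqui_suml ipS); apply: eq_bigr => j _.
  by rewrite subzn ?tau_nat// ltnW.
have zT' u : \sum_(i < N) tau T (i%:Z - N%:Z) u (x i) = hinner u (z N).
  rewrite hinner_conj -zT rmorph_sum /=; apply: eq_bigr => j _.
  by rewrite -tauN opprB.
rewrite big_ord_recr /=.
under eq_bigr do rewrite big_ord_recr /=.
rewrite big_split big_ord_recr /= zT' zT subrr tau_nat /=.
apply: (@le_trans _ _ (rnorm (z N + x N) ^+ 2)).
  by rewrite lerXn2r ?nnegrE ?rnorm_ge0.
rewrite sqr_rnormD -!Re_hinner !cReD (hinner_conj (z N) (x N)) cRe_conj.
by move: IH; rewrite -Re_hinner; lra.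
Qed.

(** [toeplitz_ge0] at the vectors [w ^+ k *: x]. *)
Lemma toeplitz_psd N (w : C) : rnorm w = 1 ->
  psd (fun x y => \sum_(i < N) \sum_(j < N)
    w ^ (- (i%:Z - j%:Z)) * tau T (i%:Z - j%:Z) x y).
Proof.
move=> w1; have w0 := rnorm1_neq0 w1.
have wV l : (w ^ l)^* = w ^ (- l) by exact: conj_unit_exp.
split; [split|..] => [a x x' y|a x y y'|x y|x].
- rewrite mulr_sumr -big_split; apply: eq_bigr => i _ /=.
  rewrite mulr_sumr -big_split; apply: eq_bigr => j _ /=.
  by rewrite (tau_sesqui _).1; ring.
- rewrite mulr_sumr -big_split; apply: eq_bigr => i _ /=.
  rewrite mulr_sumr -big_split; apply: eq_bigr => j _ /=.
  by rewrite (tau_sesqui _).2; ring.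
- rewrite rmorph_sum exchange_big; apply: eq_bigr => i _ /=.
  rewrite rmorph_sum; apply: eq_bigr => j _ /=.
  by rewrite rmorphM /= wV -tauN; congr (_ ^ _ * tau _ _ _ _); lia.
- have := toeplitz_ge0 N (fun k => w ^+ k *: x).
  congr (0 <= Re _); apply: eq_bigr => i _; apply: eq_bigr => j _.
  rewrite (sesquiZl (tau_sesqui _)) (sesquiZr (tau_sesqui _)) mulrA.
  congr (_ * _); rewrite exprnP (wV i) -expfzDr//; congr (_ ^ _); lia.
Qed.

(** Von Neumann's inequality for the harmonic extension: the coefficient of order
    [l] is applied to [T ^ l] for [l >= 0] and to the adjoint of [T ^ (- l)] for
    [l < 0]. The kernel of order [N] gives this up to the weights
    [1 - |l| / N], whose total effect [W / N] disappears as [N] grows. *)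
Lemma contraction_le n D (a : int -> 'M[C]_n) (S : R) (x y : 'I_n -> H) : 0 < S ->
  (forall l, (D < `|l|)%N -> a l = 0) ->
  (forall w : C, rnorm w = 1 -> forall v : 'cV_n,
    l2norm (zsum D (fun l => w ^ l *: a l) *m v) <= S * l2norm v) ->
  2 * rnorm (zsum D (fun l => mform (a l) (tau T l) x y)) <=
    S * (\sum_j rnorm (x j) ^+ 2 + \sum_i rnorm (y i) ^+ 2).
Proof.
move=> S0 aD hF.
pose m l := mform (a l) (tau T l) x y.
have mD l : (D < `|l|)%N -> m l = 0.
  move=> /aD al0; rewrite /m /mform al0 big1// => i _; rewrite big1// => j _.
  by rewrite mxE mul0r.
set X := _ + _; set Z := zsum D _; pose W := zsum D (fun l => m l *+ `|l|).
have key N : (D <= N)%N -> 2 * (N%:R * rnorm Z) <= N%:R * (S * X) + 2 * rnorm W.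
  move=> DN.
  have := @kernel_le R n H N a (fun l x y => tau T l x y *+ (N - `|l|)) S x y S0.
  have hp (w : C) : rnorm w = 1 ->
      psd (fun x y => zsum N (fun l => w ^ (- l) * (tau T l x y *+ (N - `|l|)))).
    move=> /(toeplitz_psd N); congr psd; apply/funext => u; apply/funext => v.
    rewrite (double_sum_sub N (fun l => w ^ (- l) * tau T l u v)).
    by apply: eq_zsum => l; rewrite mulrnAr.
  have hF' (w : C) : rnorm w = 1 -> forall v : 'cV_n,
    l2norm (zsum N (fun l => w ^ l *: a l) *m v) <= S * l2norm v.
    rewrite (zsum_widen DN) => [|l /aD ->]; last by rewrite scaler0.
    exact: hF.
  move=> /(_ hp hF') {hp hF'}.
  have -> : zsum N (fun l => mform (a l)
      (fun x y => tau T l x y *+ (N - `|l|)) x y) = N%:R * Z - W.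
    rewrite (zsum_widen DN) => [|l lD]; last first.
      by rewrite /mform big1// => i _; rewrite big1// => j _; rewrite aD// mxE mul0r.
    rewrite /Z /W /zsum mulr_sumr -sumrB; apply: eq_bigr => i _.
    rewrite [N%:R * _]mulr_natl -mulrnBr; last by have := ltn_ord i; lia.
    rewrite /m /mform -sumrMnl; apply: eq_bigr => p _.
    by rewrite -sumrMnl; apply: eq_bigr => q _; rewrite mulrnAr.
  rewrite subn0 => le1.
  have e2 (u : H) : Re (tau T 0 u u *+ N) = N%:R * rnorm u ^+ 2.
    by rewrite cReMn Re_hinner mulr_natl.
  move: le1; under eq_bigr do rewrite e2.
  under [X in _ * (_ + X)]eq_bigr do rewrite e2.
  rewrite -!mulr_sumr -mulrDr -/X mulrCA => le1.
  have : rnorm (N%:R * Z) <= rnorm (N%:R * Z - W) + rnorm W.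
    by rewrite -{1}[N%:R * Z](subrK W) rnorm_triangle.
  rewrite rnormM rnorm_nat => le2.
  lra.
rewrite leNgt; apply/negP => lt.
pose d := 2 * rnorm Z - S * X.
have d0 : 0 < d by rewrite subr_gt0.
pose N := (D + Num.truncn (2 * rnorm W / d)).+1.
have DN : (D <= N)%N by rewrite /N leqW // leq_addr.
have := key N DN.
have : 2 * rnorm W / d < N%:R.
  apply: (lt_le_trans (truncnS_gt _)); by rewrite ler_nat ltnS leq_addl.
rewrite ltr_pdivrMr// /d. lra.
Qed.

End Contraction.

(** * The remainder kernel *)

Section IntegerPowers.
Variables (R : realType) (H : hilbertType R).
Local Notation C := R[i].

Definition opz (A B : H -> H) (l : int) : H -> H :=
  match l with Posz k => iter k A | Negz k => iter k.+1 B end.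

Lemma opz_linear (A B : H -> H) l : linear A -> linear B -> linear (opz A B l).
Proof. by case: l => k AL BL; exact: is_linear_iter. Qed.

Lemma linear_op0 (A : H -> H) : linear A -> A 0 = 0.
Proof. by move=> AL; have := AL (-1) 0 0; rewrite scaler0 addr0 scaleN1r addNr. Qed.
Lemma linear_opD (A : H -> H) : linear A -> {morph A : x y / x + y}.
Proof. by move=> AL x y; rewrite -[x in LHS]scale1r AL scale1r. Qed.
Lemma linear_opZ (A : H -> H) a x : linear A -> A (a *: x) = a *: A x.
Proof. by move=> AL; rewrite -[a *: x]addr0 AL linear_op0 ?addr0. Qed.

Lemma linear_opB (A : H -> H) : linear A -> {morph A : x y / x - y}.
Proof.
by move=> AL x y; rewrite linear_opD// -scaleN1r linear_opZ// scaleN1r.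
Qed.

Lemma rnorm_iter (A : H -> H) (r : R) k x : 0 <= r ->
  (forall x, rnorm (A x) <= r * rnorm x) -> rnorm (iter k A x) <= r ^+ k * rnorm x.
Proof.
move=> r0 Ar; elim: k => [|k IH]; first by rewrite expr0 mul1r.
by rewrite iterS (le_trans (Ar _))// exprS -mulrA ler_wpM2l.
Qed.

Lemma rnorm_opz (A B : H -> H) (r : R) l x : 0 <= r ->
  (forall x, rnorm (A x) <= r * rnorm x) ->
  (forall x, rnorm (B x) <= r * rnorm x) ->
  rnorm (opz A B l x) <= r ^+ `|l| * rnorm x.
Proof. by case: l => k *; exact: rnorm_iter. Qed.

Lemma iterZ (T : H -> H) (c : C) k x : linear T ->
  iter k (fun x => c *: T x) x = c ^+ k *: iter k T x.
Proof.
move=> TL; elim: k => [|k IH]; first by rewrite expr0 scale1r.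
by rewrite !iterS IH linear_opZ// scalerA exprS.
Qed.

Lemma opzZ (A B : H -> H) (w : C) l x : linear A -> linear B -> w != 0 ->
  opz (fun x => w^-1 *: A x) (fun x => w *: B x) l x = w ^ (- l) *: opz A B l x.
Proof.
move=> AL BL w0.
case: l => k; rewrite /opz iterZ//; congr (_ *: _).
  by rewrite exprVn -exprnN.
Qed.

End IntegerPowers.

Section Geometric.
Variable R : realType.
Variable q : R.

Lemma zsum_expr N : zsum N (fun l => q ^+ `|l|) * (1 - q) = 1 + q - 2 * q ^+ N.+1.
Proof.
elim: N => [|N IH]; first by rewrite zsum0 expr0 expr1; ring.
by rewrite zsumS abszN absz_nat !mulrDl IH !exprS; ring.
Qed.

End Geometric.

Section Sector.
Variables (R : realType) (H : hilbertType R) (r : R).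
Hypothesis r1 : 1 < r.
Local Notation C := R[i].
Let kappa := r + r^-1.
Let ipS := psd_sesqui (@hinner_psd R H).

Variables U U' : H -> H.
Hypotheses (UL : linear U) (UL' : linear U').
Hypotheses (UK : cancel U U') (UK' : cancel U' U).
Hypothesis Ur : forall x, rnorm (U x) <= r * rnorm x.
Hypothesis Ur' : forall x, rnorm (U' x) <= r * rnorm x.

Let r0 : 0 < r. Proof. exact: lt_trans r1. Qed.

Lemma rnorm_inv_ge x : rnorm x <= r * rnorm (U x).
Proof. by rewrite -{1}[x]UK. Qed.

(** With [Q] the positive operator [U^* U], this says that
    [Q + Q^-1 <= r ^+ 2 + r ^- 2]; the vector [s] stands for [Q^-1 x]. It is the
    combination of [r^-1 <= |U| <= r] at the two vectors [x - r ^+ 2 *: s] and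
    [r ^+ 2 *: x - s] in which the mixed term of [U] disappears. *)
Lemma sqr_add_inv_le x s :
  rnorm (U x) ^+ 2 + 2 * Re (hinner x s) - rnorm (U s) ^+ 2 <=
    (r ^+ 2 + r ^- 2) * rnorm x ^+ 2.
Proof.
pose y := x - (r ^+ 2)%:C%C *: s; pose z := s - (r ^+ 2)%:C%C *: x.
have expand (u v : H) : rnorm (u - (r ^+ 2)%:C%C *: v) ^+ 2 =
    rnorm u ^+ 2 - 2 * r ^+ 2 * Re (hinner u v) + r ^+ 4 * rnorm v ^+ 2.
  rewrite sqr_rnormD (sesquiNr ipS) (sesquiZr ipS) conjCE /= oppr0 cReN cReMr.
  rewrite rnormN rnormZ rnormC ger0_norm ?sqr_ge0//; ring.
have le1 : rnorm (U z) ^+ 2 <= r ^+ 2 * rnorm z ^+ 2.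
  by apply: sqr_rnorm_le => //; exact: ltW.
have le2 : rnorm y ^+ 2 <= r ^+ 2 * rnorm (U y) ^+ 2.
  by apply: sqr_rnorm_le; [exact: ltW | exact: rnorm_inv_ge].
have UB (u v : H) : U (u - (r ^+ 2)%:C%C *: v) = U u - (r ^+ 2)%:C%C *: U v.
  by rewrite (linear_opB UL) (linear_opZ _ _ UL).
move: le1 le2; rewrite /y /z !UB !expand.
rewrite (hinner_conj x s) cRe_conj (hinner_conj (U x) (U s)) cRe_conj.
set a := rnorm x ^+ 2; set b := rnorm s ^+ 2; set c := rnorm (U x) ^+ 2.
set d := rnorm (U s) ^+ 2; set e := Re _; set f := Re _ => le1 le2.
have r4 : 0 < r ^+ 2 * (r ^+ 4 - 1).
  by rewrite mulr_gt0 ?exprn_gt0// subr_gt0 exprn_egt1.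
rewrite -(ler_pM2l r4).
have -> : r ^+ 2 * (r ^+ 4 - 1) * ((r ^+ 2 + r ^- 2) * a) = (r ^+ 8 - 1) * a.
  by field; rewrite gt_eqF.
have := ler_wpM2l (ltW (exprn_gt0 2 r0)) le1; lra.
Qed.

(** The numerical range of [U + U^-1] lies in the half-planes
    [Re (v * z) <= (r ^+ 2 + r ^- 2) * Re v], for the two unit vectors [v] of real
    part [kappa^-1]. When [U] has a polar decomposition [W P], the left-hand
    side is the real part of the form of [W (v P + v^* P^-1)], hence at most the
    maximum of [| v p + v^* p^-1 |] over [r^-1 <= p <= r]. *)
Lemma numerical_range_le (v : C) x : rnorm v = 1 -> Re v = kappa^-1 ->
  Re (v * (hinner (U x) x + hinner (U' x) x)) <=
    (r ^+ 2 + r ^- 2) / kappa * rnorm x ^+ 2.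
Proof.
move=> v1 vk.
have k0 : 0 < kappa by rewrite addr_gt0 ?invr_gt0.
have kE : r ^+ 2 + r ^- 2 = kappa ^+ 2 - 2 by rewrite /kappa; field; rewrite gt_eqF.
have k2 : 0 < kappa ^+ 2 - 2 by rewrite -kE addr_gt0 ?invr_gt0 ?exprn_gt0.
pose l := (kappa ^+ 2 - 2) / kappa; rewrite kE -/l.
have l0 : 0 < l by rewrite divr_gt0.
have := sqr_add_inv_le x (v * l%:C%C *: U' x - v ^+ 2 *: x).
have -> : U (v * l%:C%C *: U' x - v ^+ 2 *: x) =
    v *: (l%:C%C *: x + - (v *: U x)).
  rewrite (linear_opB UL) !(linear_opZ _ _ UL) UK' scalerBr !scalerA.
  by rewrite expr2.
rewrite rnormZ v1 mul1r sqr_rnormD rnormN !rnormZ v1 mul1r rnormC gtr0_norm//.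
rewrite (sesquiNr ipS) !(sesquiZr ipS) (sesquiZl ipS).
rewrite (sesquiDr ipS) (sesquiNr ipS) !(sesquiZr ipS) rmorphM rmorphXn /=.
have -> : hinner x (U' x) = (hinner (U' x) x)^* by exact: hinner_conj.
have -> : hinner x (U x) = (hinner (U x) x)^* by exact: hinner_conj.
have -> : (l%:C%C : C)^* = l%:C%C by rewrite conjCE /= oppr0.
rewrite kE.
have -> : (hinner x x : C) = (rnorm x ^+ 2)%:C%C.
  by rewrite hinnerE -rnormE rmorphXn.
have sv : Im v ^+ 2 = 1 - kappa ^- 2.
  by have := sqr_rnorm v; rewrite v1 vk expr1n exprVn => ->; ring.
rewrite !conjCE.
case: (hinner (U x) x) => a b; case: (hinner (U' x) x) => c d.
set X := rnorm x ^+ 2; set Y := rnorm (U x) ^+ 2.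
move: vk sv; case: (v) => e f /= -> {e} sv.
rewrite !expr2 /= -/X; simpc; rewrite /= => le1.
have lE : l ^+ 2 = kappa ^+ 2 - 4 + 4 * kappa ^- 2.
  by rewrite /l; field; rewrite gt_eqF.
have l2 : 0 < 2 * l by rewrite mulr_gt0.
rewrite -(ler_pM2l l2); move: le1.
have -> : l * rnorm x * (l * rnorm x) = l ^+ 2 * X by rewrite /X; ring.
have -> : kappa^-1 / kappa - f * f = 2 * kappa ^- 2 - 1.
  by rewrite -[f * f]expr2 sv; field; rewrite gt_eqF.
have -> : 2 * l * (l * X) = 2 * l ^+ 2 * X by ring.
rewrite !lE; set g := kappa^-1; set k' := kappa ^- 2; lra.
Qed.

(** The truncation of the kernel
    [\sum_l (r ^- 2) ^+ `|l| U ^ l =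
      (1 - r ^- 4) (1 + r ^- 4 - r ^- 2 (U + U^-1))^-1]. *)
Definition kern N (x : H) : H :=
  zsum N (fun l => ((r ^- 2) ^+ `|l|)%:C%C *: opz U U' l x).

Lemma kernS N x : kern N.+1 x =
  kern N x + ((r ^- 2) ^+ N.+1)%:C%C *: (iter N.+1 U x + iter N.+1 U' x).
Proof.
rewrite /kern zsumS abszN absz_nat -addrA addrC -addrA -scalerDr.
by rewrite [iter N.+1 U x + _]addrC.
Qed.

Lemma kern_linear N : linear (kern N).
Proof.
move=> a x y; rewrite /kern scaler_sumr -big_split; apply: eq_bigr => i _ /=.
by rewrite (opz_linear _ UL UL') scalerDr !scalerA mulrC.
Qed.

(** Multiplying the truncated kernel by its inverse telescopes, up to the two
    boundary terms. Pairing with [z] turns this into an identity of scalars. *)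
Lemma kern_resolvent N x z (t : C) : t = (r ^- 2)%:C%C ->
  (1 + t ^+ 2) * hinner (kern N x) z -
    t * (hinner (U (kern N x)) z + hinner (U' (kern N x)) z) =
  (1 - t ^+ 2) * hinner x z
  + t ^+ N.+2 * hinner (iter N U x + iter N U' x) z
  - t ^+ N.+1 * hinner (iter N.+1 U x + iter N.+1 U' x) z.
Proof.
move=> tE; elim: N => [|N IH].
  rewrite /kern zsum0 expr0 scale1r /= !(sesquiDl ipS) expr1; ring.
have UZD c (u v w : H) : U (u + c *: (v + w)) = U u + c *: (U v + U w).
  by rewrite (linear_opD UL) (linear_opZ _ _ UL) (linear_opD UL).
have UZD' c (u v w : H) : U' (u + c *: (v + w)) = U' u + c *: (U' v + U' w).
  by rewrite (linear_opD UL') (linear_opZ _ _ UL') (linear_opD UL').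
have e1 : U' (iter N.+1 U x) = iter N U x by rewrite iterS UK.
have e2 : U (iter N.+1 U' x) = iter N U' x by rewrite iterS UK'.
rewrite kernS UZD UZD' e1 e2 -!iterS.
rewrite !(sesquiDl ipS) !(sesquiZl ipS) !(sesquiDl ipS).
rewrite (sesquiDl ipS) (sesquiDl ipS (iter N.+1 U x)) in IH.
rewrite rmorphXn /= -tE !exprS in IH *.
apply/eqP; rewrite -subr_eq0; apply/eqP.
move: IH => /eqP; rewrite -subr_eq0 => /eqP IH; rewrite -[RHS]IH; ring.
Qed.

Let q := r^-1.
Let q0 : 0 < q. Proof. by rewrite invr_gt0. Qed.
Let q1 : q < 1. Proof. by rewrite invf_lt1. Qed.
Let qr : q * r = 1. Proof. by rewrite mulVf// gt_eqF. Qed.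

Lemma rnorm_kern N x : rnorm (kern N x) <= 2 / (1 - q) * rnorm x.
Proof.
have q1' : 0 < 1 - q by rewrite subr_gt0.
apply: (@le_trans _ _ (zsum N (fun l => q ^+ `|l|) * rnorm x)).
  rewrite /zsum mulr_suml; apply: (le_trans (rnorm_sum _ _ _)).
  apply: ler_sum => i _; set l := _ - _.
  have r2i k : 0 <= (r ^- 2) ^+ k.
    by apply: exprn_ge0; rewrite invr_ge0; apply: exprn_ge0; exact: ltW.
  rewrite rnormZ rnormC ger0_norm//.
  apply: le_trans (ler_wpM2l (r2i _) (rnorm_opz _ _ (ltW r0) Ur Ur')) _.
  rewrite mulrA ler_wpM2r ?rnorm_ge0// le_eqVlt; apply/orP; left; apply/eqP.
  by rewrite -exprMn; congr (_ ^+ _); rewrite /q; field; rewrite gt_eqF.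
apply: ler_wpM2r; first exact: rnorm_ge0.
rewrite ler_pdivlMr// zsum_expr.
have := exprn_ge0 N.+1 (ltW q0); lra.
Qed.

Definition kern_err N : R := 8 * q ^+ N / ((1 - q) * (1 - q ^+ 4)).

(** Put [w := kern N x]. As [x] is, up to the boundary terms, a positive multiple of
    the value at [w] of [r ^+ 2 + r ^- 2 - U - U^-1], the bound on the numerical range
    of [U + U^-1] makes [v * hinner x w] nearly positive. *)
Lemma kern_ge (v : C) N x : rnorm v = 1 -> Re v = kappa^-1 ->
  - (kern_err N * rnorm x ^+ 2) <= Re (v * hinner x (kern N x)).
Proof.
move=> v1 vk; set w := kern N x.
have k0 : 0 < kappa by rewrite addr_gt0 ?invr_gt0.
have q4 : 0 < 1 - q ^+ 4.
  by rewrite subr_gt0 exprn_ilt1 ?ltW.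
have q1' : 0 < 1 - q by rewrite subr_gt0.
have rng := numerical_range_le w v1 vk.
pose t : C := (q ^+ 2)%:C%C.
have tE : (r ^- 2)%:C%C = t by rewrite /t /q exprVn.
have res := kern_resolvent N x w (esym tE); rewrite -/w in res.
pose e : C := t ^+ N.+2 * hinner (iter N U x + iter N U' x) w
  - t ^+ N.+1 * hinner (iter N.+1 U x + iter N.+1 U' x) w.
have iter_le k : rnorm (iter k U x + iter k U' x) <= 2 * (r ^+ k * rnorm x).
  apply: (le_trans (rnorm_triangle _ _)).
  have := rnorm_iter k x (ltW r0) Ur; have := rnorm_iter k x (ltW r0) Ur'; lra.
have rt : rnorm t = q ^+ 2 by rewrite rnormC ger0_norm ?exprn_ge0 ?ltW.
have qk k : q ^+ k * r ^+ k = 1 by rewrite -exprMn qr expr1n.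
have term_le m k : rnorm (t ^+ m * hinner (iter k U x + iter k U' x) w) <=
    2 * (q ^+ (m * 2) * r ^+ k) * (rnorm x * rnorm w).
  rewrite rnormM rnormX rt -exprM mulnC.
  have h1 := le_trans (hinner_le _ w) (ler_wpM2r (rnorm_ge0 w) (iter_le k)).
  apply: le_trans (ler_wpM2l _ h1) _; first by rewrite exprn_ge0 ?ltW.
  by rewrite le_eqVlt; apply/orP; left; apply/eqP; ring.
have e_le : rnorm e <= 4 * q ^+ N * (rnorm x * rnorm w).
  rewrite /e; apply: (le_trans (rnorm_triangle _ _)); rewrite rnormN.
  have h1 := term_le N.+2 N; have h2 := term_le N.+1 N.+1.
  have e1 : q ^+ (N.+2 * 2) * r ^+ N = q ^+ 4 * q ^+ N.
    rewrite (_ : N.+2 * 2 = 4 + N + N)%N; last by rewrite muln2 -addnn !addSn !addnS.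
    by rewrite !exprD -mulrA qk mulr1.
  have e2 : q ^+ (N.+1 * 2) * r ^+ N.+1 = q * q ^+ N.
    rewrite (_ : N.+1 * 2 = N.+1 + N.+1)%N; last by rewrite muln2 addnn.
    by rewrite exprD -mulrA qk mulr1 exprS.
  rewrite e1 in h1; rewrite e2 in h2.
  have xw : 0 <= rnorm x * rnorm w by rewrite mulr_ge0 ?rnorm_ge0.
  have qN : 0 <= q ^+ N * (rnorm x * rnorm w) by rewrite mulr_ge0// exprn_ge0 ?ltW.
  have := ler_wpM2r qN (ltW q1).
  have : q ^+ 4 * (q ^+ N * (rnorm x * rnorm w)) <= q ^+ N * (rnorm x * rnorm w).
    by apply: ler_piMl => //; rewrite -subr_ge0 ltW.
  move: h1 h2; set X := rnorm x * rnorm w; lra.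
have w_le := rnorm_kern N x; rewrite -/w in w_le.
have ww : (hinner w w : C) = (rnorm w ^+ 2)%:C%C.
  by rewrite hinnerE -rnormE rmorphXn.
have resv : (1 - q ^+ 4) * Re (v * hinner x w) =
    (1 + q ^+ 4) * (kappa^-1 * rnorm w ^+ 2)
    - q ^+ 2 * Re (v * (hinner (U w) w + hinner (U' w) w)) - Re (v * e).
  have t2 : t ^+ 2 = (q ^+ 4)%:C%C by rewrite /t -rmorphXn /= -exprM.
  have r1C : (1 - q ^+ 4)%:C%C = 1 - t ^+ 2 by rewrite rmorphB /= t2.
  have r2C : (1 + q ^+ 4)%:C%C = 1 + t ^+ 2 by rewrite rmorphD /= t2.
  pose S : C := hinner (U w) w + hinner (U' w) w.
  have split3 : (1 - t ^+ 2) * hinner x w = (1 + t ^+ 2) * hinner w w - t * S - e.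
    by rewrite /S res /e; ring.
  clearbody e; have := congr1 (fun z : C => Re (v * z)) split3.
  rewrite !mulrBr !(cReD, cReN) -/S.
  rewrite -r1C -r2C (mulrCA v (1 - _)%:C%C) (mulrCA v (1 + _)%:C%C) (mulrCA v t).
  by rewrite !cReMr ww (mulrC v (rnorm w ^+ 2)%:C%C) cReMr vk [_ * kappa^-1]mulrC.
have Re_e : Re (v * e) <= rnorm e.
  by rewrite (le_trans (cRe_le_rnorm _))// rnormM v1 mul1r.
have cancel_w : q ^+ 2 * ((r ^+ 2 + r ^- 2) / kappa * rnorm w ^+ 2) =
    (1 + q ^+ 4) * (kappa^-1 * rnorm w ^+ 2).
  by rewrite /q; field; rewrite !gt_eqF.
have low : - rnorm e <= (1 - q ^+ 4) * Re (v * hinner x w).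
  have := ler_wpM2l (exprn_ge0 2 (ltW q0)) rng; lra.
have e_le' : rnorm e <= 4 * q ^+ N * (rnorm x * (2 / (1 - q) * rnorm x)).
  apply: (le_trans e_le); apply: ler_wpM2l.
    by apply: mulr_ge0 => //; apply: exprn_ge0; exact: ltW.
  by apply: ler_wpM2l w_le; exact: rnorm_ge0.
rewrite -(ler_pM2l q4) (le_trans _ low)// mulrN lerN2 (le_trans e_le')//.
rewrite le_eqVlt; apply/orP; left; apply/eqP.
by rewrite /kern_err; field; rewrite !gt_eqF.
Qed.

End Sector.

(** * The remainder *)

Section Remainder.
Variables (R : realType) (H : hilbertType R) (r : R).
Hypothesis r1 : 1 < r.
Local Notation C := R[i].
Let kappa := r + r^-1.
Let ipS := psd_sesqui (@hinner_psd R H).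
Let r0 : 0 < r. Proof. exact: lt_trans r1. Qed.
Let k0 : 0 < kappa. Proof. by rewrite addr_gt0 ?invr_gt0. Qed.
Let kE : r ^+ 2 + r ^- 2 = kappa ^+ 2 - 2.
Proof. by rewrite /kappa; field; rewrite gt_eqF. Qed.
Let k4 : 4 < kappa ^+ 2.
Proof.
rewrite -subr_gt0 (_ : _ - 4 = (r - r^-1) ^+ 2); last by rewrite /kappa; field; rewrite gt_eqF.
by rewrite exprn_gt0// subr_gt0 (lt_trans _ r1)// invf_lt1.
Qed.

Variables A B : H -> H.
Hypotheses (AL : linear A) (BL : linear B).
Hypotheses (AK : cancel A B) (BK : cancel B A).
Hypothesis Ar : forall x, rnorm (A x) <= r * rnorm x.
Hypothesis Br : forall x, rnorm (B x) <= r * rnorm x.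

(** The coefficient, in the remainder, of the Laurent coefficient of order [l]: it
    is the form of [r ^- (2 |l|)] times the adjoint of [A ^ (- l)]. *)
Definition remainder l (x y : H) : C :=
  ((r ^- 2) ^+ `|l|)%:C%C * hinner x (opz A B (- l) y).

Let err := kern_err r.

(** The Fourier coefficients of the hermitian part of [v] times the remainder
    kernel. The constant coefficient is raised by [err N], which restores the
    positivity lost by truncating at order [N]. *)
Definition sector_coef (v : C) N l (x y : H) : C :=
  (2^-1 : R)%:C%C * ((r ^- 2) ^+ `|l|)%:C%C *
    (v * hinner x (opz A B (- l) y) + v^* * hinner (opz A B l x) y)
  + (if l == 0 then (err N)%:C%C * hinner x y else 0).

Lemma sector_psd (v w : C) N : rnorm v = 1 -> Re v = kappa^-1 -> rnorm w = 1 ->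
  psd (fun x y => zsum N (fun l => w ^ (- l) * sector_coef v N l x y)).
Proof.
move=> v1 vk w1; have w0 := rnorm1_neq0 w1.
pose U x := w^-1 *: A x; pose U' x := w *: B x.
have UL : linear U by move=> a x y; rewrite /U AL scalerDr !scalerA mulrC.
have UL' : linear U' by move=> a x y; rewrite /U' BL scalerDr !scalerA mulrC.
have UK : cancel U U'.
  by move=> x; rewrite /U /U' (linear_opZ _ _ BL) AK scalerA divff// scale1r.
have UK' : cancel U' U.
  by move=> x; rewrite /U /U' (linear_opZ _ _ AL) BK scalerA mulVf// scale1r.
have Ur x : rnorm (U x) <= r * rnorm x by rewrite rnormZ rnormV w1 invr1 mul1r.
have Ur' x : rnorm (U' x) <= r * rnorm x by rewrite rnormZ w1 mul1r.
pose K := kern r U U' N.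
have KL : linear K by exact: kern_linear.
have Kr x y : hinner x (K y) =
    zsum N (fun l => w ^ (- l) * (((r ^- 2) ^+ `|l|)%:C%C *
      hinner x (opz A B (- l) y))).
  rewrite (zsum_opp N (fun l => w ^ (- l) * _)) /K /kern /zsum.
  rewrite (sesqui_sumr ipS); apply: eq_bigr => i _; set l := _ - _.
  rewrite (sesquiZr ipS) conjC_real /U /U' opzZ// (sesquiZr ipS).
  by rewrite conj_unit_exp// !opprK abszN mulrCA.
have Kl x y : hinner (K x) y =
    zsum N (fun l => w ^ (- l) * (((r ^- 2) ^+ `|l|)%:C%C *
      hinner (opz A B l x) y)).
  rewrite /K /kern /zsum (sesqui_suml ipS); apply: eq_bigr => i _; set l := _ - _.
  by rewrite (sesquiZl ipS) /U /U' opzZ// (sesquiZl ipS) mulrCA.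
pose h (x y : H) : C := (2^-1 : R)%:C%C * (v * hinner x (K y) + v^* * hinner (K x) y)
  + (err N)%:C%C * hinner x y.
have -> : (fun x y => zsum N (fun l => w ^ (- l) * sector_coef v N l x y)) = h.
  apply/funext => x; apply/funext => y; rewrite /h Kr Kl /sector_coef.
  rewrite -[in RHS](zsum_delta N ((err N)%:C%C * hinner x y)) /zsum !mulr_sumr -big_split /=.
  rewrite mulr_sumr -big_split; apply: eq_bigr => i _ /=; set l := _ - _.
  by case: eqP => [->|_]; rewrite ?oppr0 ?expr0z; ring.
split; [split|..] => [a x x' y|a x y y'|x y|x].
- by rewrite /h KL !(sesquiDl ipS) !(sesquiZl ipS); ring.
- by rewrite /h KL !(sesquiDr ipS) !(sesquiZr ipS); ring.
- rewrite /h (hinner_conj (K x) y) (hinner_conj x (K y)) (hinner_conj x y).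
  move: (err N) => e; rewrite !rmorphD /= !rmorphM /= !conjC_real rmorphD /= !rmorphM /=.
  by rewrite !conjCK; ring.
- rewrite /h cReD !cReMr cReD Re_hinner.
  have -> : Re (v^* * hinner (K x) x) = Re (v * hinner x (K x)).
    by rewrite (hinner_conj x (K x)) -rmorphM cRe_conj.
  have := kern_ge r1 UL UL' UK UK' Ur Ur' N x v1 vk; rewrite -/K -/err; lra.
Qed.

Lemma le_kern_err (D : nat) (z b k : R) :
  (forall N, (D <= N)%N -> z <= b + err N * k) -> z <= b.
Proof.
move=> hz; rewrite leNgt; apply/negP => bz.
have q0 : 0 < r^-1 by rewrite invr_gt0.
have q1 : r^-1 < 1 by rewrite invf_lt1.
pose c0 := 8 / ((1 - r^-1) * (1 - r^-1 ^+ 4)).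
have c00 : 0 <= c0.
  by rewrite divr_ge0// mulr_ge0// subr_ge0 ?exprn_ile1// ltW.
pose c := c0 * `|k|.
have : (fun n => r^-1 ^+ n * c) @ \oo --> (0 * c).
  by apply: cvgMl; apply: cvg_expr; rewrite ger0_norm ?ltW.
rewrite mul0r => /cvgrPdist_lt /(_ (z - b)); rewrite subr_gt0 => /(_ bz).
case=> M _ hM; have := hM (maxn M D); rewrite /= leq_maxl => /(_ isT).
have := hz (maxn M D); rewrite leq_maxr => /(_ isT).
set N := maxn M D; rewrite sub0r normrN => le1.
have qN : 0 <= r^-1 ^+ N by rewrite exprn_ge0 ?ltW.
have le2 : err N * k <= r^-1 ^+ N * c.
  have -> : err N = r^-1 ^+ N * c0 by rewrite /err /kern_err /c0; ring.
  by rewrite /c -mulrA ler_wpM2l// ler_wpM2l// ler_norm.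
have := ler_norm (r^-1 ^+ N * c); lra.
Qed.

(** Both directions of the sector contribute a positive kernel with the same
    diagonal average [kappa^-1], and the remainder is a combination of the two
    with coefficients of modulus [(2 * kappa^-1 * s)^-1], where [s] is the cosine of
    the half-angle of the sector. *)
Lemma remainder_sector_le n D (a : int -> 'M[C]_n) (S : R) (x y : 'I_n -> H) :
  0 < S -> (forall l, (D < `|l|)%N -> a l = 0) ->
  (forall w : C, rnorm w = 1 -> forall v : 'cV_n,
    l2norm (zsum D (fun l => w ^ l *: a l) *m v) <= S * l2norm v) ->
  2 * rnorm (zsum D (fun l => mform (a l) (remainder l) x y)) <=
    kappa / Num.sqrt (kappa ^+ 2 - 1) * S *
      (\sum_j rnorm (x j) ^+ 2 + \sum_i rnorm (y i) ^+ 2).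
Proof.
move=> S0 aD hF; set X := \sum_j _ + _; set E := zsum D _.
have X0 : 0 <= X by apply: addr_ge0; apply: sumr_ge0 => i _; exact: sqr_ge0.
have k1 : 0 < kappa ^+ 2 - 1 by rewrite subr_gt0 (lt_trans _ k4)// ltr1n.
pose s := Num.sqrt (kappa ^+ 2 - 1) / kappa.
have s0 : 0 < s by rewrite divr_gt0// sqrtr_gt0.
have s2 : s ^+ 2 = 1 - kappa ^- 2.
  by rewrite exprMn sqr_sqrtr ?ltW// exprVn mulrBl divff ?mul1r// expf_neq0// gt_eqF.
pose u : C := (kappa^-1 +i* s)%C.
have u1 : rnorm u = 1.
  apply/eqP; rewrite -(@eqrXn2 _ 2) ?rnorm_ge0// sqr_rnorm /= s2 expr1n exprVn.
  by apply/eqP; ring.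
have u1' : rnorm u^* = 1 by rewrite rnorm_conj.
pose rho : C := (0 -i* (kappa / (2 * s)))%C.
have ks0 : 0 < kappa / (2 * s) by apply: divr_gt0 => //; apply: mulr_gt0.
have rn : rnorm rho = kappa / (2 * s).
  apply/eqP; rewrite -(@eqrXn2 _ 2) ?rnorm_ge0//; last exact: ltW.
  by rewrite sqr_rnorm /= expr0n add0r sqrrN.
have rho2 : rho * (u ^+ 2 - u^* ^+ 2) = 2.
  rewrite conjCE /rho /u !expr2; simpc; rewrite /=.
  have e4 : kappa / (2 * s) * (kappa^-1 * s + s / kappa + (kappa^-1 * s + s / kappa)) = 2.
    by field; rewrite !gt_eqF.
  by rewrite e4 (natrC R 2); congr Complex; ring.
pose M0 := mform (a 0) (fun x y : H => hinner x y : C) x y.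
pose P v N := zsum N (fun l => mform (a l) (sector_coef v N l) x y).
have P_le v N : (D <= N)%N -> rnorm v = 1 -> Re v = kappa^-1 ->
    2 * rnorm (P v N) <= S * ((kappa^-1 + err N) * X).
  move=> DN v1 vk.
  have hF' (w : C) : rnorm w = 1 -> forall v : 'cV_n,
      l2norm (zsum N (fun l => w ^ l *: a l) *m v) <= S * l2norm v.
    rewrite (zsum_widen DN) => [|l /aD ->]; last by rewrite scaler0.
    exact: hF.
  have := kernel_le x y S0 (fun w => sector_psd N v1 vk) hF'.
  rewrite -/(P v N).
  have e2 (z : H) : Re (sector_coef v N 0 z z) = (kappa^-1 + err N) * rnorm z ^+ 2.
    rewrite /sector_coef eqxx oppr0 expr0 mulr1 /= cReD !cReMr -mulrDl.
    have -> : v + v^* = (2 * Re v)%:C%C by case: (v) => p q; rewrite conjCE; simpc; rewrite mulr2n mulrDl mul1r.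
    by rewrite cReMr !Re_hinner vk; field; rewrite gt_eqF.
  rewrite (eq_bigr _ (fun i _ => e2 (x i))) (eq_bigr _ (fun i _ => e2 (y i))).
  by rewrite -!mulr_sumr -mulrDr.
(* With [u'] the conjugate of [u], and [k'] the adjoint of the remainder kernel [k],
   the kernels for [v = u] and [v = u'] are, up to the common factor [2^-1], [u k + u' k']
   and [u' k + u k']. Multiplying by [u] and [- u'] eliminates [k'] and leaves
   [(u ^+ 2 - u' ^+ 2) k]; [rho] normalises this factor to [2]. *)
have comb N : (D <= N)%N ->
    E = (rho * u) * P u N - (rho * u^*) * P u^* N - (rho * (u - u^*)) * ((err N)%:C%C * M0).
  move=> DN; rewrite /E -(zsum_widen DN); last first.
    move=> l /aD al0; rewrite /mform al0 big1// => i _; rewrite big1// => j _.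
    by rewrite mxE mul0r.
  have [m0 m0E] : exists m, m = M0 by exists M0.
  rewrite -m0E -(zsum_delta N ((rho * (u - u^*)) * _)) /P /zsum !mulr_sumr -!sumrB.
  apply: eq_bigr => i _; set l := _ - _.
  have -> : (if l == 0 then rho * (u - u^*) * ((err N)%:C%C * m0) else 0) =
      rho * (u - u^*) * mform (a l) (fun x y => if l == 0 then (err N)%:C%C * hinner x y else 0) x y.
    case: eqP => [->|_]; last first.
      by rewrite /mform big1 ?mulr0// => p _; rewrite big1// => p' _; rewrite mulr0.
    rewrite m0E /M0 /mform; congr (_ * _); rewrite mulr_sumr; apply: eq_bigr => p _.
    by rewrite mulr_sumr; apply: eq_bigr => p' _; rewrite mulrCA.
  rewrite /mform !mulr_sumr -!sumrB; apply: eq_bigr => p _.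
  rewrite !mulr_sumr -!sumrB; apply: eq_bigr => p' _.
  rewrite /remainder /sector_coef conjCK; set F := a l p p'.
  set t : C := (_ ^+ `|l|)%:C%C; set h1 := hinner _ (opz _ _ _ _).
  set h2 := hinner (opz _ _ _ _) _; set d := (if _ then _ else _).
  have h12 : (2^-1 : R)%:C%C * 2 = 1 :> C.
    by rewrite (natrC R 2) -rmorphM /= mulVf// pnatr_eq0.
  transitivity (F * (t * h1 * ((2^-1 : R)%:C%C * (rho * (u ^+ 2 - u^* ^+ 2))))).
    by rewrite rho2 h12 mulr1.
  by ring.
pose k := kappa / (2 * s).
apply: (@le_kern_err D _ _ (2 * k * S * X + 4 * k * rnorm M0)) => N DN.
have err0 : 0 <= err N.
  by rewrite /err /kern_err divr_ge0 ?mulr_ge0 ?exprn_ge0// ?subr_ge0 ?exprn_ile1// ?invr_ge0 ?invf_le1//; exact: ltW.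
have k0' : 0 <= k by exact: ltW.
have := P_le u N DN u1 erefl.
have := P_le u^* N DN u1' (cRe_conj _).
set p := rnorm (P u N); set p' := rnorm (P u^* N) => le1 le2.
have le3 : rnorm E <= k * p + k * p' + 2 * k * (err N * rnorm M0).
  rewrite (comb N DN); apply: (le_trans (rnorm_triangle _ _)); rewrite rnormN lerD//.
    by apply: (le_trans (rnorm_triangle _ _)); rewrite rnormN !rnormM rn u1 u1' mulr1.
  rewrite !rnormM rn rnormC (ger0_norm err0) -/k; apply: ler_wpM2r.
    by rewrite mulr_ge0// rnorm_ge0.
  rewrite mulrC; apply: ler_wpM2r => //; apply: (le_trans (rnorm_triangle _ _)).
  by rewrite rnormN u1 u1'.
have ks : kappa / Num.sqrt (kappa ^+ 2 - 1) = 2 * k * kappa^-1.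
  rewrite /k /s; field; rewrite !gt_eqF// sqrtr_gt0//.
rewrite ks.
have := ler_wpM2l k0' le1; have := ler_wpM2l k0' le2; lra.
Qed.

End Remainder.

Section Parseval.
Variables (R : realType) (H : hilbertType R).
Local Notation C := R[i].
Let ipS := psd_sesqui (@hinner_psd R H).

Lemma parseval N (e : C) (z : int -> H) : N.*2.+1.-primitive_root e ->
  \sum_(k < N.*2.+1) rnorm (zsum N (fun l => (e ^+ k) ^ l *: z l)) ^+ 2 =
  N.*2.+1%:R * zsum N (fun l => rnorm (z l) ^+ 2).
Proof.
move=> pe; have e1 := prim_root_rnorm pe; have e0 := rnorm1_neq0 e1.
have ek (k : nat) : rnorm (e ^+ k) = 1 by rewrite rnormX e1 expr1n.
apply: complexI; rewrite rmorph_sum rmorphM /=.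
have hz (u : H) : (rnorm u ^+ 2)%:C%C = hinner u u :> C.
  by rewrite hinnerE -rnormE rmorphXn.
rewrite [in RHS]/zsum rmorph_sum mulr_sumr.
transitivity (\sum_(k < N.*2.+1) \sum_(i < N.*2.+1) \sum_(l < N.*2.+1)
    (e ^+ k) ^ (i%:Z - l%:Z) * hinner (z (i%:Z - N%:Z)) (z (l%:Z - N%:Z))).
  apply: eq_bigr => k _; rewrite hz /zsum (sesqui_suml ipS).
  apply: eq_bigr => i _; rewrite (sesqui_sumr ipS); apply: eq_bigr => l _.
  rewrite (sesquiZl ipS) (sesquiZr ipS) conj_unit_exp// mulrA -expfzDr ?expf_neq0//.
  by congr (_ ^ _ * _); lia.
rewrite exchange_big; apply: eq_bigr => i _ /=.
rewrite exchange_big /= (bigD1 i)//= [X in _ + X]big1 => [|l li].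
  by rewrite addr0 -mulr_suml fourier_ortho// eqxx hz natrC.
by rewrite -mulr_suml fourier_ortho// eq_sym (negPf li) mul0r.
Qed.

End Parseval.

Section RemainderParseval.
Variables (R : realType) (H : hilbertType R) (r : R).
Hypothesis r1 : 1 < r.
Local Notation C := R[i].
Let ipS := psd_sesqui (@hinner_psd R H).
Let r0 : 0 < r. Proof. exact: lt_trans r1. Qed.

Variables A B : H -> H.
Hypothesis Ar : forall x, rnorm (A x) <= r * rnorm x.
Hypothesis Br : forall x, rnorm (B x) <= r * rnorm x.

Lemma zsum_le N (f g : int -> R) : (forall l, f l <= g l) -> zsum N f <= zsum N g.
Proof. by move=> fg; apply: ler_sum => i _. Qed.

Lemma zsum_geometric_le D :
  zsum D (fun l => (r ^- 2) ^+ `|l|) <= (r ^+ 2 + 1) / (r ^+ 2 - 1).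
Proof.
have q0 : 0 < r ^- 2 by rewrite invr_gt0 exprn_gt0.
have q1 : 0 < 1 - r ^- 2.
  by rewrite subr_gt0 invf_lt1 ?exprn_gt0// exprn_egt1.
have r21 : 0 < r ^+ 2 - 1 by rewrite subr_gt0 exprn_egt1.
rewrite -(ler_pM2r q1) zsum_expr.
have -> : (r ^+ 2 + 1) / (r ^+ 2 - 1) * (1 - r ^- 2) = 1 + r ^- 2.
  by field; rewrite !gt_eqF.
by rewrite gerBl mulr_ge0// exprn_ge0 ?ltW.
Qed.

(** By Parseval the coefficients [a l] satisfy
    [\sum_l |a l x| ^+ 2 <= S ^+ 2 |x| ^+ 2], whereas
    [r ^- (2 |l|) |A ^ (- l) y| <= r ^- |l| |y|]; Cauchy-Schwarz in [l] leaves the square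
    root of [\sum_l r ^- (2 |l|)]. *)
Lemma remainder_parseval_le n D (a : int -> 'M[C]_n) (S : R) (x y : 'I_n -> H) :
  0 < S ->
  (forall w : C, rnorm w = 1 -> forall v : 'cV_n,
    l2norm (zsum D (fun l => w ^ l *: a l) *m v) <= S * l2norm v) ->
  2 * rnorm (zsum D (fun l => mform (a l) (remainder r A B l) x y)) <=
    Num.sqrt ((r ^+ 2 + 1) / (r ^+ 2 - 1)) * S *
      (\sum_j rnorm (x j) ^+ 2 + \sum_i rnorm (y i) ^+ 2).
Proof.
move=> S0 hF; set X := \sum_j _; set Y := \sum_i _; set Q := (r ^+ 2 + 1) / _.
have r20 : 0 < r ^+ 2 by rewrite exprn_gt0.
have r21 : 0 < r ^+ 2 - 1 by rewrite subr_gt0 exprn_egt1.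
have Q0 : 0 < Q by apply: divr_gt0 => //; apply: addr_gt0.
pose z l i := \sum_j a l i j *: x j.
pose t l : R := (r ^- 2) ^+ `|l|.
have t0 l : 0 <= t l by apply: exprn_ge0; rewrite invr_ge0; apply: exprn_ge0; exact: ltW.
have sQ : 0 < Num.sqrt Q by rewrite sqrtr_gt0.
pose lam := S / Num.sqrt Q.
have lam0 : 0 < lam by rewrite divr_gt0.
have formE l : mform (a l) (remainder r A B l) x y =
    \sum_i hinner (z l i) ((t l)%:C%C *: opz A B (- l) (y i)).
  apply: eq_bigr => i _; rewrite (sesqui_suml ipS); apply: eq_bigr => j _.
  by rewrite (sesquiZl ipS) (sesquiZr ipS) conjC_real.
have sum_z : zsum D (fun l => \sum_i rnorm (z l i) ^+ 2) <= S ^+ 2 * X.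
  pose M := D.*2.+1; have [e pe] := @prim_root_exists R M isT.
  have M0 : 0 < (M%:R : R) by rewrite ltr0n.
  rewrite -(ler_pM2l M0).
  have -> : M%:R * zsum D (fun l => \sum_i rnorm (z l i) ^+ 2) =
      \sum_(k < M) \sum_i rnorm (zsum D (fun l => (e ^+ k) ^ l *: z l i)) ^+ 2.
    rewrite exchange_big /= /zsum exchange_big /= mulr_sumr.
    by apply: eq_bigr => i _; rewrite -(parseval (fun l => z l i) pe).
  have -> : M%:R * (S ^+ 2 * X) = \sum_(k < M) S ^+ 2 * X.
    by rewrite sumr_const card_ord mulr_natl.
  apply: ler_sum => k _.
  have w1 : rnorm (e ^+ k) = 1 by rewrite rnormX (prim_root_rnorm pe) expr1n.
  have := @psd_mulmx R n H (zsum D (fun l => (e ^+ k) ^ l *: a l)) _ (S ^+ 2) x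
    (@hinner_psd R H).
  have hF2 (c : 'cV_n) : l2norm (zsum D (fun l => (e ^+ k) ^ l *: a l) *m c) ^+ 2 <=
      S ^+ 2 * l2norm c ^+ 2.
    rewrite -exprMn; apply: lerXn2r; rewrite ?nnegrE ?l2norm_ge0//.
      by apply: mulr_ge0; [exact: ltW | exact: l2norm_ge0].
    exact: hF.
  move=> /(_ hF2); rewrite (eq_bigr _ (fun j _ => Re_hinner (x j))) -/X.
  congr (_ <= _); apply: eq_bigr => i _; rewrite Re_hinner; congr (rnorm _ ^+ 2).
  rewrite /z /zsum; under [RHS]eq_bigr do rewrite scaler_sumr.
  rewrite exchange_big; apply: eq_bigr => j _; rewrite summxE scaler_suml.
  by apply: eq_bigr => l _; rewrite mxE scalerA.
have sum_y : zsum D (fun l => \sum_i rnorm ((t l)%:C%C *: opz A B (- l) (y i)) ^+ 2) <= Q * Y.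
  apply: (@le_trans _ _ (zsum D (fun l => t l * Y))).
    apply: zsum_le => l; rewrite mulr_sumr; apply: ler_sum => i _.
    rewrite rnormZ rnormC ger0_norm//.
    have h1 := rnorm_opz (- l) (y i) (ltW r0) Ar Br; rewrite abszN in h1.
    have h2 := sqr_rnorm_le (exprn_ge0 `|l| (ltW r0)) h1.
    rewrite exprMn; apply: le_trans (ler_wpM2l (sqr_ge0 _) h2) _.
    have tr : t l * r ^+ `|l| ^+ 2 = 1.
      by rewrite /t -exprM mulnC exprM -exprMn mulVf ?expr1n// gt_eqF.
    by rewrite mulrA expr2 -[t l * t l * _]mulrA tr mulr1.
  rewrite /zsum -mulr_suml; apply: ler_wpM2r; last exact: zsum_geometric_le.
  by apply: sumr_ge0 => i _; exact: sqr_ge0.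
apply: (@le_trans _ _ (lam^-1 * (S ^+ 2 * X) + lam * (Q * Y))); last first.
  have sQ2 : Num.sqrt Q ^+ 2 = Q by rewrite sqr_sqrtr// ltW.
  rewrite /lam le_eqVlt; apply/orP; left; apply/eqP.
  move: sQ sQ2; set c := Num.sqrt Q => sQ <-.
  by field; rewrite !gt_eqF.
apply: le_trans (lerD (ler_wpM2l _ sum_z) (ler_wpM2l _ sum_y)); last 2 first.
- by rewrite invr_ge0 ltW.
- exact: ltW.
rewrite (_ : zsum D _ = zsum D (fun l => \sum_i hinner (z l i) ((t l)%:C%C *: opz A B (- l) (y i)))); last exact: eq_zsum.
rewrite /zsum !mulr_sumr -big_split /=.
apply: (le_trans (ler_wpM2l _ (rnorm_sum _ _ _))) => //.
rewrite mulr_sumr; apply: ler_sum => k _.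
apply: (le_trans (ler_wpM2l _ (rnorm_sum _ _ _))) => //.
rewrite !mulr_sumr -big_split /=; apply: ler_sum => i _.
have := psd_amgmZ (z (k%:Z - D%:Z) i)
  ((t (k%:Z - D%:Z))%:C%C *: opz A B (- (k%:Z - D%:Z)) (y i)) (@hinner_psd R H) lam0.
by rewrite !Re_hinner.
Qed.

End RemainderParseval.

(** * Laurent polynomials *)

Definition upper_constant (R : realType) (r : R) : R :=
  Num.min (Num.sqrt ((r ^+ 2 + 2 * r + 1) / (r ^+ 2 + r + 1)))
          (Num.sqrt ((r ^+ 2 + 1) / (r ^+ 2 - 1))).

Section Laurent.
Variables (R : realType) (H : hilbertType R) (r : R).
Hypothesis r1 : 1 < r.
Local Notation C := R[i].
Let ipS := psd_sesqui (@hinner_psd R H).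
Let r0 : 0 < r. Proof. exact: lt_trans r1. Qed.

(** In terms of [k := r + r^-1 >= 2], the squares are [k ^+ 2 / (k ^+ 2 - 1)] and
    [(k + 2) / (k + 1)]. *)
Lemma sector_constant_le : (r + r^-1) / Num.sqrt ((r + r^-1) ^+ 2 - 1) <=
  Num.sqrt ((r ^+ 2 + 2 * r + 1) / (r ^+ 2 + r + 1)).
Proof.
set k := r + r^-1.
have k2 : 2 <= k.
  rewrite -subr_ge0 (_ : k - 2 = (r - 1) ^+ 2 / r); last by rewrite /k; field; rewrite gt_eqF.
  by apply: divr_ge0; [exact: sqr_ge0 | exact: ltW].
have kk : 0 < k ^+ 2 - 1 by nra.
have k0 : 0 < k by lra.
have -> : k / Num.sqrt (k ^+ 2 - 1) = Num.sqrt (k ^+ 2 / (k ^+ 2 - 1)).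
  by rewrite sqrtrM ?sqr_ge0// sqrtr_sqr (ger0_norm (ltW k0)) sqrtrV// ltW.
rewrite ler_sqrt; last first.
  by apply: divr_ge0; rewrite !addr_ge0 ?mulr_ge0 ?sqr_ge0 ?ler01//; apply: ltW.
have -> : (r ^+ 2 + 2 * r + 1) / (r ^+ 2 + r + 1) = (k + 2) / (k + 1).
  by rewrite /k; field; rewrite !gt_eqF//; nra.
rewrite ler_pdivrMr// mulrAC ler_pdivlMr; last lra.
nra.
Qed.

Variables A B : H -> H.
Hypotheses (AL : linear A) (BL : linear B).
Hypotheses (AK : cancel A B) (BK : cancel B A).
Hypothesis Ar : forall x, rnorm (A x) <= r * rnorm x.
Hypothesis Br : forall x, rnorm (B x) <= r * rnorm x.

Lemma tauZ (T : H -> H) l x y : linear T ->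
  tau (fun x => (r^-1)%:C%C *: T x) l x y = (r^-1 ^+ `|l|)%:C%C * tau T l x y.
Proof.
move=> TL; case: l => k; rewrite /tau iterZ//.
  by rewrite (sesquiZl ipS) rmorphXn.
by rewrite (sesquiZr ipS) rmorphXn /= conjC_real -rmorphXn.
Qed.

Lemma scaled_contraction (T : H -> H) x : (forall x, rnorm (T x) <= r * rnorm x) ->
  rnorm ((r^-1)%:C%C *: T x) <= rnorm x.
Proof.
move=> Tr; rewrite rnormZ rnormC gtr0_norm ?invr_gt0//.
by rewrite -(ler_pM2l r0) mulrA divff ?mul1r// gt_eqF.
Qed.

(** The comparison of coefficients behind the upper bound: on the outer circle the
    positive kernel of [r^-1 A] reproduces the terms [l >= 0], on the inner circle
    that of [r^-1 B] reproduces the terms [l <= 0], and the unwanted terms add up to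
    the remainder. *)
Lemma laurent_form_le n D (a : int -> 'M[C]_n) (S : R) (x y : 'I_n -> H) :
  0 < S -> (forall l, (D < `|l|)%N -> a l = 0) ->
  (forall z : C, r^-1 <= rnorm z <= r -> forall v : 'cV_n,
    l2norm (zsum D (fun l => z ^ l *: a l) *m v) <= S * l2norm v) ->
  2 * rnorm (zsum D (fun l => mform (a l) (fun x y => hinner (opz A B l x) y) x y)) <=
    (2 + upper_constant r) * S *
      (\sum_j rnorm (x j) ^+ 2 + \sum_i rnorm (y i) ^+ 2).
Proof.
move=> S0 aD hF; set X := \sum_j _ + _.
have X0 : 0 <= X by apply: addr_ge0; apply: sumr_ge0 => i _; exact: sqr_ge0.
have rV1 : r^-1 <= 1 by rewrite invf_le1// ltW.
have rC0 : (r%:C%C : C) != 0 by rewrite (inj_eq (@complexI _)) gt_eqF.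
pose TA x := (r^-1)%:C%C *: A x; pose TB x := (r^-1)%:C%C *: B x.
have TAL : linear TA by move=> c u v; rewrite /TA AL scalerDr !scalerA mulrC.
have TBL : linear TB by move=> c u v; rewrite /TB BL scalerDr !scalerA mulrC.
pose a1 l := (r%:C%C : C) ^ l *: a l.
pose a2 l := (r%:C%C : C) ^ l *: a (- l).
have hF1 (w : C) : rnorm w = 1 -> forall v : 'cV_n,
    l2norm (zsum D (fun l => w ^ l *: a1 l) *m v) <= S * l2norm v.
  move=> w1 v.
  have -> : zsum D (fun l => w ^ l *: a1 l) = zsum D (fun l => (w * r%:C%C) ^ l *: a l).
    by apply: eq_zsum => l; rewrite /a1 scalerA expfzMl.
  apply: hF; rewrite rnormM w1 mul1r rnormC gtr0_norm//.
  by rewrite lexx andbT (le_trans rV1 (ltW r1)).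
have hF2 (w : C) : rnorm w = 1 -> forall v : 'cV_n,
    l2norm (zsum D (fun l => w ^ l *: a2 l) *m v) <= S * l2norm v.
  move=> w1 v.
  have -> : zsum D (fun l => w ^ l *: a2 l) =
      zsum D (fun l => ((w * r%:C%C)^-1) ^ l *: a l).
    rewrite [RHS]zsum_opp; apply: eq_zsum => l.
    by rewrite /a2 scalerA exprz_inv opprK expfzMl.
  apply: hF; rewrite rnormV rnormM w1 mul1r rnormC gtr0_norm//.
  by rewrite lexx (le_trans rV1 (ltW r1)).
have hF3 (w : C) : rnorm w = 1 -> forall v : 'cV_n,
    l2norm (zsum D (fun l => w ^ l *: a l) *m v) <= S * l2norm v.
  by move=> w1; apply: hF; rewrite w1 rV1 ltW.
have a1D l : (D < `|l|)%N -> a1 l = 0 by move=> /aD al; rewrite /a1 al scaler0.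
have a2D l : (D < `|l|)%N -> a2 l = 0.
  by move=> lD; rewrite /a2 aD ?scaler0// abszN.
have le1 := contraction_le TAL (fun x => scaled_contraction x Ar) x y S0 a1D hF1.
have le2 := contraction_le TBL (fun x => scaled_contraction x Br) x y S0 a2D hF2.
have le3 := remainder_sector_le r1 AL BL AK BK Ar Br x y S0 aD hF3.
have le4 := remainder_parseval_le r1 Ar Br x y S0 hF3.
rewrite -/X in le1 le2 le3 le4.
set E3 := zsum _ _ in le3; rewrite -/E3 in le4.
set E1 := zsum _ _ in le1; set E2 := zsum _ _ in le2.
have SX : 0 <= S * X by rewrite mulr_ge0// ltW.
have le5 : 2 * rnorm E3 <= upper_constant r * S * X.
  rewrite /upper_constant -mulrA minEle; case: ifP => _; last by rewrite mulrA.
  by rewrite -mulrA in le3; apply: (le_trans le3); apply: ler_wpM2r => //; exact: sector_constant_le.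
have -> : zsum D (fun l => mform (a l) (fun x y => hinner (opz A B l x) y) x y) =
    E1 + E2 - E3.
  have -> : E2 = zsum D (fun l => mform (a2 (- l)) (tau TB (- l)) x y).
    exact: zsum_opp.
  rewrite /E1 /E3 /zsum -big_split -sumrB; apply: eq_bigr => i _ /=.
  set l := _ - _; rewrite /mform -big_split -sumrB; apply: eq_bigr => p _ /=.
  rewrite -big_split -sumrB; apply: eq_bigr => p' _ /=.
  rewrite /a1 /a2 opprK !mxE /TA /TB !tauZ// /remainder abszN.
  have rr k : (r%:C%C : C) ^+ k * (r^-1 ^+ k)%:C%C = 1.
    by rewrite -rmorphXn -rmorphM /= -exprMn divff ?expr1n// gt_eqF.
  have r2 k : (r%:C%C : C) ^- k * (r^-1 ^+ k)%:C%C = ((r ^- 2) ^+ k)%:C%C.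
    rewrite -rmorphXn -fmorphV -rmorphM /=; congr (_%:C%C).
    by rewrite -exprVn -exprMn; congr (_ ^+ _); field; rewrite gt_eqF.
  have reorg (c f g h : C) : c * f * (g * h) = f * ((c * g) * h) by ring.
  rewrite !reorg -mulrDr -mulrBr; congr (_ * _).
  case: l => [[|k]|k].
  - by rewrite oppr0 !expr0z /= !mul1r addrK.
  - rewrite -exprnN -exprnP rr r2 /= mul1r /tau.
    by rewrite addrK.
  - rewrite NegzE opprK -exprnN -exprnP rr ?abszN ?absz_nat r2 /= mul1r.
    by rewrite addrAC subrr add0r.
have := le_trans (rnorm_triangle (E1 + E2) (- E3)) (lerD (rnorm_triangle E1 E2) (lexx _)).
by rewrite rnormN; lra.
Qed.

End Laurent.

(** * Bounded operators *)

Section Operators.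
Variables (R : realType) (H : hilbertType R).
Local Notation C := R[i].
Implicit Types A B : H -> H.

Lemma bounded_operatorP A : bounded_operator A <->
  linear A /\ exists2 M : R, 0 <= M & forall x, rnorm (A x) <= M * rnorm x.
Proof.
split=> [[AL Ab]|[AL [M M0 AM]]]; split => //.
  pose f : {linear H -> H} := HB.pack A (GRing.isLinear.Build _ _ _ _ A AL).
  have /linear_boundedP : bounded_near f (nbhs (0 : H)) by exact: Ab.
  move=> /pinfty_ex_gt0 [M M0 hM].
  have ME : M = (Re M)%:C%C by rewrite RRe_real// gtr0_real.
  exists (Re M); first by rewrite -ler0c -ME ltW.
  by move=> x; rewrite -lecR rmorphM /= -ME !rnormE; exact: hM.
pose f : {linear H -> H} := HB.pack A (GRing.isLinear.Build _ _ _ _ A AL).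
suff : bounded_near f (nbhs (0 : H)) by [].
apply/linear_boundedP; exists M%:C%C; split; first by rewrite complex_real.
move=> t Mt x; apply: (@le_trans _ _ (M%:C%C * `|x|)).
  by rewrite -!rnormE -rmorphM lecR /=; exact: AM.
by rewrite ler_wpM2r// ltW.
Qed.

Lemma opnorm_has_sup A : bounded_operator A ->
  has_sup [set rnorm (A x) | x in [set x : H | rnorm x <= 1]].
Proof.
move=> /bounded_operatorP [AL [M M0 AM]]; split.
  by exists (rnorm (A 0)), 0 => //=; rewrite rnorm0.
exists M => _ [x /= x1 <-]; apply: (le_trans (AM x)).
by rewrite -[leRHS]mulr1 ler_wpM2l.
Qed.

Lemma rnorm_le_opnorm A x : bounded_operator A -> rnorm (A x) <= opnorm A * rnorm x.
Proof.
move=> Ab; have [AL _] := Ab; have hs := opnorm_has_sup Ab.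
have [->|x0] := eqVneq x 0; first by rewrite linear_op0// !rnorm0 mulr0.
have nx : 0 < rnorm x by rewrite lt_neqAle eq_sym rnorm_eq0 x0 rnorm_ge0.
have : rnorm (A ((rnorm x)^-1%:C%C *: x)) <= opnorm A.
  apply: ub_le_sup; first by case: hs.
  exists ((rnorm x)^-1%:C%C *: x) => //=.
  by rewrite rnormZ rnormC ger0_norm ?invr_ge0 ?rnorm_ge0// mulVf// gt_eqF.
rewrite linear_opZ// rnormZ rnormC ger0_norm ?invr_ge0 ?rnorm_ge0//.
by rewrite mulrC ler_pdivrMr.
Qed.

Lemma opnorm_le A (c : R) : linear A -> 0 <= c ->
  (forall x, rnorm (A x) <= c * rnorm x) -> opnorm A <= c.
Proof.
move=> AL c0 Ac; apply: ge_sup.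
  by exists (rnorm (A 0)), 0 => //=; rewrite rnorm0.
move=> _ [x /= x1 <-]; apply: (le_trans (Ac x)).
by rewrite -[leRHS]mulr1 ler_wpM2l.
Qed.

Lemma is_opinv_unique A B B' : is_opinv A B -> is_opinv A B' -> B = B'.
Proof.
move=> [_ AB BA] [_ AB' BA']; apply/funext => x.
have -> : x = A (B' x) by have := congr1 (@^~ x) AB'.
have := congr1 (@^~ (B' x)) BA; rewrite /= => ->.
by have := congr1 (@^~ x) AB' => /= ->.
Qed.

Lemma opinvE A B : is_opinv A B -> opinv A = B.
Proof.
move=> AB; apply: xget_unique => // B'; move=> AB'; exact: is_opinv_unique AB' AB.
Qed.

Lemma op_invertibleP A : op_invertible A -> is_opinv A (opinv A).
Proof. by move=> [B AB]; rewrite (opinvE AB). Qed.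

Lemma is_opinvP A B : bounded_operator B -> cancel A B -> cancel B A -> is_opinv A B.
Proof. by move=> Bb AK BK; split => //; apply/funext => x /=; rewrite ?AK ?BK. Qed.

Lemma bounded_comp A B : bounded_operator A -> bounded_operator B ->
  bounded_operator (A \o B).
Proof.
move=> /bounded_operatorP [AL [M M0 AM]] /bounded_operatorP [BL [N N0 BN]].
apply/bounded_operatorP; split; first by move=> a x y /=; rewrite BL AL.
exists (M * N); first exact: mulr_ge0.
by move=> x /=; rewrite (le_trans (AM _))// -mulrA ler_wpM2l.
Qed.

Lemma bounded_scale (c : C) A : bounded_operator A ->
  bounded_operator (fun x => c *: A x).
Proof.
move=> /bounded_operatorP [AL [M M0 AM]]; apply/bounded_operatorP; split.
  by move=> a x y; rewrite AL scalerDr !scalerA mulrC.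
exists (rnorm c * M); first by rewrite mulr_ge0 ?rnorm_ge0.
by move=> x; rewrite rnormZ -mulrA ler_wpM2l ?rnorm_ge0.
Qed.

Lemma is_opinv_comp A A' B B' : is_opinv A B -> is_opinv A' B' ->
  is_opinv (A \o A') (B' \o B).
Proof.
move=> [Bb AB BA] [Bb' AB' BA']; split; first exact: bounded_comp.
  by rewrite -compA (compA A') AB' compA.
by rewrite -compA (compA B) BA compA.
Qed.

Lemma is_opinv_scale (c : C) A B : linear A -> c != 0 -> is_opinv A B ->
  is_opinv (fun x => c *: A x) (fun x => c^-1 *: B x).
Proof.
move=> AL c0 [Bb AB BA]; have [BL _] := Bb; apply: is_opinvP.
- exact: bounded_scale.
- move=> x; rewrite (linear_opZ _ _ BL) scalerA mulVf// scale1r.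
  by have := congr1 (@^~ x) BA.
- move=> x; rewrite (linear_opZ _ _ AL) scalerA divff// scale1r.
  by have := congr1 (@^~ x) AB.
Qed.

(** The partial sums of the Neumann series are Cauchy; this is where the
    completeness of [H] enters. *)
Lemma neumann (T : H -> H) (c : R) : linear T -> 0 <= c -> c < 1 ->
  (forall x, rnorm (T x) <= c * rnorm x) ->
  exists2 W, is_opinv (fun x => x - T x) W &
    forall N x, rnorm (W x - \sum_(k < N) iter k T x) <= c ^+ N / (1 - c) * rnorm x.
Proof.
move=> TL c0 c1 Tc; have c1' : 0 < 1 - c by rewrite subr_gt0.
pose s x N := \sum_(k < N) iter k T x.
have s_diff x N k : rnorm (s x (N + k)%N - s x N) <= c ^+ N / (1 - c) * rnorm x.
  have : rnorm (s x (N + k)%N - s x N) <= (c ^+ N - c ^+ (N + k)) / (1 - c) * rnorm x.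
    elim: k => [|k IH]; first by rewrite addn0 !subrr rnorm0 !mul0r.
    rewrite addnS {1}/s big_ord_recr /= -/(s x _) addrAC.
    apply: (le_trans (rnorm_triangle _ _)); apply: (le_trans (lerD IH (rnorm_iter _ _ c0 Tc))).
    rewrite -mulrDl ler_wpM2r ?rnorm_ge0// exprS.
    by rewrite le_eqVlt; apply/orP; left; apply/eqP; field; rewrite gt_eqF.
  move/le_trans; apply; apply: ler_wpM2r; first exact: rnorm_ge0.
  by rewrite ler_wpM2r ?invr_ge0 ?(ltW c1')// gerBl exprn_ge0.
have small (x : H) (e : R) : 0 < e -> exists N, c ^+ N / (1 - c) * rnorm x < e.
  move=> e0; have : (fun n => c ^+ n * ((1 - c)^-1 * rnorm x)) @ \oo -->
      (0 * ((1 - c)^-1 * rnorm x)).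
    by apply: cvgMl; apply: cvg_expr; rewrite ger0_norm.
  rewrite mul0r => /cvgrPdist_lt /(_ e e0) [N _ hN]; exists N.
  have := hN N (leqnn N); rewrite sub0r normrN mulrA => h.
  exact: le_lt_trans (ler_norm _) h.
have s_cvg x : cvg (s x @ \oo).
  apply/cauchy_cvgP/cauchy_exP => e.
  rewrite ltcE => /andP[/eqP e_im e0].
  have {e_im}ee : e = (Re e)%:C%C by case: e e_im {e0} => a b /= ->.
  have [N hN] := small x (Re e) e0.
  exists (s x N), N => //= m /= Nm.
  rewrite -ball_normE /= ee -rnormE ltcR rnormB -(subnKC Nm).
  exact: le_lt_trans (s_diff _ _ _) hN.
pose W x := lim (s x @ \oo).
have Wle N x : rnorm (W x - s x N) <= c ^+ N / (1 - c) * rnorm x.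
  apply/ler_addgt0Pl => e e0.
  have /cvgrPdist_lt /(_ (e%:C)%C) : s x @ \oo --> W x by exact: s_cvg.
  rewrite ltcR => /(_ e0) [M _ hM]; have := hM (maxn M N); rewrite /= leq_maxl => /(_ isT).
  rewrite -rnormE ltcR => h1.
  have h2 := s_diff x N (maxn M N - N)%N; rewrite subnKC ?leq_maxr// in h2.
  rewrite -(subrK (s x (maxn M N)) (W x)) -addrA.
  by apply: (le_trans (rnorm_triangle _ _)); rewrite lerD// ltW.
have WT x : W x - T (W x) = x.
  apply/eqP; rewrite -subr_eq0 -rnorm_eq0 eq_le rnorm_ge0 andbT.
  apply/ler_addgt0Pl => e e0; rewrite addr0.
  have [N hN] := small x (e / 3) (divr_gt0 e0 (ltr0n R 3)).
  have sT : s x N.+1 = x + T (s x N).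
    rewrite /s big_ord_recl /=; congr (_ + _).
    by rewrite (big_morph T (linear_opD TL) (linear_op0 TL)).
  have -> : W x - T (W x) - x = (W x - s x N.+1) - T (W x - s x N).
    by rewrite sT (linear_opB TL) opprB opprD !addrA subrK addrAC.
  apply: (le_trans (rnorm_triangle _ _)); rewrite rnormN.
  have h1 := Wle N.+1 x; have h2 := Wle N x; have h3 := Tc (W x - s x N).
  have cN : c ^+ N.+1 / (1 - c) * rnorm x <= c ^+ N / (1 - c) * rnorm x.
    rewrite ler_wpM2r ?rnorm_ge0// ler_wpM2r ?invr_ge0 ?(ltW c1')//.
    by rewrite exprS ler_piMl ?exprn_ge0// ltW.
  have h4 : c * rnorm (W x - s x N) <= rnorm (W x - s x N).
    by rewrite ler_piMl ?rnorm_ge0// ltW.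
  lra.
have inj x y : x - T x = y - T y -> x = y.
  move=> xy; apply/eqP; rewrite -subr_eq0 -rnorm_eq0 eq_le rnorm_ge0 andbT.
  have : x - y = T (x - y).
    have xE : x = y - T y + T x by rewrite -xy subrK.
    by rewrite (linear_opB TL) {1}xE addrAC [y - T y]addrC addrK addrC.
  move=> xyT; have := Tc (x - y); rewrite -xyT; have := rnorm_ge0 (x - y); nra.
have WL : linear W.
  by move=> a x y; apply: inj; rewrite WT TL opprD addrACA -scalerBr !WT.
exists W; last exact: Wle.
apply: is_opinvP => //; last by move=> x; apply: inj; rewrite WT.
apply/bounded_operatorP; split => //; exists (1 - c)^-1; first by rewrite invr_ge0 ltW.
by move=> x; have := Wle 0%N x; rewrite /s big_ord0 subr0 expr0 mul1r.
Qed.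

Lemma op_poly_widen (p : {poly C}) A N x : (size p <= N)%N ->
  op_poly p A x = \sum_(i < N) p`_i *: iter i A x.
Proof.
move=> pN; rewrite /op_poly (big_ord_widen _ (fun i => p`_i *: iter i A x) pN).
rewrite big_mkcond; apply: eq_bigr => i _; case: ltnP => // pi.
by rewrite nth_default// scale0r.
Qed.

Lemma op_polyD (p q : {poly C}) A x : op_poly (p + q) A x = op_poly p A x + op_poly q A x.
Proof.
pose N := maxn (size p) (size q).
rewrite !(@op_poly_widen _ _ N) ?leq_maxl ?leq_maxr ?size_polyD//.
by rewrite -big_split; apply: eq_bigr => i _; rewrite coefD scalerDl.
Qed.

Lemma op_polyZ (c : C) (p : {poly C}) A x : op_poly (c *: p) A x = c *: op_poly p A x.
Proof.
rewrite !(@op_poly_widen _ _ (size p)) ?size_scale_leq// scaler_sumr.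
by apply: eq_bigr => i _; rewrite coefZ scalerA.
Qed.

Lemma op_polyC (c : C) A x : op_poly c%:P A x = c *: x.
Proof. by rewrite (@op_poly_widen _ _ 1) ?size_polyC_leq1// big_ord1 coefC. Qed.

Lemma op_polyMX (p : {poly C}) A x : op_poly (p * 'X) A x = op_poly p A (A x).
Proof.
rewrite (@op_poly_widen _ _ (size p).+1); last first.
  by rewrite (leq_trans (size_polyMleq _ _))// size_polyX addn2.
rewrite big_ord_recl coefMX eqxx scale0r add0r /op_poly.
by apply: eq_bigr => i _; rewrite coefMX /= -iterSr.
Qed.

Lemma op_poly_linear (p : {poly C}) A : linear A -> linear (op_poly p A).
Proof.
move=> AL a x y; rewrite /op_poly scaler_sumr -big_split; apply: eq_bigr => i _ /=.
by rewrite (is_linear_iter i AL) scalerDr !scalerA mulrC.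
Qed.

Lemma op_polyX A x : op_poly 'X A x = A x.
Proof. by rewrite -[X in op_poly X](mul1r 'X) op_polyMX -[1]/(1%:P) op_polyC scale1r. Qed.

Lemma op_polyM (p q : {poly C}) A x : linear A ->
  op_poly (p * q) A x = op_poly p A (op_poly q A x).
Proof.
move=> AL; have pL := op_poly_linear p AL.
elim/poly_ind: q x => [|q c IH] x.
  have p00 : op_poly 0 A x = 0 by rewrite -[0 : {poly C}]/(0%:P) op_polyC scale0r.
  by rewrite mulr0 p00 linear_op0.
rewrite mulrDr mulrA !op_polyD !op_polyMX IH op_polyC (linear_opD pL) (linear_opZ _ _ pL).
by rewrite mulrC mul_polyC op_polyZ.
Qed.

Lemma bounded_op_poly (p : {poly C}) A : bounded_operator A -> bounded_operator (op_poly p A).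
Proof.
move=> /bounded_operatorP [AL [M M0 AM]]; apply/bounded_operatorP; split.
  exact: op_poly_linear.
exists (\sum_(i < size p) rnorm p`_i * M ^+ i).
  by apply: sumr_ge0 => i _; rewrite mulr_ge0 ?rnorm_ge0// exprn_ge0.
move=> x; rewrite /op_poly mulr_suml; apply: (le_trans (rnorm_sum _ _ _)).
apply: ler_sum => i _; rewrite rnormZ -mulrA; apply: ler_wpM2l; first exact: rnorm_ge0.
exact: rnorm_iter.
Qed.

End Operators.

(** * Rational functions of an annulus operator *)

Section Calculus.
Variables (R : realType) (H : hilbertType R) (r : R).
Hypothesis r1 : 1 < r.
Local Notation C := R[i].
Let r0 : 0 < r. Proof. exact: lt_trans r1. Qed.

Variables A B : H -> H.
Hypotheses (Ab : bounded_operator A) (Bb : bounded_operator B).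
Hypotheses (AK : cancel A B) (BK : cancel B A).
Hypothesis Ar : forall x, rnorm (A x) <= r * rnorm x.
Hypothesis Br : forall x, rnorm (B x) <= r * rnorm x.
Let AL : linear A := Ab.1.
Let BL : linear B := Bb.1.

Lemma annulus_neq0 (z : C) : annulus r z -> z != 0.
Proof.
move=> /andP[rz _]; rewrite -rnorm_eq0 gt_eqF// (lt_le_trans _ rz)//.
by rewrite invr_gt0.
Qed.

Lemma iter_comm (T : H -> H) k x : (forall x, T (B x) = B (T x)) ->
  T (iter k B x) = iter k B (T x).
Proof. by move=> TB; elim: k => //= k IH; rewrite TB IH. Qed.

Lemma op_poly_commB (p : {poly C}) x : op_poly p A (B x) = B (op_poly p A x).
Proof.
rewrite /op_poly (big_morph B (linear_opD BL) (linear_op0 BL)); apply: eq_bigr => i _.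
rewrite (linear_opZ _ _ BL); congr (_ *: _); elim: (nat_of_ord i) => //= k ->.
by rewrite BK AK.
Qed.

(** The values of [l] off [0] determine the operator [L], and the
    coefficients stay hidden, so that sums and products are immediate. *)
Definition laurent (l : C -> C) (L : H -> H) := exists D (p : {poly C}),
  (forall z, z != 0 -> l z = z ^- D * p.[z]) /\
  (forall x, L x = iter D B (op_poly p A x)).

Lemma laurent_poly p : laurent (horner p) (op_poly p A).
Proof. by exists 0%N, p; split => // z _; rewrite expr0 invr1 mul1r. Qed.

Lemma laurent_mul l L m M : laurent l L -> laurent m M ->
  laurent (fun z => l z * m z) (L \o M).
Proof.
move=> [D [p [lE LE]]] [E [q [mE ME]]]; exists (D + E)%N, (p * q); split.
  by move=> z z0; rewrite lE// mE// hornerM exprD invfM mulrACA.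
move=> x; rewrite /= LE ME iterD; congr (iter D B _).
by rewrite op_polyM// (iter_comm _ _ (op_poly_commB p)).
Qed.

Lemma laurent_const (c : C) : laurent (fun=> c) (fun x => c *: x).
Proof.
exists 0%N, c%:P; split=> [z _|x]; last by rewrite op_polyC.
by rewrite hornerC expr0 invr1 mul1r.
Qed.

Lemma laurent_inv : laurent (fun z => z^-1) B.
Proof.
exists 1%N, 1; split=> [z _|x]; first by rewrite hornerE expr1 mulr1.
by rewrite -[1]/(1%:P) op_polyC scale1r.
Qed.

Lemma laurent_id : laurent id A.
Proof.
exists 0%N, 'X; split=> [z _|x]; last by rewrite op_polyX.
by rewrite hornerX expr0 invr1 mul1r.
Qed.

Lemma laurent_add l L m M : laurent l L -> laurent m M ->
  laurent (fun z => l z + m z) (fun x => L x + M x).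
Proof.
move=> [D [p [lE LE]]] [E [q [mE ME]]].
have BA k x : iter k B (iter k A x) = x.
  by elim: k x => // k IH x; rewrite iterSr iterS AK IH.
have opXn k (s : {poly C}) x : op_poly ('X^k * s) A x = iter k A (op_poly s A x).
  elim: k => [|k IH]; first by rewrite expr0 mul1r.
  by rewrite exprS -mulrA op_polyM// op_polyX IH.
have itD k : {morph iter k B : x y / x + y} := linear_opD (is_linear_iter k BL).
exists (D + E)%N, ('X^E * p + 'X^D * q); split=> [z z0|x].
  rewrite lE// mE// !hornerE exprD; field.
  by rewrite !expf_neq0.
rewrite op_polyD itD !opXn LE ME; congr (_ + _).
  by rewrite iterD BA.
by rewrite addnC iterD BA.
Qed.

Lemma laurent_sum N (l : nat -> C -> C) (L : nat -> H -> H) :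
  (forall k, laurent (l k) (L k)) ->
  laurent (fun z => \sum_(k < N) l k z) (fun x => \sum_(k < N) L k x).
Proof.
move=> lL; elim: N => [|N IH].
  have := laurent_const 0; congr laurent; apply/funext => z.
    by rewrite big_ord0.
  by rewrite scale0r big_ord0.
have := laurent_add IH (lL N); congr laurent; apply/funext => z;
  by rewrite big_ord_recr.
Qed.

Lemma laurent_exp l L k : laurent l L -> laurent (fun z => l z ^+ k) (iter k L).
Proof.
move=> lL; elim: k => [|k IH].
  have := laurent_const 1; congr laurent; apply/funext => x; by rewrite ?scale1r ?expr0.
have := laurent_mul lL IH; congr laurent; apply/funext => z.
by rewrite exprS.
Qed.

(** Joint approximation on the annulus and at [A]. It is stable under products and
    passes to inverses of linear factors with roots off the annulus, hence applies
    to every rational function, without partial fractions. *)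
Definition approx (g : C -> C) (T : H -> H) := forall d : R, 0 < d ->
  exists l L, [/\ laurent l L, forall z, annulus r z -> rnorm (g z - l z) <= d &
    forall x, rnorm (T x - L x) <= d * rnorm x].

Lemma laurent_approx l L : laurent l L -> approx l L.
Proof.
move=> lL d d0; exists l, L; split => // [z _|x]; rewrite subrr rnorm0 ?(ltW d0)//.
by rewrite mulr_ge0 ?rnorm_ge0// ltW.
Qed.

Lemma approx_eq g h T : (forall z, annulus r z -> g z = h z) -> approx g T -> approx h T.
Proof.
move=> gh gT d d0; have [l [L [lL gl TL]]] := gT d d0; exists l, L; split => //.
by move=> z Xz; rewrite -gh//; exact: gl.
Qed.

Lemma laurent_linear l L : laurent l L -> linear L.
Proof.
move=> [D [p [_ LE]]] a x y.
by rewrite !LE (op_poly_linear _ AL) (is_linear_iter _ BL).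
Qed.

Lemma laurent_bounded l L : laurent l L -> exists2 M : R, 0 <= M &
  (forall z, annulus r z -> rnorm (l z) <= M) /\ (forall x, rnorm (L x) <= M * rnorm x).
Proof.
move=> [D [p [lE LE]]].
pose m := \sum_(i < size p) rnorm p`_i * r ^+ i.
have m0 : 0 <= m.
  by apply: sumr_ge0 => i _; rewrite mulr_ge0 ?rnorm_ge0// exprn_ge0 ?ltW.
have rD : 0 <= r ^+ D by rewrite exprn_ge0// ltW.
exists (r ^+ D * m); first exact: mulr_ge0.
split=> [z Xz|x].
  have z0 := annulus_neq0 Xz; have /andP[zl zu] := Xz.
  rewrite lE// rnormM; apply: ler_pM; rewrite ?rnorm_ge0//.
    rewrite rnormV rnormX -exprVn; apply: lerXn2r; rewrite ?nnegrE ?invr_ge0 ?rnorm_ge0 ?(ltW r0)//.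
    by rewrite -[leRHS]invrK lef_pV2 ?posrE ?invr_gt0// (lt_le_trans _ zl)// invr_gt0.
  rewrite horner_coef; apply: (le_trans (rnorm_sum _ _ _)); apply: ler_sum => i _.
  rewrite rnormM rnormX; apply: ler_wpM2l; first exact: rnorm_ge0.
  by apply: lerXn2r; rewrite ?nnegrE ?rnorm_ge0// ltW.
rewrite LE; apply: (le_trans (rnorm_iter _ _ (ltW r0) Br)).
rewrite -mulrA; apply: ler_wpM2l => //.
rewrite /op_poly /m mulr_suml; apply: (le_trans (rnorm_sum _ _ _)).
apply: ler_sum => i _; rewrite rnormZ -mulrA; apply: ler_wpM2l; first exact: rnorm_ge0.
by apply: rnorm_iter => //; exact: ltW.
Qed.

Lemma approx_bounded g T : approx g T -> exists2 M : R, 0 <= M &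
  (forall z, annulus r z -> rnorm (g z) <= M) /\ (forall x, rnorm (T x) <= M * rnorm x).
Proof.
move=> /(_ 1 ltr01) [l [L [/laurent_bounded[M M0 [lM LM]] gl TL]]].
exists (1 + M); first by rewrite addr_ge0.
split=> [z Xz|x].
  rewrite -[g z](subrK (l z)); apply: (le_trans (rnorm_triangle _ _)).
  by rewrite lerD ?gl ?lM.
rewrite -[T x](subrK (L x)); apply: (le_trans (rnorm_triangle _ _)).
by rewrite mulrDl lerD ?TL ?LM.
Qed.

Lemma approx_mul g T h S : linear T -> approx g T -> approx h S ->
  approx (fun z => g z * h z) (T \o S).
Proof.
move=> TL gT hS d d0.
have [M M0 [gM TM]] := approx_bounded gT; have [N N0 [hN SN]] := approx_bounded hS.
pose e := Num.min 1 (d / (M + N + 1)).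
have MN : 0 < M + N + 1 by rewrite ltr_wpDl// addr_ge0.
have e0 : 0 < e by rewrite lt_min ltr01 divr_gt0.
have e1 : e <= 1 by rewrite ge_min lexx.
have ed : e * (M + N + 1) <= d by rewrite -ler_pdivlMr// ge_min lexx orbT.
have eMN : M * e + e * (N + e) <= d by apply: le_trans ed; nra.
have [l [L [lL gl TLe]]] := gT e e0; have [m [K [mK hm SK]]] := hS e e0.
exists (fun z => l z * m z), (L \o K); split; first exact: laurent_mul.
  move=> z Xz; apply: le_trans eMN.
  have -> : g z * h z - l z * m z = g z * (h z - m z) + (g z - l z) * m z by ring.
  apply: (le_trans (rnorm_triangle _ _)); rewrite !rnormM.
  apply: lerD; apply: ler_pM; rewrite ?rnorm_ge0 ?gM ?hm ?gl//.
  rewrite -[m z](subKr (h z)); apply: (le_trans (rnorm_triangle _ _)).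
  by rewrite rnormN lerD ?hN ?hm.
move=> x /=.
have -> : T (S x) - L (K x) = T (S x - K x) + (T (K x) - L (K x)).
  by rewrite (linear_opB TL) addrA subrK.
apply: (le_trans (rnorm_triangle _ _)).
apply: (@le_trans _ _ ((M * e + e * (N + e)) * rnorm x)); last first.
  by rewrite ler_wpM2r ?rnorm_ge0.
rewrite mulrDl -!mulrA; apply: lerD.
  apply: (le_trans (TM _)); apply: ler_wpM2l => //; exact: SK.
apply: (le_trans (TLe _)); apply: ler_wpM2l; first exact: ltW.
rewrite -[K x](subKr (S x)); apply: (le_trans (rnorm_triangle _ _)).
by rewrite rnormN mulrDl lerD ?SN ?SK.
Qed.

Lemma geometric_tail_le (t : C) (c : R) N : rnorm t <= c -> c < 1 ->
  rnorm ((1 - t)^-1 - \sum_(k < N) t ^+ k) <= c ^+ N / (1 - c).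
Proof.
move=> tc c1; have t1 : 0 < 1 - rnorm t by rewrite subr_gt0 (le_lt_trans tc).
have nt : 1 - rnorm t <= rnorm (1 - t).
  have := rnorm_triangle (1 - t) t; rewrite subrK rnorm1; lra.
have t1' : 1 - t != 0 by rewrite -rnorm_eq0 gt_eqF// (lt_le_trans t1).
have -> : (1 - t)^-1 - \sum_(k < N) t ^+ k = t ^+ N / (1 - t).
  have e : (1 - t) * \sum_(k < N) t ^+ k = 1 - t ^+ N.
    by rewrite -[1 - t]opprB mulNr -subrX1 opprB.
  apply: (mulfI t1'); rewrite mulrBr divff// e subKr.
  by rewrite mulrCA divff// mulr1.
rewrite rnormM rnormX rnormV; apply: ler_pM; rewrite ?exprn_ge0 ?invr_ge0 ?rnorm_ge0//.
  by apply: lerXn2r; rewrite ?nnegrE ?rnorm_ge0// (le_trans _ tc)// rnorm_ge0.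
rewrite lef_pV2 ?posrE ?subr_gt0//; last exact: lt_le_trans nt.
by apply: le_trans nt; rewrite lerD2l lerN2.
Qed.

Lemma geometric_small (c b e : R) : 0 <= c -> c < 1 -> 0 < e ->
  exists N, c ^+ N * b <= e.
Proof.
move=> c0 c1 e0; have : (fun n => c ^+ n * b) @ \oo --> (0 * b).
  by apply: cvgMl; apply: cvg_expr; rewrite ger0_norm.
rewrite mul0r => /cvgrPdist_lt /(_ e e0) [N _ hN]; exists N.
have := hN N (leqnn N); rewrite sub0r normrN => h.
exact: le_trans (ler_norm _) (ltW h).
Qed.

(** The partial sums of the geometric series of [T] are Laurent polynomials, and
    their tails obey the same bound on the annulus and at [A]. *)
Lemma approx_neumann t T (c : R) : laurent t T -> 0 <= c -> c < 1 ->
  (forall z, annulus r z -> rnorm (t z) <= c) ->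
  (forall x, rnorm (T x) <= c * rnorm x) ->
  exists2 W, is_opinv (fun x => x - T x) W & approx (fun z => (1 - t z)^-1) W.
Proof.
move=> tT c0 c1 tc Tc; have TL := laurent_linear tT.
have [W WT Wle] := neumann TL c0 c1 Tc; exists W => // d d0.
have [N hN] := geometric_small (1 - c)^-1 c0 c1 d0.
exists (fun z => \sum_(k < N) t z ^+ k), (fun x => \sum_(k < N) iter k T x); split.
- exact: (laurent_sum N (fun k => laurent_exp k tT)).
- by move=> z /tc tz; apply: le_trans hN; exact: geometric_tail_le.
- by move=> x; apply: (le_trans (Wle N x)); rewrite ler_wpM2r ?rnorm_ge0.
Qed.

(** The series is in powers of [A] for a pole beyond the outer circle, and in powers of
    [B = A^-1] for a pole inside the inner circle. *)
Lemma approx_inv_linear (a : C) : ~ annulus r a -> exists2 W,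
  is_opinv (fun x => A x - a *: x) W & approx (fun z => (z - a)^-1) W.
Proof.
move=> Xa.
have [ra|ar] := ltP r (rnorm a).
  have a0 : a != 0 by rewrite -rnorm_eq0 gt_eqF// (lt_trans r0).
  have na : 0 < rnorm a by exact: lt_trans ra.
  have c1 : r / rnorm a < 1 by rewrite ltr_pdivrMr// mul1r.
  have lT := laurent_mul (laurent_const a^-1) laurent_id.
  have [||x|W [Wb W1 W2] Wa] := approx_neumann lT _ c1.
  - by rewrite divr_ge0// ltW.
  - move=> z /andP[_ zr]; rewrite rnormM rnormV mulrC.
    by rewrite ler_wpM2r ?invr_ge0 ?rnorm_ge0.
  - by rewrite /= rnormZ rnormV [r / _]mulrC -mulrA ler_wpM2l ?invr_ge0 ?rnorm_ge0.
  exists (fun x => - a^-1 *: W x).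
    have -> : (fun x => A x - a *: x) = (fun x => - a *: (x - a^-1 *: A x)).
      apply/funext => x; rewrite scalerBr !scalerA mulNr divff// scaleN1r opprK.
      by rewrite scaleNr addrC.
    rewrite -invrN; apply: is_opinv_scale; rewrite ?oppr_eq0//.
    move=> b x y; rewrite AL scalerDr !scalerBr !scalerA opprD addrACA.
    by rewrite [_ * b]mulrC.
  have := approx_mul (laurent_linear (laurent_const (- a^-1)))
    (laurent_approx (laurent_const (- a^-1))) Wa.
  apply: approx_eq => z Xz; rewrite -invrN -invfM; congr (_^-1).
  by rewrite mulrBr mulr1 mulrA mulNr divff// mulN1r opprK addrC.
have ar' : rnorm a < r^-1.
  by rewrite ltNge; apply/negP => ra; apply: Xa; rewrite /annulus /= ra.
have c1 : rnorm a * r < 1 by rewrite -(mulVf (lt0r_neq0 r0)) ltr_pM2r.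
have lT := laurent_mul (laurent_const a) laurent_inv.
have [||x|W WT Wa] := approx_neumann lT _ c1.
- by rewrite mulr_ge0 ?rnorm_ge0// ltW.
- move=> z Xz; have /andP[rz _] := Xz; rewrite rnormM rnormV ler_wpM2l ?rnorm_ge0//.
  by rewrite -[leRHS]invrK lef_pV2 ?posrE ?invr_gt0// (lt_le_trans _ rz)// invr_gt0.
- by rewrite /= rnormZ -mulrA ler_wpM2l ?rnorm_ge0.
exists (B \o W).
  have -> : (fun x => A x - a *: x) = (fun x => x - a *: B x) \o A.
    by apply/funext => x /=; rewrite AK.
  by apply: is_opinv_comp => //; exact: is_opinvP.
have := approx_mul BL (laurent_approx laurent_inv) Wa.
apply: approx_eq => z Xz; have z0 := annulus_neq0 Xz.
by rewrite -invfM mulrBr mulr1 mulrCA divff// mulr1.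
Qed.

Lemma approx_inv_poly (q : {poly C}) : q != 0 ->
  (forall z, annulus r z -> q.[z] != 0) -> exists2 W,
  is_opinv (op_poly q A) W & approx (fun z => q.[z]^-1) W.
Proof.
move=> q0 qX; have [s qE] := closed_field_poly_normal q.
have c0 : lead_coef q != 0 by rewrite lead_coef_eq0.
have sX a : a \in s -> ~ annulus r a.
  move=> sa Xa; have := qX a Xa; rewrite {1}qE hornerZ.
  have /rootP -> : root (\prod_(z <- s) ('X - z%:P)) a by rewrite root_prod_XsubC.
  by rewrite mulr0 eqxx.
have [W WT Wa] : exists2 W, is_opinv (op_poly (\prod_(z <- s) ('X - z%:P)) A) W &
    approx (fun z => (\prod_(z <- s) ('X - z%:P)).[z]^-1) W.
  elim: s sX {qE} => [|a s IH] sX.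
    exists (fun x => 1 *: x).
      apply: is_opinvP => [|x|x]; rewrite ?big_nil -?[1 : {poly C}]/(1%:P) ?op_polyC ?scale1r//.
      apply/bounded_operatorP; split; first by move=> b x y; rewrite !scale1r.
      by exists 1 => // x; rewrite scale1r mul1r.
    have := laurent_approx (laurent_const 1); apply: approx_eq => z _.
    by rewrite big_nil hornerE invr1.
  have [|W WT Wa] := IH; first by move=> b sb; apply: sX; rewrite inE sb orbT.
  have [|V VT Va] := @approx_inv_linear a; first by apply: sX; rewrite inE eqxx.
  exists (W \o V).
    have -> : op_poly (\prod_(z <- a :: s) ('X - z%:P)) A =
        (fun x => A x - a *: x) \o op_poly (\prod_(z <- s) ('X - z%:P)) A.
      apply/funext => x /=; rewrite big_cons op_polyM// op_polyD op_polyX.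
      by rewrite -polyCN op_polyC scaleNr.
    exact: is_opinv_comp.
  have WL : linear W by case: WT => -[].
  have := approx_mul WL Wa Va; apply: approx_eq => z _.
  by rewrite big_cons hornerM invfM mulrC hornerXsubC.
exists (fun x => (lead_coef q)^-1 *: W x).
  have -> : op_poly q A = fun x => lead_coef q *: op_poly (\prod_(z <- s) ('X - z%:P)) A x.
    by apply/funext => x; rewrite -op_polyZ -qE.
  apply: is_opinv_scale => //; exact: op_poly_linear.
have := approx_mul (laurent_linear (laurent_const (lead_coef q)^-1))
  (laurent_approx (laurent_const (lead_coef q)^-1)) Wa.
by apply: approx_eq => z _; rewrite [in RHS]qE hornerZ invfM.
Qed.

Lemma approx_ratfun (f : ratfun R) : rat_bounded (annulus r) f ->
  approx (rat_eval f) (rat_op f A).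
Proof.
move=> [q0 qX _]; have [W WT Wa] := approx_inv_poly q0 qX.
rewrite /rat_op (opinvE WT).
exact: (approx_mul (op_poly_linear f.1 AL) (laurent_approx (laurent_poly f.1)) Wa).
Qed.

Lemma spectrum_annulus : spectrum A `<=` annulus r.
Proof.
move=> z Az; apply: contrapT => Xz; apply: Az.
by have [W WT _] := approx_inv_linear Xz; exists W.
Qed.

Lemma rat_op_linear (f : ratfun R) : rat_bounded (annulus r) f -> linear (rat_op f A).
Proof.
move=> [q0 qX _]; have [W WT _] := approx_inv_poly q0 qX.
have WL : linear W by case: WT => -[].
by move=> a x y; rewrite /rat_op (opinvE WT) /= WL (op_poly_linear _ AL).
Qed.

(** All [N] from some [D] on are allowed, so that finitely many Laurent polynomials can
    be expanded to the same order. *)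
Lemma laurent_zsum l L : laurent l L -> exists D, forall N, (D <= N)%N ->
  exists a : int -> C, [/\ forall k, (N < `|k|)%N -> a k = 0,
    forall z, z != 0 -> l z = zsum N (fun k => z ^ k * a k) &
    forall x, L x = zsum N (fun k => a k *: opz A B k x)].
Proof.
clear r1 r0 Ar Br.
move=> [D [p [lE LE]]]; exists (D + size p)%N => N DN.
pose P := 'X^(N - D) * p.
have DN' : (D <= N)%N by rewrite (leq_trans _ DN)// leq_addr.
have sP : (size P <= N.*2.+1)%N.
  apply: (leq_trans (size_polyMleq _ _)); rewrite size_polyXn.
  by move: DN DN'; clear; lia.
exists (fun k => if (N < `|k|)%N then 0 else P`_(absz (k + N%:Z)%R)); split.
- by move=> k ->.
- move=> z z0; rewrite lE//.
  have -> : z ^- D * p.[z] = z ^- N * P.[z].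
    rewrite /P hornerM hornerXn mulrA; congr (_ * _).
    by rewrite -{1}(subnK DN') exprD invfM mulrAC mulVf ?expf_neq0// mul1r.
  rewrite (horner_coef_wide _ sP) mulr_sumr; apply: eq_bigr => i _.
  rewrite ifF; last by have := ltn_ord i; lia.
  rewrite subrK absz_nat mulrCA mulrC; congr (_ * _).
  by rewrite expfzDr// -exprnP mulrC -exprnN.
- move=> x.
  have BA k y : iter k B (iter k A y) = y.
    by elim: k y => // k IH y; rewrite iterSr iterS AK IH.
  have -> : L x = iter N B (op_poly P A x).
    rewrite LE -{1}(subnK DN') addnC iterD.
    have -> : op_poly P A x = iter (N - D) A (op_poly p A x).
      rewrite /P; elim: (N - D)%N => [|k IH]; first by rewrite expr0 mul1r.
      by rewrite exprS -mulrA op_polyM// op_polyX IH.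
    by rewrite BA.
  have NL := is_linear_iter N BL.
  rewrite (op_poly_widen A x sP) (big_morph _ (linear_opD NL) (linear_op0 NL)).
  apply: eq_bigr => i _; rewrite (linear_opZ _ _ NL) ifF; last by have := ltn_ord i; lia.
  rewrite subrK absz_nat; congr (_ *: _).
  have [Ni|iN] := leqP N i.
    rewrite subzn// /opz -{1}(subnKC Ni) iterD.
    by rewrite BA.
  have -> : i%:Z - N%:Z = - (N - i)%N%:Z by have := iN; lia.
  have -> : opz A B (- (N - i)%N%:Z) x = iter (N - i) B x.
    by case: (N - i)%N.
  by rewrite -{1}(subnK (ltnW iN)) iterD BA.
Qed.

End Calculus.

(** * The upper bound *)

(* Not the supremum of the moduli of the entries. *)
Local Notation mx_norm := Defs.mx_norm.

Section L2Norm.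
Variable R : realType.
Local Notation C := R[i].

Lemma l2norm_triangle n (V : normedZmodType C) (x y : 'cV[V]_n) :
  l2norm (x + y) <= l2norm x + l2norm y.
Proof.
set s := l2norm x; set t := l2norm y.
have s0 : 0 <= s := l2norm_ge0 x; have t0 : 0 <= t := l2norm_ge0 y.
have cs : \sum_i rnorm (x i 0) * rnorm (y i 0) <= s * t.
  have [sz|sn] := eqVneq s 0.
    rewrite sz mul0r big1// => i _; apply/eqP; rewrite mulf_eq0.
    have : \sum_i rnorm (x i 0) ^+ 2 == 0 by rewrite -sqr_l2norm -/s sz expr0n.
    rewrite psumr_eq0 => [|j _]; last exact: sqr_ge0.
    by move=> /allP /(_ i (mem_index_enum i)); rewrite /= expf_eq0 /= => ->.
  have sp : 0 < s by rewrite lt_neqAle eq_sym sn.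
  have [tz|tn] := eqVneq t 0.
    rewrite tz mulr0 big1// => i _; apply/eqP; rewrite mulf_eq0 orbC.
    have : \sum_i rnorm (y i 0) ^+ 2 == 0 by rewrite -sqr_l2norm -/t tz expr0n.
    rewrite psumr_eq0 => [|j _]; last exact: sqr_ge0.
    by move=> /allP /(_ i (mem_index_enum i)); rewrite /= expf_eq0 /= => ->.
  have tp : 0 < t by rewrite lt_neqAle eq_sym tn.
  have st : 0 < 2 * (s * t) by rewrite !mulr_gt0.
  have : 2 * (s * t) * \sum_i rnorm (x i 0) * rnorm (y i 0) <=
      t ^+ 2 * (\sum_i rnorm (x i 0) ^+ 2) + s ^+ 2 * (\sum_i rnorm (y i 0) ^+ 2).
    rewrite !mulr_sumr -big_split; apply: ler_sum => i _ /=.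
    by have := sqr_ge0 (t * rnorm (x i 0) - s * rnorm (y i 0)); nra.
  rewrite -!sqr_l2norm -/s -/t => h; rewrite -(ler_pM2l st); apply: (le_trans h).
  by rewrite le_eqVlt; apply/orP; left; apply/eqP; ring.
rewrite -(@ler_pXn2r _ 2) ?nnegrE ?l2norm_ge0 ?addr_ge0//.
rewrite sqrrD !sqr_l2norm; apply: (@le_trans _ _
  (\sum_i (rnorm (x i 0) + rnorm (y i 0)) ^+ 2)).
  apply: ler_sum => i _; rewrite mxE; apply: lerXn2r; rewrite ?nnegrE ?addr_ge0 ?rnorm_ge0//.
  exact: rnorm_triangle.
under eq_bigr do rewrite sqrrD.
rewrite !big_split /= -!sqr_l2norm -/s -/t; lra.
Qed.

Lemma l2normZ n (c : C) (x : 'cV[C]_n) : l2norm (c *: x) = rnorm c * l2norm x.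
Proof.
apply/eqP; rewrite -(@eqrXn2 _ 2) ?l2norm_ge0 ?mulr_ge0 ?rnorm_ge0 ?l2norm_ge0//.
rewrite exprMn !sqr_l2norm mulr_sumr; apply/eqP; apply: eq_bigr => i _.
by rewrite mxE rnormM exprMn.
Qed.

Lemma rnorm_le_l2norm n (V : normedZmodType C) (x : 'cV[V]_n) i :
  rnorm (x i 0) <= l2norm x.
Proof.
rewrite -(@ler_pXn2r _ 2) ?nnegrE ?l2norm_ge0 ?rnorm_ge0// sqr_l2norm.
by rewrite (bigD1 i)//= lerDl sumr_ge0// => j _; exact: sqr_ge0.
Qed.

Lemma l2norm_le_sum n (V : normedZmodType C) (x : 'cV[V]_n) :
  l2norm x <= \sum_i rnorm (x i 0).
Proof.
have s0 : 0 <= \sum_i rnorm (x i 0) by apply: sumr_ge0 => i _; exact: rnorm_ge0.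
rewrite -(@ler_pXn2r _ 2) ?nnegrE ?l2norm_ge0// sqr_l2norm expr2 mulr_suml.
apply: ler_sum => i _; rewrite expr2 ler_wpM2l ?rnorm_ge0//.
by rewrite (bigD1 i)//= lerDl sumr_ge0// => j _; exact: rnorm_ge0.
Qed.

Lemma l2norm0 n (V : normedZmodType C) : l2norm (0 : 'cV[V]_n) = 0.
Proof.
by rewrite /l2norm big1 ?sqrtr0// => i _; rewrite mxE rnorm0 expr0n.
Qed.

(** Crude, but enough to control a perturbation of the entries. *)
Lemma l2norm_entries_le n (V : normedZmodType C) (b : R) (x y : 'cV[V]_n) : 0 <= b ->
  (forall i, rnorm (y i 0) <= \sum_j b * rnorm (x j 0)) ->
  l2norm y <= n%:R ^+ 2 * b * l2norm x.
Proof.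
move=> b0 yx; apply: (le_trans (l2norm_le_sum y)).
apply: (@le_trans _ _ (\sum_(i < n) \sum_(j < n) b * l2norm x)).
  apply: ler_sum => i _; apply: (le_trans (yx i)); apply: ler_sum => j _.
  by rewrite ler_wpM2l// rnorm_le_l2norm.
rewrite !sumr_const !card_ord -mulrnA -[leLHS]mulr_natl natrM.
by rewrite le_eqVlt; apply/orP; left; apply/eqP; ring.
Qed.

Lemma mx_norm_le_entries n (M : 'M[C]_n) v (b : R) : 0 <= b ->
  (forall i j, rnorm (M i j) <= b) -> l2norm (M *m v) <= n%:R ^+ 2 * b * l2norm v.
Proof.
move=> b0 Mb; apply: l2norm_entries_le => // i; rewrite mxE.
apply: (le_trans (rnorm_sum _ _ _)); apply: ler_sum => j _.
by rewrite rnormM ler_wpM2r ?rnorm_ge0.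
Qed.

Lemma mx_norm_set_bounded n (M : 'M[C]_n) :
  has_sup [set l2norm (M *m x) | x in [set x : 'cV[C]_n | l2norm x <= 1]].
Proof.
split; first by exists (l2norm (M *m 0)), 0 => //=; rewrite l2norm0.
pose b := \sum_i \sum_j rnorm (M i j).
have b0 : 0 <= b by apply: sumr_ge0 => i _; apply: sumr_ge0 => j _; exact: rnorm_ge0.
exists (n%:R ^+ 2 * b) => _ [v /= v1 <-].
have Mb i j : rnorm (M i j) <= b.
  rewrite /b (bigD1 i)//= (bigD1 j)//= -addrA lerDl addr_ge0// sumr_ge0// => k _.
    exact: rnorm_ge0.
  by apply: sumr_ge0 => l _; exact: rnorm_ge0.
apply: (le_trans (mx_norm_le_entries v b0 Mb)).
by rewrite -[leRHS]mulr1 ler_wpM2l// mulr_ge0// exprn_ge0.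
Qed.

Lemma l2norm_mulmx_le n (M : 'M[C]_n) v : l2norm (M *m v) <= mx_norm M * l2norm v.
Proof.
have [nb nu] := mx_norm_set_bounded M.
have [v0|vn] := eqVneq (l2norm v) 0.
  have -> : v = 0.
    apply/colP => i; rewrite mxE; apply/eqP; rewrite -rnorm_eq0 eq_le rnorm_ge0 andbT.
    by rewrite -v0 rnorm_le_l2norm.
  by rewrite mulmx0 !l2norm0 mulr0.
have vp : 0 < l2norm v by rewrite lt_neqAle eq_sym vn l2norm_ge0.
rewrite -ler_pdivrMr//; apply: ub_le_sup => //.
have rv : rnorm ((l2norm v)^-1%:C%C : C) = (l2norm v)^-1.
  by rewrite rnormC ger0_norm// invr_ge0 ltW.
exists ((l2norm v)^-1%:C%C *: v); first by rewrite /= l2normZ rv mulVf.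
by rewrite -scalemxAr l2normZ rv mulrC.
Qed.

Lemma mx_norm_le n (M : 'M[C]_n) (b : R) : 0 <= b ->
  (forall v, l2norm (M *m v) <= b * l2norm v) -> mx_norm M <= b.
Proof.
move=> b0 Mb; apply: ge_sup; first by case: (mx_norm_set_bounded M).
by move=> _ [v /= v1 <-]; rewrite (le_trans (Mb v))// -[leRHS]mulr1 ler_wpM2l.
Qed.

End L2Norm.

Section UpperBound.
Variables (R : realType) (r : R).
Hypothesis r1 : 1 < r.
Local Notation C := R[i].
Let r0 : 0 < r. Proof. exact: lt_trans r1. Qed.

Lemma annulus1 : annulus r (1 : C).
Proof. by rewrite /annulus /= rnorm1 invf_le1// ltW ?andbT// ltW. Qed.

Section Supremum.
Variables (n : nat) (F : 'M[ratfun R]_n).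
Hypothesis Fb : forall i j, rat_bounded (annulus r) (F i j).

Definition ratmx_eval z : 'M[C]_n := \matrix_(i, j) rat_eval (F i j) z.

Lemma ratmx_has_sup : has_sup [set mx_norm (ratmx_eval z) | z in annulus r].
Proof.
split; first by exists (mx_norm (ratmx_eval 1)), 1 => //; exact: annulus1.
have /choice[M hM] : forall ij : 'I_n * 'I_n, exists M : R, forall z, annulus r z ->
    rnorm (rat_eval (F ij.1 ij.2) z) <= M by move=> ij; case: (Fb ij.1 ij.2).
pose b := \sum_ij `|M ij|.
have b0 : 0 <= b by apply: sumr_ge0.
exists (n%:R ^+ 2 * b) => _ [z Xz <-]; apply: mx_norm_le => [|v].
  by rewrite mulr_ge0// exprn_ge0.
apply: mx_norm_le_entries => // i j; rewrite mxE.
apply: (le_trans (hM (i, j) z Xz)); rewrite /b (bigD1 (i, j))//=.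
by rewrite (le_trans (ler_norm _))// lerDl sumr_ge0.
Qed.

Lemma ratmx_supnorm_ge z v : annulus r z ->
  l2norm (ratmx_eval z *m v) <= ratmx_supnorm (annulus r) F * l2norm v.
Proof.
move=> Xz; apply: (le_trans (l2norm_mulmx_le _ v)); apply: ler_wpM2r.
  exact: l2norm_ge0.
by apply: ub_le_sup; [case: ratmx_has_sup | exists z].
Qed.

Lemma ratmx_supnorm_ge0 : 0 <= ratmx_supnorm (annulus r) F.
Proof.
apply: (@le_trans _ _ (mx_norm (ratmx_eval 1))).
  apply: (@le_trans _ _ (l2norm (ratmx_eval 1 *m 0))); first exact: l2norm_ge0.
  apply: ub_le_sup; first by case: (mx_norm_set_bounded (ratmx_eval 1)).
  by exists 0 => //=; rewrite l2norm0.
by apply: ub_le_sup; [case: ratmx_has_sup | exists 1 => //; exact: annulus1].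
Qed.

End Supremum.

Variables (H : hilbertType R) (A B : H -> H).
Hypotheses (Ab : bounded_operator A) (Bb : bounded_operator B).
Hypotheses (AK : cancel A B) (BK : cancel B A).
Hypothesis Ar : forall x, rnorm (A x) <= r * rnorm x.
Hypothesis Br : forall x, rnorm (B x) <= r * rnorm x.

(** Take [y := K^-1 w]. *)
Lemma form_bound n (K : R) (x w : 'cV[H]_n) : 0 < K ->
  (forall y : 'I_n -> H, 2 * rnorm (\sum_i hinner (w i 0) (y i) : C) <=
    K * (l2norm x ^+ 2 + \sum_i rnorm (y i) ^+ 2)) -> l2norm w <= K * l2norm x.
Proof.
move=> K0 hK; have ipS := psd_sesqui (@hinner_psd R H).
have := hK (fun i => (K^-1)%:C%C *: w i 0).
have -> : \sum_i hinner (w i 0) ((K^-1)%:C%C *: w i 0) = (K^-1 * l2norm w ^+ 2)%:C%C.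
  rewrite sqr_l2norm mulr_sumr rmorph_sum; apply: eq_bigr => i _ /=.
  by rewrite (sesquiZr ipS) conjC_real hinnerE -rnormE rmorphM rmorphXn.
have -> : \sum_i rnorm ((K^-1)%:C%C *: w i 0) ^+ 2 = K^-1 ^+ 2 * l2norm w ^+ 2.
  rewrite sqr_l2norm mulr_sumr; apply: eq_bigr => i _.
  by rewrite rnormZ rnormC gtr0_norm ?invr_gt0// exprMn.
have Kw0 : 0 <= K^-1 * l2norm w ^+ 2.
  by apply: mulr_ge0; [rewrite invr_ge0 ltW | exact: sqr_ge0].
rewrite rnormC (ger0_norm Kw0) => h.
have w0 := l2norm_ge0 w.
have Kx0 : 0 <= K * l2norm x by apply: mulr_ge0; [exact: ltW | exact: l2norm_ge0].
rewrite -(@ler_pXn2r _ 2) ?nnegrE// exprMn -(ler_pM2l (_ : 0 < K^-1)) ?invr_gt0//.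
have e1 : K^-1 * (K ^+ 2 * l2norm x ^+ 2) = K * l2norm x ^+ 2 by field; rewrite gt_eqF.
have e2 : K * (l2norm x ^+ 2 + K^-1 ^+ 2 * l2norm w ^+ 2) =
    K * l2norm x ^+ 2 + K^-1 * l2norm w ^+ 2 by field; rewrite gt_eqF.
by move: h; rewrite e1 e2; lra.
Qed.

Lemma upper_constant_ge0 : 0 <= upper_constant r.
Proof. by rewrite /upper_constant le_min !sqrtr_ge0. Qed.

(** Replace the entries of [F] by Laurent polynomials at distance [d], apply
    [laurent_form_le], and let [d] tend to [0]. *)
Lemma complete_bound n (F : 'M[ratfun R]_n) (x : 'cV[H]_n) :
  (forall i j, rat_bounded (annulus r) (F i j)) ->
  l2norm (opmx_apply (ratmx_op F A) x) <=
    (2 + upper_constant r) * ratmx_supnorm (annulus r) F * l2norm x.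
Proof.
move=> Fb; set K := 2 + _; set S := ratmx_supnorm _ _.
have K0 : 0 < K by rewrite ltr_wpDr// upper_constant_ge0.
have S0 : 0 <= S by exact: ratmx_supnorm_ge0.
have x0 := l2norm_ge0 x.
pose m : R := n%:R ^+ 2.
have m0 : 0 <= m by rewrite exprn_ge0.
suff key (d : R) : 0 < d -> l2norm (opmx_apply (ratmx_op F A) x) <=
    (K * (S + m * d + d) + m * d) * l2norm x.
  apply/ler_addgt0Pl => e e0.
  pose c := K * (m + 1) + m.
  have c0 : 0 <= c.
    by apply: addr_ge0 => //; apply: mulr_ge0; [exact: ltW | exact: addr_ge0].
  have cx : 0 < c * l2norm x + 1 by rewrite ltr_wpDl// mulr_ge0.
  have d0 : 0 < e / (c * l2norm x + 1) by rewrite divr_gt0.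
  apply: (le_trans (key _ d0)); set d := e / _ in d0 *.
  have : d * (c * l2norm x) <= e.
    by rewrite /d mulrAC ler_pdivrMr//; apply: ler_wpM2l; [exact: ltW | lra].
  by rewrite /c; lra.
move=> d0.
have /choice[l hl] : forall ij : 'I_n * 'I_n, exists lL : (C -> C) * (H -> H),
    [/\ laurent A B lL.1 lL.2,
      forall z, annulus r z -> rnorm (rat_eval (F ij.1 ij.2) z - lL.1 z) <= d &
      forall x, rnorm (rat_op (F ij.1 ij.2) A x - lL.2 x) <= d * rnorm x].
  move=> ij; have [l [L hL]] := approx_ratfun r1 Ab Bb AK BK Ar Br (Fb ij.1 ij.2) d0.
  by exists (l, L).
have /choice[D hD] : forall ij : 'I_n * 'I_n, exists D, forall N, (D <= N)%N ->
    exists a : int -> C, [/\ forall k, (N < `|k|)%N -> a k = 0,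
      forall z, z != 0 -> (l ij).1 z = zsum N (fun k => z ^ k * a k) &
      forall x, (l ij).2 x = zsum N (fun k => a k *: opz A B k x)].
  by move=> ij; have [lL _ _] := hl ij; exact: (laurent_zsum Ab Bb AK lL).
pose N := (\sum_ij D ij)%N.
have /choice[a ha] : forall ij : 'I_n * 'I_n, exists a : int -> C,
    [/\ forall k, (N < `|k|)%N -> a k = 0,
      forall z, z != 0 -> (l ij).1 z = zsum N (fun k => z ^ k * a k) &
      forall x, (l ij).2 x = zsum N (fun k => a k *: opz A B k x)].
  by move=> ij; apply: hD; rewrite /N (bigD1 ij)//= leq_addr.
pose am k : 'M[C]_n := \matrix_(i, j) a (i, j) k.
pose S' := S + m * d + d.
have S'0 : 0 < S' by rewrite ltr_wpDl// addr_ge0// mulr_ge0// ltW.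
have am0 k : (N < `|k|)%N -> am k = 0.
  by move=> Nk; apply/matrixP => i j; rewrite !mxE; have [->] := ha (i, j).
have amle (z : C) : r^-1 <= rnorm z <= r -> forall v : 'cV_n,
    l2norm (zsum N (fun k => z ^ k *: am k) *m v) <= S' * l2norm v.
  move=> Xz v; set L := zsum N _; have z0 := annulus_neq0 r1 Xz.
  have Lij i j : L i j = (l (i, j)).1 z.
    have [_ lE _] := ha (i, j); rewrite lE// /L /zsum summxE; apply: eq_bigr => k _.
    by rewrite !mxE.
  have -> : L *m v = ratmx_eval F z *m v + (L - ratmx_eval F z) *m v.
    by rewrite -mulmxDl [ratmx_eval F z + _]addrC subrK.
  apply: (le_trans (l2norm_triangle _ _)).
  have h1 := ratmx_supnorm_ge Fb v Xz.
  have h2 : l2norm ((L - ratmx_eval F z) *m v) <= m * d * l2norm v.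
    apply: mx_norm_le_entries; first exact: ltW.
    move=> i j; rewrite !mxE Lij rnormB; have [_ + _] := hl (i, j); exact.
  apply: (le_trans (lerD h1 h2)); rewrite /S' !mulrDl lerDl.
  exact: mulr_ge0 (ltW d0) (l2norm_ge0 v).
pose w : 'cV[H]_n := \col_i \sum_j (l (i, j)).2 (x j 0).
have wle : l2norm w <= K * S' * l2norm x.
  apply: form_bound; first exact: mulr_gt0.
  move=> y; rewrite sqr_l2norm.
  have := laurent_form_le r1 Ab.1 Bb.1 AK BK Ar Br (fun j => x j 0) y S'0 am0 amle.
  rewrite -/K; suff -> : zsum N (fun k => mform (am k)
      (fun x y => hinner (opz A B k x) y) (fun j => x j 0) y) =
      \sum_i hinner (w i 0) (y i) by [].
  have ipS := psd_sesqui (@hinner_psd R H).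
  rewrite /zsum exchange_big; apply: eq_bigr => i _ /=.
  rewrite exchange_big mxE (sesqui_suml ipS); apply: eq_bigr => j _ /=.
  have [_ _ LE] := ha (i, j); rewrite LE /zsum (sesqui_suml ipS).
  by apply: eq_bigr => k _; rewrite (sesquiZl ipS) mxE.
have -> : opmx_apply (ratmx_op F A) x = w + (opmx_apply (ratmx_op F A) x - w).
  by rewrite [w + _]addrC subrK.
apply: (le_trans (l2norm_triangle _ _)); rewrite mulrDl lerD//.
apply: l2norm_entries_le; first exact: ltW.
move=> i; rewrite !mxE -sumrB; apply: (le_trans (rnorm_sum _ _ _)).
apply: ler_sum => j _; rewrite mxE; have [_ _ +] := hl (i, j); exact.
Qed.

End UpperBound.

(** * The lower bound *)

Section LowerBound.
Variables (R : realType) (r : R).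
Hypothesis r1 : 1 < r.
Local Notation C := R[i].
Let r0 : 0 < r. Proof. exact: lt_trans r1. Qed.
Let g := r ^- 2.
Let g0 : 0 < g. Proof. by rewrite invr_gt0 exprn_gt0. Qed.
Let g1 : g < 1. Proof. by rewrite invf_lt1 ?exprn_gt0// exprn_egt1. Qed.

(** The filled ellipse of semi-axes [r - r^-1] and [r + r^-1] is the image of the
    annulus by [z - z^-1]; [xi] and [ups] are the squares of the coordinates, and
    [tau] that of the small semi-axis. *)
Lemma ellipse_le (xi ups tau : R) : 0 <= xi -> 0 <= ups -> g * tau = (1 - g) ^+ 2 ->
  xi * (tau + 4) + ups * tau <= tau * (tau + 4) ->
  g * (1 - g ^+ 3) ^+ 2 * (xi + ups) <=
    ((1 - g ^+ 2) ^+ 2 - g ^+ 2 * (xi - ups)) ^+ 2 + 4 * g ^+ 4 * xi * ups.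
Proof.
move=> xi0 ups0 gt le_ell.
set s := xi + ups; pose w := (1 - g) * (1 - g ^+ 3).
have g2 : 0 <= g ^+ 2 by exact: sqr_ge0.
have g31 : 0 < 1 - g ^+ 3 by rewrite subr_gt0 exprn_ilt1// ltW.
have w0 : 0 < w by rewrite mulr_gt0// subr_gt0.
have wE : (1 - g ^+ 2) ^+ 2 - g ^+ 2 * tau = w.
  by rewrite expr2 -[g * g * tau]mulrA gt /w; ring.
have ktau : g * (1 - g ^+ 3) ^+ 2 * tau = w ^+ 2.
  by rewrite mulrAC gt /w; ring.
have -> : ((1 - g ^+ 2) ^+ 2 - g ^+ 2 * (xi - ups)) ^+ 2 + 4 * g ^+ 4 * xi * ups =
    (w - g ^+ 2 * (s - tau)) ^+ 2 + 4 * (1 - g ^+ 2) ^+ 2 * g ^+ 2 * ups.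
  by rewrite -wE /s; ring.
have last0 : 0 <= 4 * (1 - g ^+ 2) ^+ 2 * g ^+ 2 * ups.
  by apply: mulr_ge0 => //; apply: mulr_ge0 => //; apply: mulr_ge0 => //; exact: sqr_ge0.
have [st|ts] := leP s tau.
  apply: (@le_trans _ _ (w ^+ 2)).
    rewrite -ktau; apply: ler_wpM2l => //; apply: mulr_ge0; [exact: ltW | exact: sqr_ge0].
  have wst : w <= w - g ^+ 2 * (s - tau).
    by rewrite lerDl -mulrN opprB mulr_ge0// subr_ge0.
  apply: ler_wpDr => //; apply: lerXn2r => //; rewrite nnegrE; first exact: ltW.
  by apply: le_trans wst; exact: ltW.
set h := s - tau; have h0 : 0 < h by rewrite subr_gt0.
have ups_ge : (tau + 4) * h <= 4 * ups by rewrite /h /s; lra.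
have low : (1 - g ^+ 2) ^+ 2 * g ^+ 2 * ((tau + 4) * h) <=
    (1 - g ^+ 2) ^+ 2 * g ^+ 2 * (4 * ups).
  apply: ler_wpM2l => //; apply: mulr_ge0 => //; exact: sqr_ge0.
have lowE : (1 - g ^+ 2) ^+ 2 * g ^+ 2 * ((tau + 4) * h) =
    (1 - g ^+ 2) ^+ 2 * g * (1 + g) ^+ 2 * h.
  have -> : (1 + g) ^+ 2 = g * tau + 4 * g by rewrite gt; ring.
  by ring.
rewrite lowE in low.
have kE : g * (1 - g ^+ 3) ^+ 2 * s = w ^+ 2 + g * (1 - g ^+ 3) ^+ 2 * h.
  by rewrite -ktau -mulrDr /h; congr (_ * _); rewrite addrC subrK.
rewrite kE.
have slope : 0 <= g ^+ 3 * (1 - g) ^+ 2 * h.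
  apply: mulr_ge0; last exact: ltW.
  by apply: mulr_ge0; [apply: exprn_ge0; exact: ltW | exact: sqr_ge0].
have sq : 0 <= (g ^+ 2 * h) ^+ 2 by exact: sqr_ge0.
apply: (@le_trans _ _ ((w - g ^+ 2 * h) ^+ 2 +
    (1 - g ^+ 2) ^+ 2 * g * (1 + g) ^+ 2 * h)); last by rewrite lerD2l; lra.
rewrite -subr_ge0; apply: (le_trans (addr_ge0 slope sq)).
by rewrite le_eqVlt; apply/orP; left; apply/eqP; rewrite /w; ring.
Qed.

Let p : C := (g ^+ 2)%:C%C.

Let sq1 : {poly C} := 'X^2 - 1%:P.
(** With [zeta := z - z^-1] and [p := r ^- 4], the test function is
    [zeta / ((1 - p) ^+ 2 - p zeta ^+ 2)]. It is the first factor of the infinite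
    product for the Ahlfors function of the annulus with zeros at [1] and [-1]: the
    denominator is [(1 - p z ^+ 2) (1 - p z ^- 2)]. *)
Definition extremal_num : {poly C} := 'X * sq1.
Definition extremal_den : {poly C} := ((1 - p) ^+ 2) *: 'X^2 - p *: sq1 ^+ 2.
Definition extremal : ratfun R := (extremal_num, extremal_den).

Lemma extremal_ineq (z : C) : annulus r z ->
  r^-1 * (1 - g ^+ 3) * rnorm extremal_num.[z] <= rnorm extremal_den.[z].
Proof.
move=> Xz; have z0 := annulus_neq0 r1 Xz; have /andP[zl zu] := Xz.
pose zeta := z - z^-1.
have zz : z ^+ 2 - 1 = z * zeta by rewrite /zeta mulrBr divff.
have X2 : sq1.[z] = z ^+ 2 - 1 by rewrite hornerD hornerN hornerXn hornerC.
have numE : extremal_num.[z] = z ^+ 2 * zeta.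
  by rewrite /extremal_num hornerM hornerX X2 zz expr2 mulrA.
have denE : extremal_den.[z] = z ^+ 2 * ((1 - p) ^+ 2 - p * zeta ^+ 2).
  have e (u v m c : C) : m * u ^+ 2 - c * (u * v) ^+ 2 = u ^+ 2 * (m - c * v ^+ 2) by ring.
  by rewrite /extremal_den hornerD hornerN !hornerZ !horner_exp hornerX X2 zz; exact: e.
rewrite numE denE (rnormM (z ^+ 2) zeta) (rnormM (z ^+ 2) (_ - _)) mulrCA; apply: ler_wpM2l; first exact: rnorm_ge0.
have q0 : 0 < r^-1 by rewrite invr_gt0.
have g31 : 0 < 1 - g ^+ 3 by rewrite subr_gt0 exprn_ilt1// ltW.
have c0 : 0 <= r^-1 * (1 - g ^+ 3) by rewrite mulr_ge0// ltW.
have zc0 : 0 <= r^-1 * (1 - g ^+ 3) * rnorm zeta by rewrite mulr_ge0 ?rnorm_ge0.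
rewrite -(@ler_pXn2r _ 2) ?nnegrE ?rnorm_ge0//.
pose n := rnorm z ^+ 2.
have n0 : 0 < n by rewrite exprn_gt0// (lt_le_trans _ zl).
have nl : g <= n by rewrite /g -exprVn; apply: lerXn2r; rewrite ?nnegrE ?rnorm_ge0 ?(ltW q0).
have nu : n <= r ^+ 2 by apply: lerXn2r; rewrite ?nnegrE ?rnorm_ge0 ?(ltW r0).
pose a := Re z; pose b := Im z.
have nE : n = a ^+ 2 + b ^+ 2 by rewrite /n sqr_rnorm.
have zetaE : zeta = (a * (1 - n^-1) +i* (b * (1 + n^-1)))%C.
  have zV : z^-1 = (n^-1)%:C%C * z^*.
    apply: (mulfI z0); rewrite divff// mulrCA mul_conj -rmorphM /= mulVf ?gt_eqF//.
  rewrite /zeta zV conjCE /a /b; case: (z) => x y /=; simpc.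
  by congr Complex; ring.
have gr : g * r ^+ 2 = 1 by rewrite mulVf// gt_eqF// exprn_gt0.
pose tau := g + r ^+ 2 - 2.
have tauE : g * tau = (1 - g) ^+ 2.
  by rewrite /tau mulrBr mulrDr gr; ring.
have nV : n + n^-1 <= tau + 2.
  have : 0 <= (r ^+ 2 - n) * (n - g) / n.
    by apply: divr_ge0; [apply: mulr_ge0; rewrite subr_ge0 | exact: ltW].
  have -> : (r ^+ 2 - n) * (n - g) / n = r ^+ 2 - (g * r ^+ 2) / n - n + g.
    by field; rewrite gt_eqF.
  by rewrite gr div1r /tau; lra.
have := @ellipse_le ((a * (1 - n^-1)) ^+ 2) ((b * (1 + n^-1)) ^+ 2) tau
  (sqr_ge0 _) (sqr_ge0 _) tauE.
have nV0 : 0 < n^-1 by rewrite invr_gt0.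
have nn : n * n^-1 = 1 by rewrite divff// gt_eqF.
pose s := n + n^-1.
have s2 : 0 <= s - 2.
  rewrite (_ : s - 2 = (n - 1) ^+ 2 / n); last by rewrite /s; field; rewrite gt_eqF.
  by apply: divr_ge0; [exact: sqr_ge0 | exact: ltW].
have tau0 : 0 <= tau by rewrite -/s in nV; lra.
have ell : (a * (1 - n^-1)) ^+ 2 * (tau + 4) + (b * (1 + n^-1)) ^+ 2 * tau <= tau * (tau + 4).
  have -> : (a * (1 - n^-1)) ^+ 2 = a ^+ 2 / n * (s - 2) by rewrite /s; field; rewrite gt_eqF.
  have -> : (b * (1 + n^-1)) ^+ 2 = b ^+ 2 / n * (s + 2) by rewrite /s; field; rewrite gt_eqF.
  have ab : a ^+ 2 / n + b ^+ 2 / n = 1 by rewrite -mulrDl -nE divff// gt_eqF.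
  have a2 : 0 <= a ^+ 2 / n by apply: divr_ge0; [exact: sqr_ge0 | exact: ltW].
  have b2 : 0 <= b ^+ 2 / n by apply: divr_ge0; [exact: sqr_ge0 | exact: ltW].
  rewrite -/s in nV.
  have h1 : (s - 2) * (tau + 4) <= tau * (tau + 4) by rewrite ler_wpM2r; lra.
  have h2 : (s + 2) * tau <= tau * (tau + 4) by rewrite mulrC ler_wpM2l; lra.
  have := lerD (ler_wpM2l a2 h1) (ler_wpM2l b2 h2).
  by rewrite -[X in _ <= X]mulrDl ab mul1r !mulrA.
move=> /(_ ell) h; rewrite [leLHS]exprMn [X in X * _]exprMn [r^-1 ^+ 2]exprVn -/g.
have -> : rnorm zeta ^+ 2 = (a * (1 - n^-1)) ^+ 2 + (b * (1 + n^-1)) ^+ 2.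
  by rewrite sqr_rnorm zetaE.
apply: (le_trans h).
have pE : (1 - p) ^+ 2 = ((1 - g ^+ 2) ^+ 2)%:C%C by rewrite rmorphXn rmorphB.
rewrite zetaE pE /p [in leRHS]sqr_rnorm expr2.
set x := a * _; set y := b * _; simpc; rewrite /=.
by rewrite le_eqVlt; apply/orP; left; apply/eqP; ring.
Qed.

(** The Jordan block with off-diagonal entry [t = r - r^-1] and its inverse both have
    norm [r]. *)
Definition shear (t : C) (v : plane R) : plane R := (v.1 + t * v.2, v.2).

Lemma shear_linear t : linear (shear t).
Proof.
move=> c u v; rewrite /shear; apply/eqP; rewrite xpair_eqE; apply/andP; split => //.
by apply/eqP => /=; rewrite -[c *: u.1]/(c * u.1) -[c *: u.2]/(c * u.2) -[c *: (_ + _)]/(c * (_ + _)); ring.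
Qed.

Lemma sqr_rnorm_plane (v : plane R) :
  rnorm v ^+ 2 = rnorm v.1 ^+ 2 + rnorm v.2 ^+ 2.
Proof. by rewrite rnorm_planeE sqr_sqrtr// addr_ge0 ?sqr_ge0. Qed.

Let t := r - r^-1.
Let t0 : 0 < t. Proof. by rewrite subr_gt0 (lt_trans _ r1)// invf_lt1. Qed.

Lemma shear_coord_le (s x y : R) : s ^+ 2 = t ^+ 2 ->
  (x + s * y) ^+ 2 + y ^+ 2 <= r ^+ 2 * (x ^+ 2 + y ^+ 2).
Proof.
move=> /eqP; rewrite eqf_sqr => st.
have e1 : r ^+ 2 * (x ^+ 2 + y ^+ 2) - ((x + t * y) ^+ 2 + y ^+ 2) =
    t * r * (x - y / r) ^+ 2 by rewrite /t; field; rewrite gt_eqF.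
have e2 : r ^+ 2 * (x ^+ 2 + y ^+ 2) - ((x + - t * y) ^+ 2 + y ^+ 2) =
    t * r * (x + y / r) ^+ 2 by rewrite /t; field; rewrite gt_eqF.
have tr : 0 <= t * r by rewrite mulr_ge0// ltW.
by rewrite -subr_ge0; case/orP: st => /eqP ->; rewrite ?e1 ?e2 mulr_ge0 ?sqr_ge0.
Qed.

Lemma shear_le (s : R) v : s ^+ 2 = t ^+ 2 ->
  rnorm (shear s%:C%C v) <= r * rnorm v.
Proof.
move=> st; have rv : 0 <= r * rnorm v by rewrite mulr_ge0 ?rnorm_ge0// ltW.
rewrite -(@ler_pXn2r _ 2) ?nnegrE ?rnorm_ge0// exprMn !sqr_rnorm_plane !sqr_rnorm /=.
case: v {rv} => -[a b] [c d] /=; rewrite !mul0r subr0 addr0.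
by have := shear_coord_le a c st; have := shear_coord_le b d st; lra.
Qed.

Lemma bounded_shear (s : R) : s ^+ 2 = t ^+ 2 -> bounded_operator (shear s%:C%C).
Proof.
move=> st; apply/bounded_operatorP; split; first exact: shear_linear.
by exists r; [exact: ltW | move=> v; exact: shear_le].
Qed.

Let T := shear t%:C%C.

Lemma shear_opinv : is_opinv T (shear (- t)%:C%C).
Proof.
apply: is_opinvP; first by apply: bounded_shear; rewrite sqrrN.
- by move=> [x y]; rewrite /T /shear /= rmorphN mulNr addrK.
- by move=> [x y]; rewrite /T /shear /= rmorphN mulNr subrK.
Qed.

Lemma shear_annulus : annulus_operator r T.
Proof.
split; [exact: bounded_shear | by exists (shear (- t)%:C%C); exact: shear_opinv |..].
  by apply: opnorm_le; [exact: shear_linear | exact: ltW | move=> v; exact: shear_le].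
rewrite (opinvE shear_opinv); apply: opnorm_le; [exact: shear_linear | exact: ltW |].
by move=> v; apply: shear_le; rewrite sqrrN.
Qed.

Lemma op_poly_shear (f : {poly C}) v :
  op_poly f T v = (f.[1] * v.1 + t%:C%C * f^`().[1] * v.2, f.[1] * v.2).
Proof.
elim/poly_ind: f v => [|f c IH] v.
  by rewrite -[0 : {poly C}]/(0%:P) op_polyC scale0r derivC !hornerC !mul0r mulr0 mul0r addr0.
rewrite op_polyD op_polyMX op_polyC IH derivD derivM derivX derivC addr0 mulr1.
rewrite !hornerD !hornerM hornerX hornerC !mulr1 /T /shear /=.
case: v => x y /=; rewrite -[c *: (x, y)]/(c * x, c * y).
have e1 (a b d e h k : C) : a * (h + e * k) + e * b * k + d * h =
    (a + d) * h + e * (b + a) * k by ring.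
by congr pair => /=; [exact: e1 | rewrite mulrDl].
Qed.

Lemma extremal_den_neq0 z : annulus r z -> extremal_den.[z] != 0.
Proof.
move=> Xz; have z0 := annulus_neq0 r1 Xz; have := extremal_ineq Xz.
have g31 : 0 < 1 - g ^+ 3 by rewrite subr_gt0 exprn_ilt1// ltW.
have c0 : 0 < r^-1 * (1 - g ^+ 3) by rewrite mulr_gt0// invr_gt0.
move=> le1; apply/eqP => d0; move: le1; rewrite d0 rnorm0 pmulr_rle0// => n0.
have {}n0 : extremal_num.[z] = 0.
  by apply/eqP; rewrite -rnorm_eq0 eq_le n0 rnorm_ge0.
move/eqP: n0; rewrite /extremal_num hornerM hornerX mulf_eq0 (negPf z0) /= => /eqP n0.
move: d0; rewrite /extremal_den hornerD hornerN !hornerZ !horner_exp hornerX n0.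
rewrite expr0n mulr0 subr0 => /eqP; rewrite mulf_eq0 !expf_eq0 /= (negPf z0) orbF.
rewrite -(rmorph1 (real_complex R)) -rmorphB (inj_eq (@complexI _)) subr_eq0 eq_sym.
by rewrite lt_eqF// exprn_ilt1// ltW.
Qed.

Lemma extremal_le z : annulus r z ->
  rnorm (rat_eval extremal z) <= r / (1 - g ^+ 3).
Proof.
move=> Xz; have g31 : 0 < 1 - g ^+ 3 by rewrite subr_gt0 exprn_ilt1// ltW.
have d0 : 0 < rnorm extremal_den.[z].
  by rewrite lt_neqAle rnorm_ge0 andbT eq_sym rnorm_eq0 extremal_den_neq0.
rewrite /rat_eval rnormM rnormV ler_pdivrMr//.
have c0 : 0 <= r / (1 - g ^+ 3) by apply: divr_ge0; exact: ltW.
have := ler_wpM2l c0 (extremal_ineq Xz); rewrite mulrA.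
rewrite (_ : _ / _ * (_ * _) = 1) ?mul1r//.
by field; rewrite !gt_eqF.
Qed.

Lemma extremal_bounded : rat_bounded (annulus r) extremal.
Proof.
split; first last.
- by exists (r / (1 - g ^+ 3)) => z; exact: extremal_le.
- exact: extremal_den_neq0.
apply: contraTneq isT => d0; have := extremal_den_neq0 (annulus1 r1).
by rewrite [extremal_den]d0 horner0 eqxx.
Qed.

(** [t] times the derivative of [extremal] at [1], divided by the bound of [extremal] on
    the annulus. *)
Definition lower_constant : R :=
  2 * (1 - g) * (1 - g ^+ 3) / (1 - g ^+ 2) ^+ 2.

Lemma lower_constant_gt : 2 / (1 + g) < lower_constant.
Proof.
have h1 : 0 < 1 + g by rewrite addr_gt0.
have h2 : 0 < 1 - g by rewrite subr_gt0.
have E : (1 - g ^+ 2) = (1 - g) * (1 + g) by ring.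
rewrite /lower_constant E -subr_gt0.
have -> : 2 * (1 - g) * (1 - g ^+ 3) / ((1 - g) * (1 + g)) ^+ 2 - 2 / (1 + g) =
   2 * g ^+ 2 / (1 + g) ^+ 2.
  by field; rewrite !gt_eqF.
by rewrite divr_gt0 ?exprn_gt0// mulr_gt0 ?exprn_gt0.
Qed.

(** [extremal] vanishes at [1], so that its value at [T] is [t] times its derivative
    [2 / (1 - g ^+ 2) ^+ 2] at [1] times the nilpotent part of [T]. *)
Lemma opnorm_extremal : 2 * t / (1 - g ^+ 2) ^+ 2 <= opnorm (rat_op extremal T).
Proof.
pose d := extremal_den.[1]; pose d' := extremal_den^`().[1].
have dE : d = ((1 - g ^+ 2) ^+ 2)%:C%C.
  rewrite /d /extremal_den hornerD hornerN !hornerZ !horner_exp hornerX expr1n mulr1.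
  rewrite /sq1 hornerD hornerN hornerXn hornerC expr1n subrr expr0n mulr0 subr0.
  by rewrite rmorphXn rmorphB.
have d0 : d != 0 by apply: extremal_den_neq0; exact: annulus1.
have [Bb TB BT] := shear_opinv; set B := shear _ in Bb TB BT.
have TK : cancel T B by move=> v; exact: (congr1 (@^~ v) BT).
have BK : cancel B T by move=> v; exact: (congr1 (@^~ v) TB).
have Tb : bounded_operator T by exact: bounded_shear.
have Tr v : rnorm (T v) <= r * rnorm v by exact: shear_le.
have Br v : rnorm (B v) <= r * rnorm v by apply: shear_le; rewrite sqrrN.
have [q0 qX _] := extremal_bounded.
have [W WT _] := approx_inv_poly r1 Tb Bb TK BK Tr Br q0 qX.
have [Wb _ WK] := WT.
have fb : bounded_operator (rat_op extremal T).
  by rewrite /rat_op (opinvE WT); apply: bounded_comp => //; exact: bounded_op_poly.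
pose e : plane R := (0, 1).
pose w : plane R := (- (t%:C%C * d' / d ^+ 2), d^-1).
have We : W e = w.
  have <- : op_poly extremal_den T w = e.
    rewrite op_poly_shear -/d -/d' /w /e; congr pair => /=; last by rewrite divff.
    by field.
  exact: (congr1 (@^~ w) WK).
have num1 : extremal_num.[1] = 0.
  by rewrite /extremal_num hornerM /sq1 hornerD hornerN hornerXn hornerC expr1n subrr mulr0.
have num1' : extremal_num^`().[1] = 2.
  rewrite /extremal_num derivM derivX mul1r hornerD hornerM hornerX mul1r.
  rewrite /sq1 derivB derivC subr0 derivXn hornerD hornerN hornerXn hornerC expr1n subrr add0r.
  by rewrite hornerMn hornerXn expr1n.
have fe : rat_op extremal T e = (t%:C%C * 2 * d^-1, 0).
  rewrite /rat_op (opinvE WT) /= We op_poly_shear num1 num1' /w /=.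
  by rewrite !mul0r add0r.
have ne : rnorm e = 1.
  by apply/eqP; rewrite -(@eqrXn2 _ 2) ?rnorm_ge0// sqr_rnorm_plane /= rnorm0 rnorm1 expr0n add0r expr1n.
have := rnorm_le_opnorm e fb; rewrite ne mulr1; apply: le_trans.
have -> : rnorm (rat_op extremal T e) = rnorm (t%:C%C * 2 * d^-1 : C).
  by apply/eqP; rewrite -(@eqrXn2 _ 2) ?rnorm_ge0// sqr_rnorm_plane fe /= rnorm0 expr0n addr0.
rewrite !rnormM rnormV dE !rnormC rnorm_nat !ger0_norm ?sqr_ge0 ?(ltW t0)//.
by rewrite [2 * t]mulrC.
Qed.

Lemma spectral_constants_ge K : spectral_constants r K -> lower_constant <= K.
Proof.
move=> hK; have [K0 _ Kf] := hK _ _ shear_annulus.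
have g31 : 0 < 1 - g ^+ 3 by rewrite subr_gt0 exprn_ilt1// ltW.
have g2 : 0 < 1 - g ^+ 2 by rewrite subr_gt0 exprn_ilt1// ltW.
have le1 := le_trans opnorm_extremal (Kf _ extremal_bounded).
have le2 : rat_supnorm (annulus r) extremal <= r / (1 - g ^+ 3).
  apply: ge_sup; first by exists (rnorm (rat_eval extremal 1)), 1 => //; exact: annulus1.
  by move=> _ [z Xz <-]; exact: extremal_le.
have le3 := le_trans le1 (ler_wpM2l (ltW K0) le2).
have c0 : 0 < (1 - g ^+ 3) / r by rewrite divr_gt0.
have := ler_wpM2r (ltW c0) le3.
have -> : K * (r / (1 - g ^+ 3)) * ((1 - g ^+ 3) / r) = K.
  by field; rewrite !gt_eqF.
congr (_ <= _); rewrite /lower_constant.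
have -> : 1 - g = t / r by rewrite /t /g; field; rewrite gt_eqF.
by field; rewrite !gt_eqF.
Qed.

End LowerBound.

(** * The spectral constants *)

Section Constants.
Variables (R : realType) (r : R).
Hypothesis r1 : 1 < r.
Local Notation C := R[i].
Let r0 : 0 < r. Proof. exact: lt_trans r1. Qed.

Lemma annulus_operatorP (H : hilbertType R) (A : H -> H) : annulus_operator r A ->
  exists B, [/\ bounded_operator A, bounded_operator B, cancel A B & cancel B A] /\
    (forall x, rnorm (A x) <= r * rnorm x) /\ (forall x, rnorm (B x) <= r * rnorm x).
Proof.
move=> [Ab Ai An Bn]; have [Bb AB BA] := op_invertibleP Ai; exists (opinv A).
split; [split => // x|split => x].
- by have := congr1 (@^~ x) BA.
- by have := congr1 (@^~ x) AB.
- by apply: (le_trans (rnorm_le_opnorm x Ab)); rewrite ler_wpM2r ?rnorm_ge0.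
- by apply: (le_trans (rnorm_le_opnorm x Bb)); rewrite ler_wpM2r ?rnorm_ge0.
Qed.

Lemma complete_constant_mem : complete_spectral_constants r (2 + upper_constant r).
Proof.
move=> H A /annulus_operatorP [B [[Ab Bb AK BK] [Ar Br]]].
have K0 : 0 < 2 + upper_constant r by rewrite ltr_wpDr// upper_constant_ge0.
split => //; first exact: (spectrum_annulus r1 Ab Bb AK BK Ar Br).
move=> n F _ Fb; apply: ge_sup.
  by exists (l2norm (opmx_apply (ratmx_op F A) 0)), 0 => //=; rewrite l2norm0.
move=> _ [x /= x1 <-].
apply: (le_trans (complete_bound r1 Ab Bb AK BK Ar Br x Fb)).
rewrite -[leRHS]mulr1 ler_wpM2l// mulr_ge0 ?(ltW K0)//; exact: ratmx_supnorm_ge0.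
Qed.

Lemma l2norm_cV1 (V : normedZmodType C) (x : 'cV[V]_1) : l2norm x = rnorm (x 0 0).
Proof. by rewrite /l2norm big_ord1 sqrtr_sqr ger0_norm ?rnorm_ge0. Qed.

Lemma complete_sub_spectral :
  complete_spectral_constants r `<=` spectral_constants r.
Proof.
move=> K hK H A hA; have [K0 AX Kf] := hK H A hA; split => // f fb.
have [B [[Ab Bb AK BK] [Ar Br]]] := annulus_operatorP hA.
pose F : 'M[ratfun R]_1 := const_mx f.
have Fb i j : rat_bounded (annulus r) (F i j) by rewrite mxE.
have fA : linear (rat_op f A) by exact: (rat_op_linear r1 Ab Bb AK BK Ar Br fb).
have [_ _ [M hM]] := fb.
have supf : has_ubound [set rnorm (rat_eval f z) | z in annulus r].
  by exists M => _ [z Xz <-]; exact: hM.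
apply: (@le_trans _ _ (opmx_norm (ratmx_op F A))).
  apply: ge_sup; first by exists (rnorm (rat_op f A 0)), 0 => //=; rewrite rnorm0.
  move=> _ [x /= x1 <-]; apply: ub_le_sup.
    exists ((2 + upper_constant r) * ratmx_supnorm (annulus r) F) => _ [y /= y1 <-].
    apply: (le_trans (complete_bound r1 Ab Bb AK BK Ar Br y Fb)).
    rewrite -[leRHS]mulr1 ler_wpM2l// mulr_ge0 ?ratmx_supnorm_ge0//.
    by rewrite addr_ge0 ?upper_constant_ge0.
  exists (const_mx x); first by rewrite /= l2norm_cV1 mxE.
  by rewrite l2norm_cV1 /opmx_apply mxE big_ord1 !mxE.
apply: (le_trans (Kf 1%N F isT Fb)); apply: ler_wpM2l; first exact: ltW.
apply: ge_sup.
  by exists (Defs.mx_norm (\matrix_(i, j) rat_eval (F i j) 1)), 1 => //; exact: annulus1.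
move=> _ [z Xz <-]; apply: (@le_trans _ _ (rnorm (rat_eval f z))); last first.
  by apply: ub_le_sup => //; exists z.
apply: mx_norm_le => [|v]; first exact: rnorm_ge0.
by rewrite !l2norm_cV1 mxE big_ord1 !mxE rnormM.
Qed.

(** The inequalities defining a spectral constant are closed, so that the infimum
    of the constants satisfies them. *)
Lemma inf_le_mul (S : set R) (a s : R) : S !=set0 -> (forall K, S K -> 0 <= K) ->
  0 <= s -> (forall K, S K -> a <= K * s) -> a <= inf S * s.
Proof.
move=> [K0 SK0] S0 s0 hS.
have [sz|sn] := eqVneq s 0.
  by have := hS K0 SK0; rewrite sz !mulr0.
have sp : 0 < s by rewrite lt_neqAle eq_sym sn.
rewrite -ler_pdivrMr//; apply: lb_le_inf; first by exists K0.
by move=> K SK; rewrite ler_pdivrMr//; exact: hS.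
Qed.

Lemma rat_supnorm_ge0 (f : ratfun R) : rat_bounded (annulus r) f ->
  0 <= rat_supnorm (annulus r) f.
Proof.
move=> [_ _ [M hM]]; apply: (@le_trans _ _ (rnorm (rat_eval f 1))).
  exact: rnorm_ge0.
apply: ub_le_sup; first by exists M => _ [z Xz <-]; exact: hM.
by exists 1 => //; exact: annulus1.
Qed.

Let lc0 : 0 < lower_constant r.
Proof.
apply: lt_trans (lower_constant_gt r1).
by rewrite divr_gt0// addr_gt0// invr_gt0 exprn_gt0.
Qed.

Let SC := spectral_constants r.
Let CC := complete_spectral_constants r.

Lemma spectral_constant_mem : SC (2 + upper_constant r).
Proof. exact: complete_sub_spectral complete_constant_mem. Qed.

Lemma Kspec_ge : lower_constant r <= Kspec r.
Proof.
apply: lb_le_inf; first by exists (2 + upper_constant r); exact: spectral_constant_mem.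
exact: spectral_constants_ge.
Qed.

Lemma Kcb_ge : Kspec r <= Kcb r.
Proof.
apply: lb_le_inf; first by exists (2 + upper_constant r); exact: complete_constant_mem.
move=> K CK; apply: ge_inf; last exact: complete_sub_spectral.
by exists (lower_constant r) => L; exact: spectral_constants_ge.
Qed.

Lemma Kspec_least : is_least SC (Kspec r).
Proof.
split; last first.
  by move=> K SK; apply: ge_inf => //; exists (lower_constant r) => L; exact: spectral_constants_ge.
move=> H A hA; split; first exact: lt_le_trans lc0 Kspec_ge.
  by have [] := spectral_constant_mem hA.
move=> f fb; apply: inf_le_mul.
- by exists (2 + upper_constant r); exact: spectral_constant_mem.
- by move=> K /spectral_constants_ge hK; apply: le_trans (hK r1); exact: ltW.
- exact: rat_supnorm_ge0.
- by move=> K SK; have [_ _] := SK H A hA; apply.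
Qed.

Lemma Kcb_least : is_least CC (Kcb r).
Proof.
have lb : has_lbound CC.
  by exists (lower_constant r) => L /complete_sub_spectral; exact: spectral_constants_ge.
split; last by move=> K SK; exact: ge_inf.
move=> H A hA; split; first exact: lt_le_trans lc0 (le_trans Kspec_ge Kcb_ge).
  by have [] := complete_constant_mem hA.
move=> n F n0 Fb; apply: inf_le_mul.
- by exists (2 + upper_constant r); exact: complete_constant_mem.
- move=> K /complete_sub_spectral /spectral_constants_ge hK.
  by apply: le_trans (hK r1); exact: ltW.
- exact: ratmx_supnorm_ge0.
- by move=> K SK; have [_ _] := SK H A hA; apply.
Qed.

End Constants.

Lemma sqrt_ratio_le (R : realType) (r : R) : 0 < r ->
  Num.sqrt ((r ^+ 2 + 2 * r + 1) / (r ^+ 2 + r + 1)) <= 2 / Num.sqrt 3.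
Proof.
move=> r0; have d0 : 0 < r ^+ 2 + r + 1 by rewrite !addr_gt0 ?exprn_gt0.
have -> : 2 / Num.sqrt 3 = Num.sqrt (4 / 3) :> R.
  by rewrite sqrtrM// sqrtrV// (_ : 4 = 2 ^+ 2) ?sqrtr_sqr ?ger0_norm//; ring.
rewrite ler_sqrt; last by rewrite divr_ge0.
by rewrite ler_pdivrMr// mulrAC ler_pdivlMr//; have := sqr_ge0 (r - 1); nra.
Qed.

Lemma two_div_sqrt3_lt (R : realType) : 2 + 2 / Num.sqrt 3 < 32 / 10 :> R.
Proof.
have s0 : 0 < Num.sqrt 3 :> R by rewrite sqrtr_gt0.
have s2 : Num.sqrt 3 ^+ 2 = 3 :> R by rewrite sqr_sqrtr.
have : 2 / Num.sqrt 3 < 12 / 10 :> R by rewrite ltr_pdivrMr//; nra.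
lra.
Qed.

Theorem theorem1p3 (R : realType) (r : R) (hr : 1 < r) :
  [/\ is_least (spectral_constants r) (Kspec r),
      is_least (complete_spectral_constants r) (Kcb r)
    & [/\ 2 / (1 + r ^- 2) < Kspec r,
          Kspec r <= Kcb r,
          Kcb r <= 2 + Num.min
            (Num.sqrt ((r ^+ 2 + 2 * r + 1) / (r ^+ 2 + r + 1)))
            (Num.sqrt ((r ^+ 2 + 1) / (r ^+ 2 - 1))),
          2 + Num.min
            (Num.sqrt ((r ^+ 2 + 2 * r + 1) / (r ^+ 2 + r + 1)))
            (Num.sqrt ((r ^+ 2 + 1) / (r ^+ 2 - 1))) <= 2 + 2 / Num.sqrt 3
        & 2 + 2 / Num.sqrt 3 < 32 / 10 :> R]].
Proof.
have [_ lbK] := Kcb_least hr.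
split; [exact: Kspec_least | exact: Kcb_least | split].
- exact: lt_le_trans (lower_constant_gt hr) (Kspec_ge hr).
- exact: Kcb_ge.
- exact: lbK (complete_constant_mem hr).
- by rewrite lerD2l ge_min sqrt_ratio_le// (lt_trans ltr01).
- exact: two_div_sqrt3_lt.
Qed.
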